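(* Let $h$ be a 2-dimensional metric in coordinates $(x,y)$ and let $g=k(h+dz^2)$ for some non-zero constant $k$. If $g$ is of non-constant curvature, the projective vector fields of $g$ are the vector fields $$v=u+(k_1z+k_0)\partial_z,$$ where $u$ is a homothetic vector field of $h$, and where $k_0,k_1\in\mathbb{R}$.
   Context: All objects are smooth and statements are local. A metric is a symmetric non-degenerate $(0,2)$-tensor field of arbitrary signature; the components of $h$ depend on $(x,y)$ only. A vector field is projective for $g$ if its local flow maps unparametrised geodesics of $g$ to unparametrised geodesics of $g$. A vector field $u$ (in the variables $x,y$) is homothetic for $h$ if $\mathcal{L}_uh=\lambda h$ for some constant $\lambda\in\mathbb{R}$ (possibly $\lambda=0$, and $u=0$ is allowed). *)

(* Defs.v *)
From HB Require Import structures.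
From mathcomp Require Import all_boot all_order all_algebra.
From mathcomp Require Import all_classical all_reals all_analysis.
Import Order.TTheory GRing.Theory Num.Theory.
Import numFieldNormedType.Exports.

Set Implicit Arguments.
Unset Strict Implicit.
Unset Printing Implicit Defensive.

Local Open Scope ring_scope.
Local Open Scope classical_set_scope.

(* Points and tangent vectors of R^n are row vectors 'rV[R]_n.  Tensor fields
   are given by their components in the standard coordinates; they are total
   functions, of which only the values on a given open set matter. *)

Definition pd (R : realType) (n : nat) (i : 'I_n) (f : 'rV[R]_n -> R) :
    'rV[R]_n -> R :=
  'D_(delta_mx 0 i) f.

Fixpoint Ck (R : realType) (n : nat) (U : set 'rV[R]_n) (k : nat)
    (f : 'rV[R]_n -> R) : Prop :=
  (forall p, U p -> {for p, continuous f}) /\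
  if k is k'.+1 then
    forall i : 'I_n,
      (forall p, U p -> derivable f p (delta_mx 0 i)) /\ Ck U k' (pd i f)
  else True.

Definition smooth (R : realType) (n : nat) (U : set 'rV[R]_n)
    (f : 'rV[R]_n -> R) : Prop :=
  forall k, Ck U k f.

Definition smooth_on_line (R : realType) (J : set R) (f : R -> R) : Prop :=
  forall k t, J t -> derivable (derive1n k f) t 1.

Definition is_metric (R : realType) (n : nat) (U : set 'rV[R]_n)
    (g : 'rV[R]_n -> 'M[R]_n) : Prop :=
  [/\ forall i j, smooth U (fun p => g p i j),
      forall p, U p -> (g p)^T = g p
    & forall p, U p -> g p \in unitmx].

Definition vector_field (R : realType) (n : nat) (U : set 'rV[R]_n)
    (v : 'rV[R]_n -> 'rV[R]_n) : Prop :=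
  forall i, smooth U (fun p => v p 0 i).

Section Curvature.
Variables (R : realType) (n : nat) (g : 'rV[R]_n -> 'M[R]_n).

(* [christoffel p i j k] is Gamma^i_{jk}. *)
Definition christoffel (p : 'rV[R]_n) (i j k : 'I_n) : R :=
  2^-1 * \sum_l invmx (g p) i l *
    (pd j (fun q => g q l k) p + pd k (fun q => g q l j) p
     - pd l (fun q => g q j k) p).

(* [riemann p i j k l] is R^i_{jkl}, where
   R(X,Y)Z = nabla_X nabla_Y Z - nabla_Y nabla_X Z - nabla_[X,Y] Z
   has components R^i_{jkl} Z^j X^k Y^l. *)
Definition riemann (p : 'rV[R]_n) (i j k l : 'I_n) : R :=
  pd k (fun q => christoffel q i l j) p - pd l (fun q => christoffel q i k j) p
  + \sum_m (christoffel p i k m * christoffel p m l j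
            - christoffel p i l m * christoffel p m k j).

Definition inner (p X Y : 'rV[R]_n) : R :=
  \sum_i \sum_j g p i j * X 0 i * Y 0 j.

Definition curvature_op (p X Y Z : 'rV[R]_n) : 'rV[R]_n :=
  \row_i \sum_j \sum_k \sum_l riemann p i j k l * Z 0 j * X 0 k * Y 0 l.

(* Nonzero exactly when X and Y span a nondegenerate plane. *)
Definition gram (p X Y : 'rV[R]_n) : R :=
  inner p X X * inner p Y Y - inner p X Y ^+ 2.

Definition sectional_curvature (p X Y : 'rV[R]_n) : R :=
  inner p (curvature_op p X Y Y) X / gram p X Y.

Definition constant_curvature (D : set 'rV[R]_n) : Prop :=
  exists kappa : R, forall p X Y, D p -> gram p X Y != 0 ->
    sectional_curvature p X Y = kappa.

End Curvature.

(* An affinely parametrised geodesic; constant curves are excluded. *)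
Definition geodesic (R : realType) (n : nat) (g : 'rV[R]_n -> 'M[R]_n)
    (D : set 'rV[R]_n) (J : set R) (c : R -> 'rV[R]_n) : Prop :=
  forall t, J t ->
    [/\ D (c t), derivable c t 1, derivable (derive1 c) t 1, derive1 c t != 0
      & forall i, derive1 (derive1 c) t 0 i
          + \sum_j \sum_k
              christoffel g (c t) i j k * derive1 c t 0 j * derive1 c t 0 k = 0].

Definition open_interval (R : realType) (J : set R) : Prop :=
  open J /\ is_interval J.

(* A curve which is a geodesic up to a change of parameter. *)
Definition unparametrised_geodesic (R : realType) (n : nat)
    (g : 'rV[R]_n -> 'M[R]_n) (D : set 'rV[R]_n) (J : set R)
    (gamma : R -> 'rV[R]_n) : Prop :=
  open_interval J /\
  exists (J' : set R) (c : R -> 'rV[R]_n) (tau : R -> R),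
    [/\ open_interval J', geodesic g D J' c, smooth_on_line J tau,
        tau @` J = J'
      & forall t, J t -> derive1 tau t != 0 /\ gamma t = c (tau t)].

(* [phi s p] is the integral curve of v through p at time s, for p in V and
   |s| < e.  Such phi exist near every point of D and are determined by v, V
   and e; their smoothness in (s, p) is automatic. *)
Definition local_flow (R : realType) (n : nat) (D : set 'rV[R]_n)
    (v : 'rV[R]_n -> 'rV[R]_n) (V : set 'rV[R]_n) (e : R)
    (phi : R -> 'rV[R]_n -> 'rV[R]_n) : Prop :=
  [/\ open V, V `<=` D, 0 < e
    & forall p, V p ->
        phi 0 p = p /\
        forall s, `|s| < e ->
          D (phi s p) /\ is_derive s 1 (fun r => phi r p) (v (phi s p))].

Definition projective_field (R : realType) (n : nat) (D : set 'rV[R]_n)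
    (g : 'rV[R]_n -> 'M[R]_n) (v : 'rV[R]_n -> 'rV[R]_n) : Prop :=
  forall V e phi, local_flow D v V e phi ->
  forall s, `|s| < e ->
  forall J gamma, unparametrised_geodesic g V J gamma ->
    unparametrised_geodesic g D J (fun t => phi s (gamma t)).

Definition lie_derivative (R : realType) (n : nat) (u : 'rV[R]_n -> 'rV[R]_n)
    (h : 'rV[R]_n -> 'M[R]_n) (p : 'rV[R]_n) : 'M[R]_n :=
  \matrix_(i, j) \sum_k
    (u p 0 k * pd k (fun q => h q i j) p
     + h p k j * pd i (fun q => u q 0 k) p
     + h p i k * pd j (fun q => u q 0 k) p).

Definition homothetic_field (R : realType) (n : nat) (U : set 'rV[R]_n)
    (h : 'rV[R]_n -> 'M[R]_n) (u : 'rV[R]_n -> 'rV[R]_n) : Prop :=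
  vector_field U u /\
  exists lambda : R, forall p, U p -> lie_derivative u h p = lambda *: h p.

(* Points of R^3 = R^(2+1): the coordinates (x,y) and z. *)
Definition xy (R : realType) (p : 'rV[R]_(2 + 1)) : 'rV[R]_2 := lsubmx p.

Definition zc (R : realType) (p : 'rV[R]_(2 + 1)) : R := rsubmx p 0 0.

Definition cylinder (R : realType) (U : set 'rV[R]_2) (I : set R) :
    set 'rV[R]_(2 + 1) :=
  [set p | U (xy p) /\ I (zc p)].

(* The matrix of k (h + dz^2). *)
Definition product_metric (R : realType) (k : R) (h : 'rV[R]_2 -> 'M[R]_2)
    (p : 'rV[R]_(2 + 1)) : 'M[R]_(2 + 1) :=
  k *: block_mx (h (xy p)) 0 0 (1%:M : 'M[R]_1).

(* The vector u + w d/dz. *)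
Definition vec3 (R : realType) (u : 'rV[R]_2) (w : R) : 'rV[R]_(2 + 1) :=
  row_mx u (w%:M : 'M[R]_1).

(* Main.v *)
Require Import Defs.
From HB Require Import structures.
From mathcomp Require Import all_boot all_order all_algebra.
From mathcomp Require Import all_classical all_reals all_analysis.
From mathcomp Require Import ring lra.
Import Order.TTheory GRing.Theory Num.Theory.
Import numFieldNormedType.Exports.

(** Along a vector field [v], the Levi-Civita connection has a Lie derivative,
    a symmetric tensor of type (1,2); write [L(X)] for the vector obtained by
    evaluating it at [(X,X)] ([lie_conn] below).  Let a curve be carried along
    by the flow of [v], with tangent [X] and covariant acceleration [E] at flow
    time [s].  Then [E] satisfies the linear equation
    [dE/ds = L(X) + (Dv) E] ([variation]).  Two consequences follow.
    - If [L = 0], then [E] stays zero once it is zero, so the flow maps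
      geodesics to geodesics ([lie_conn0_projective]).
    - If [v] is projective, then [E] stays a multiple of [X] along every
      geodesic, and the derivative at [s = 0] shows that [L(X)] is a multiple of
      [X] at every point, for every [X] ([projective_lie_conn]).
    Both rest on the differentiability of the flow in the initial point
    ([flow_derivative]), which follows from Gronwall's inequality, and the
    second also on local existence of solutions ([ode_local]), to have the flow
    and the geodesics.

    On the product, write [v = u + w d/dz] with [u] tangent to the slices
    [z = const], and [X = x + t d/dz].  For fixed [x], the condition that [L(X)]
    is parallel to [X] is a polynomial identity of degree three in [t], and its
    coefficients say ([split_conditions]) that, on every slice,
    - the 1-form [dw] is parallel for [h];
    - the Lie derivative of the connection of [h] along [u], at [(x,x)], is
      [2 (d_x d_z w) x];
    - the vector field [y = d_z u] satisfies [nabla y = (d_z^2 w / 2) id];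
    - [d_z y = 0].

    At a point where [h] is not flat, the curvature of [h] is a non-zero multiple
    of the generator of [so(h)], which is invertible ([nonflat_shape]).  The
    integrability condition of a parallel 1-form is that the curvature
    annihilates it, so [dw] vanishes at that point, hence on the whole slice,
    because it solves a linear first-order system on a connected set
    ([unique_continuation]).  Then [d_z^2 w] is constant on the slice, the
    curvature annihilates [y] too, and [y = 0] near the point; so
    [d_z^2 w = 0], and again [y = 0] on the slice.  Thus [w = k1 z + k0], the
    field [u] does not depend on [z], and it preserves the connection of [h].
    For such a field the tensor [L_u h] is parallel; being annihilated by the
    curvature, it is a multiple [lambda h] at the point, and unique continuation
    applied to [L_u h - lambda h] shows that [u] is homothetic
    ([affine_homothetic]).

    Conversely a homothetic field preserves the connection of [h]
    ([homothetic_affine]), and therefore [u + (k1 z + k0) d/dz] preserves that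
    of the product.  Finally, if [h] is flat everywhere then the product is flat,
    so non-constant curvature provides the point where [h] is not flat. *)

Local Open Scope ring_scope.
Local Open Scope classical_set_scope.

Set Implicit Arguments.
Unset Strict Implicit.
Unset Printing Implicit Defensive.

(** * Functions of class C^k on an open set *)

Lemma normr_coord (R : realType) (n : nat) (x : 'rV[R]_n) (i : 'I_n) :
  `|x 0 i| <= `|x|.
Proof.
rewrite [leRHS]/Num.Def.normr/= mx_normrE.
exact: (le_bigmax _ (fun ij => `|x ij.1 ij.2|) (0, i)).
Qed.

Lemma normr_rV_le (R : realType) (n : nat) (x : 'rV[R]_n) (e : R) :
  0 <= e -> (forall i, `|x 0 i| <= e) -> `|x| <= e.
Proof.
move=> e0 xe; rewrite [leLHS]/Num.Def.normr/= mx_normrE bigmax_le// => -[a b] _.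
by rewrite ord1.
Qed.

Section OneVariable.
Variable R : realType.

Lemma is_derive_line (V W : normedModType R) (f : V -> W) (p v : V) (s : R) :
  derivable f (s *: v + p) v ->
  is_derive s 1 (fun r : R => f (r *: v + p)) ('D_v f (s *: v + p)).
Proof.
have E : (fun h : R => h^-1 *: (f ((h *: 1 + s) *: v + p) - f (s *: v + p))) =
         (fun h : R => h^-1 *: (f (h *: v + (s *: v + p)) - f (s *: v + p))).
  by apply/funext => h; rewrite [h *: 1]mulr1 scalerDl addrA.
by move=> df; apply: DeriveDef; rewrite /derivable /derive /= E.
Qed.

Lemma mvt_between (f df : R -> R) (a b : R) :
  (forall t, 0 <= t <= 1 -> is_derive (a + t * (b - a)) 1 f (df (a + t * (b - a)))) ->
  exists2 t, 0 <= t <= 1 & f b - f a = df (a + t * (b - a)) * (b - a).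
Proof.
move=> fdf.
have D (t : R) : 0 <= t <= 1 ->
    is_derive t 1 (fun r => f (r *: (b - a) + a)) (df (a + t * (b - a)) * (b - a)).
  move=> /fdf; rewrite addrC -[t * _]/(t *: _) => d.
  have := @is_derive1_comp R f (fun r => r *: (b - a) + a) t _ (b - a) d.
  apply; apply: is_derive_eq.
  by rewrite scaler0 addr0 add0r [LHS]mulr1.
have [||t t01] := @MVT_segment R (fun r => f (r *: (b - a) + a))
   (fun t => df (a + t * (b - a)) * (b - a)) 0 1 ler01.
- by move=> x; rewrite in_itv/= => /andP[x0 x1]; apply: D; rewrite !ltW.
- apply: derivable_within_continuous => x; rewrite in_itv/= => x01.
  by have [] := D x x01.
rewrite scale1r subrK scale0r add0r subr0 mulr1 => ->.
by exists t => //; move: t01; rewrite in_itv.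
Qed.

End OneVariable.

Section Regularity.
Variables (R : realType) (n : nat).
Implicit Types (U : set 'rV[R]_n) (f g : 'rV[R]_n -> R) (p x y : 'rV[R]_n).

Lemma near_open U p (P : 'rV[R]_n -> Prop) : open U -> U p ->
  (forall q, U q -> P q) -> \forall q \near p, P q.
Proof. by move=> oU Up UP; apply: filterS UP _; exact: open_nbhs_nbhs. Qed.

Lemma pd_congr U f g p i : open U -> {in U, f =1 g} -> U p ->
  pd i f p = pd i g p.
Proof.
move=> oU fg Up; apply: near_eq_derive; apply: near_open Up _ => // q Uq.
by rewrite fg// inE.
Qed.

Lemma derivable_congr U f g p v : open U -> {in U, f =1 g} -> U p ->
  derivable f p v -> derivable g p v.
Proof.
move=> oU fg Up; apply: near_eq_derivable; apply: near_open Up _ => // q Uq.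
by rewrite fg// inE.
Qed.

Lemma continuous_congr U f g p : open U -> {in U, f =1 g} -> U p ->
  {for p, continuous f} -> {for p, continuous g}.
Proof.
move=> oU fg Up cf; have E : f p = g p by rewrite fg ?inE.
rewrite /prop_for /continuous_at -E; apply: cvg_trans cf.
apply: (near_eq_cvg (F := nbhs p)).
by apply: (near_open (P := fun q => f q = g q) oU Up) => q Uq; rewrite fg ?inE.
Qed.

Lemma Ck_congr U k f g : open U -> {in U, f =1 g} -> Ck U k f -> Ck U k g.
Proof.
elim: k f g => [|k IH] f g oU fg [cf df]; split=> //.
1,2: by move=> p Up; exact: continuous_congr fg Up (cf p Up).
move=> i; have [dfi Ci] := df i; split.
  by move=> p Up; apply: derivable_congr fg Up (dfi p Up).
by apply: IH Ci => // p; rewrite inE; exact: pd_congr.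
Qed.

Lemma Ck_continuous U k f p : Ck U k f -> U p -> {for p, continuous f}.
Proof. by case: k => [|k] [cf _]; exact: cf. Qed.

Lemma Ck_derivable U k f p i : Ck U k.+1 f -> U p -> derivable f p (delta_mx 0 i).
Proof. by move=> [_ /(_ i) [df _]]; exact: df. Qed.

Lemma Ck_pd U k f i : Ck U k.+1 f -> Ck U k (pd i f).
Proof. by move=> [_ /(_ i) []]. Qed.

Lemma CkW U k f : Ck U k.+1 f -> Ck U k f.
Proof.
elim: k f => [|k IH] f [cf df]; split=> // i.
by have [dfi Ci] := df i; split=> //; exact: IH.
Qed.


Lemma Ck_cst U k (a : R) : Ck U k (fun=> a).
Proof.
elim: k a => [|k IH] a; split=> //; try by move=> p _; exact: cst_continuous.
move=> i; split; first by move=> p _; exact: derivable_cst.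
have -> : pd i (fun=> a) = fun=> 0 :> R; last exact: IH.
by apply/funext => p; exact: derive_cst.
Qed.

Lemma CkD U k f g : open U -> Ck U k f -> Ck U k g ->
  Ck U k (fun p => f p + g p).
Proof.
move=> oU; elim: k f g => [|k IH] f g [cf df] [cg dg]; split=> //;
  try by move=> p Up; apply: (continuousD (f := f) (g := g)); [exact: cf|exact: cg].
move=> i; have [dfi Cf] := df i; have [dgi Cg] := dg i; split.
  by move=> p Up; apply: derivableD; [exact: dfi|exact: dgi].
apply: (Ck_congr oU _ (IH _ _ Cf Cg)) => p; rewrite inE => Up.
by rewrite /pd deriveD//; [exact: dfi|exact: dgi].
Qed.

Lemma CkM U k f g : open U -> Ck U k f -> Ck U k g ->
  Ck U k (fun p => f p * g p).
Proof.
move=> oU; elim: k f g => [|k IH] f g Cf Cg; have [cf df] := Cf;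
  have [cg dg] := Cg; split=> //;
  try by move=> p Up; apply: (continuousM (s := f) (t := g)); [exact: cf|exact: cg].
move=> i; have [dfi Cfi] := df i; have [dgi Cgi] := dg i; split.
  by move=> p Up; apply: derivableM; [exact: dfi|exact: dgi].
apply: (Ck_congr oU _ (CkD oU (IH _ _ (CkW Cf) Cgi) (IH _ _ (CkW Cg) Cfi))) => p.
by rewrite inE => Up; rewrite /pd deriveM//; [exact: dfi|exact: dgi].
Qed.

Lemma CkN U k f : open U -> Ck U k f -> Ck U k (fun p => - f p).
Proof.
move=> oU Cf; apply: (Ck_congr oU _ (CkM oU (Ck_cst U k (-1)) Cf)) => p _.
exact: mulN1r.
Qed.

Lemma CkB U k f g : open U -> Ck U k f -> Ck U k g ->
  Ck U k (fun p => f p - g p).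
Proof. by move=> oU Cf Cg; apply: CkD => //; exact: CkN. Qed.

Lemma Ck_sum U k (I : Type) (r : seq I) (P : pred I) (F : I -> 'rV[R]_n -> R) :
  open U -> (forall i, Ck U k (F i)) ->
  Ck U k (fun p => \sum_(i <- r | P i) F i p).
Proof.
move=> oU CF; elim: r => [|a r IH].
  by apply: (Ck_congr oU _ (Ck_cst U k 0)) => p _; rewrite big_nil.
apply: (Ck_congr oU _ (CkD oU (if P a as b return Ck U k (fun p => if b then F a p else 0)
  then CF a else Ck_cst U k 0) IH)) => p _; rewrite big_cons.
by case: (P a); rewrite ?add0r.
Qed.

Lemma Ck_prod U k (I : Type) (r : seq I) (P : pred I) (F : I -> 'rV[R]_n -> R) :
  open U -> (forall i, Ck U k (F i)) ->
  Ck U k (fun p => \prod_(i <- r | P i) F i p).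
Proof.
move=> oU CF; elim: r => [|a r IH].
  by apply: (Ck_congr oU _ (Ck_cst U k 1)) => p _; rewrite big_nil.
apply: (Ck_congr oU _ (CkM oU (if P a as b return Ck U k (fun p => if b then F a p else 1)
  then CF a else Ck_cst U k 1) IH)) => p _; rewrite big_cons.
by case: (P a); rewrite ?mul1r.
Qed.

Lemma CkV U k f : open U -> (forall p, U p -> f p != 0) -> Ck U k f ->
  Ck U k (fun p => (f p)^-1).
Proof.
move=> oU f0; elim: k f f0 => [|k IH] f f0 Cf; have [cf df] := Cf; split=> //;
  try by move=> p Up; apply: (continuousV (s := f)); [exact: f0|exact: cf].
move=> i; have [dfi Cfi] := df i; split.
  by move=> p Up; apply: derivableV; [exact: f0|exact: dfi].
have CV := IH _ f0 (CkW Cf).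
apply: (Ck_congr oU _ (CkN oU (CkM oU (CkM oU CV CV) Cfi))) => p.
rewrite inE => Up; rewrite /pd deriveV//; [|exact: f0|exact: dfi].
by rewrite -exprVn expr2 /GRing.scale /= mulNr.
Qed.

Lemma is_derive_coord p v (i : 'I_n) :
  is_derive p v (fun q : 'rV[R]_n => q 0 i) (v 0 i).
Proof.
have H := @derivable_id R _ p v.
apply: DeriveDef; first by have /derivable_mxP := H; exact.
by have := derive_mx H; rewrite derive_id => /matrixP/(_ 0 i); rewrite mxE => <-.
Qed.

Lemma Ck_coord U k (i : 'I_n) : open U -> Ck U k (fun p => p 0 i).
Proof.
move=> oU; case: k => [|k]; split=> //;
  try by move=> p Up; exact: coord_continuous.
move=> j; split=> [p _|]; first by have [] := is_derive_coord p (delta_mx 0 j) i.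
apply: (Ck_congr oU _ (Ck_cst U k ((delta_mx 0 j : 'rV[R]_n) 0 i))) => p _.
by rewrite /pd; have [_ ->] := is_derive_coord p (delta_mx 0 j) i.
Qed.

(** * Strict differentiability, the chain rule and symmetry of second derivatives *)

(** The increment is split into steps along the coordinate axes; the mean value
    theorem turns each step into a partial derivative at a point near [p], where it
    differs little from its value at [p]. *)
Lemma C1_strict U f p eta : open U -> Ck U 1 f -> U p -> 0 < eta ->
  exists2 rho, 0 < rho & forall x y, `|x - p| < rho -> `|y - p| < rho ->
    U x /\ `|f x - f y - \sum_i pd i f p * (x - y) 0 i| <= eta * `|x - y|.
Proof.
move=> oU Cf Up eta0.
have e0 : 0 < eta / n.+1%:R by rewrite divr_gt0.
have : \forall q \near p, U q /\ forall i, `|pd i f p - pd i f q| < eta / n.+1%:R.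
  apply: (filterI (F := nbhs p)); first exact: open_nbhs_nbhs.
  apply: (filter_forall (F := nbhs p)) => i; have [_ /(_ i) [_ [ci _]]] := Cf.
  by move/cvgrPdist_lt : (ci p Up) => /(_ _ e0).
move=> /nbhs_ballP [rho /= rho0 H].
have {}H q : `|q - p| < rho -> U q /\ forall i, `|pd i f p - pd i f q| < eta / n.+1%:R.
  by move=> qr; apply: H; rewrite -ball_normE /= distrC.
exists rho => // x y xr yr; split; first by have [] := H x xr.
(* [z k] has the first [k] coordinates of [x] and the others of [y]. *)
pose z k : 'rV[R]_n := \row_i (if (i < k)%N then x 0 i else y 0 i).
have z0 : z 0%N = y by apply/rowP => i; rewrite mxE ltn0.
have zn : z n = x by apply/rowP => i; rewrite mxE ltn_ord.
have zS (i : 'I_n) : z i.+1 = (x - y) 0 i *: delta_mx 0 i + z i.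
  apply/rowP => j; rewrite !mxE /=; case: (ltngtP j i) => [ji|ij|/val_inj ->].
  - by rewrite ltnS ltnW// (_ : (j == i) = false) ?andbF ?mulr0 ?add0r// -val_eqE /= ltn_eqF.
  - by rewrite ltnS leqNgt ij /= (_ : (j == i) = false) ?mulr0 ?add0r// -val_eqE /= gtn_eqF.
  - by rewrite ltnS leqnn eqxx mulr1 subrK.
have zr (i : 'I_n) t : 0 <= t <= 1 ->
    `|(0 + t * ((x - y) 0 i - 0)) *: delta_mx 0 i + z i - p| < rho.
  move=> /andP[t0 t1]; set m := Num.max `|x - p| `|y - p|.
  have mr : m < rho by rewrite gt_max xr.
  apply: le_lt_trans mr.
  have xm j : `|x 0 j - p 0 j| <= m.
    by have := normr_coord (x - p) j; rewrite !mxE => /le_trans; apply; rewrite le_max lexx.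
  have ym j : `|y 0 j - p 0 j| <= m.
    by have := normr_coord (y - p) j; rewrite !mxE => /le_trans; apply; rewrite le_max lexx orbT.
  apply: normr_rV_le => [|j]; first by rewrite le_max normr_ge0.
  rewrite !mxE /=; case: eqVneq => [->|ji]; last first.
    by rewrite mulr0 add0r; case: ifP.
  rewrite ltnn mulr1 add0r subr0.
  have -> : t * (x 0 i - y 0 i) + y 0 i - p 0 i =
    t * (x 0 i - p 0 i) + (1 - t) * (y 0 i - p 0 i) by ring.
  rewrite (le_trans (ler_normD _ _))// !normrM (ger0_norm t0).
  rewrite (ger0_norm (_ : 0 <= 1 - t)) ?subr_ge0//.
  have -> : m = t * m + (1 - t) * m by ring.
  by apply: lerD; apply: ler_wpM2l; rewrite ?subr_ge0.
have -> : f x - f y = \sum_(i < n) (f (z i.+1) - f (z i)).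
  by rewrite -z0 -zn -(telescope_sumr (fun i => f (z i)) (leq0n n)) big_mkord.
rewrite -sumrB (le_trans (ler_norm_sum _ _ _))//.
have S1 (i : 'I_n) : `|f (z i.+1) - f (z i) - pd i f p * (x - y) 0 i| <=
    eta / n.+1%:R * `|x - y|.
  have [|t t01 E] := @mvt_between R (fun s => f (s *: delta_mx 0 i + z i))
     (fun s => 'D_(delta_mx 0 i) f (s *: delta_mx 0 i + z i)) 0 ((x - y) 0 i).
  - move=> t t01; apply: is_derive_line.
    by apply: Ck_derivable Cf _; have [] := H _ (zr i t t01).
  have [_ /(_ i)/ltW Hi] := H _ (zr i t t01).
  rewrite zS; rewrite scale0r add0r in E; rewrite !subr0 in Hi E; rewrite E -mulrBl normrM distrC.
  rewrite ler_pM//; exact: normr_coord.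
apply: le_trans (ler_sum _ (fun i _ => S1 i)) _.
rewrite sumr_const card_ord -[leLHS]mulr_natl mulrA ler_wpM2r//.
by rewrite mulrCA ler_piMr ?(ltW eta0)// ler_pdivrMr// mul1r ler_nat.
Qed.

End Regularity.

Section Chain.
Variable R : realType.

Lemma is_derive_cvgP (V W : normedModType R) (f : V -> W) (x v : V) (l : W) :
  is_derive x v f l <->
  (fun h : R => h^-1 *: (f (h *: v + x) - f x)) @ 0^' --> l.
Proof.
split=> [[df <-]|fl]; first exact: df.
by apply: DeriveDef; [apply: cvgP fl|exact: cvg_lim fl].
Qed.

Lemma is_derive_rVP (V : normedModType R) (n : nat) (c : V -> 'rV[R]_n)
    (x v : V) (c' : 'rV[R]_n) :
  is_derive x v c c' <-> forall i, is_derive x v (fun y => c y 0 i) (c' 0 i).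
Proof.
split=> [[dc <-] i|dc].
  apply: DeriveDef; first by have /derivable_mxP := dc; exact.
  by rewrite derive_mx// mxE.
have d : derivable c x v.
  by apply/derivable_mxP => i j; rewrite ord1; have [] := dc j.
apply: DeriveDef => //; rewrite derive_mx//; apply/rowP => j.
by rewrite mxE; have [_ ->] := dc j.
Qed.

(** A curve through [c t] moves in two points near [c t], so strict
    differentiability of [f] there is all that the chain rule needs. *)
Lemma is_derive_chain (n : nat) (U : set 'rV[R]_n) (f : 'rV[R]_n -> R)
    (c : R -> 'rV[R]_n) (t : R) (c' : 'rV[R]_n) :
  open U -> Ck U 1 f -> U (c t) -> is_derive t 1 c c' ->
  is_derive t 1 (fun r => f (c r)) (\sum_i pd i f (c t) * c' 0 i).
Proof.
move=> oU Cf Uc dc; have cc : {for t, continuous c}.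
  by have [/derivable1_diffP/differentiable_continuous] := dc.
move/is_derive_cvgP : (dc) => qc; apply/is_derive_cvgP/cvgrPdist_le => e e0.
pose K := \sum_i `|pd i f (c t)|.
have K0 : 0 <= K by apply: sumr_ge0.
have eta0 : 0 < e / 2 / (`|c'| + 1) by rewrite !divr_gt0// ltr_wpDl.
have del0 : 0 < Num.min 1 (e / 2 / (K + 1)).
  by rewrite lt_min ltr01 !divr_gt0// ltr_wpDl.
have [rho rho0 S] := C1_strict oU Cf Uc eta0.
have Q := (cvgrPdist_le _ _).1 qc _ del0.
have N : \forall h \near (0 : R)^', `|c (h *: 1 + t) - c t| < rho.
  have /cvgrPdist_lt/(_ _ rho0)/nbhs_ballP[d /= d0 cd] := cc.
  near=> h; rewrite distrC; apply: cd; rewrite -ball_normE /= opprD addrCA subrr addr0.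
  by rewrite normrN [h *: 1]mulr1; near: h; exact: dnbhs0_lt.
have hn0 : \forall h \near (0 : R)^', h != 0 by exact: nbhs_dnbhs_neq.
near=> h.
have h0 : h != 0 by near: h.
have cr : `|c (h *: 1 + t) - c t| < rho by near: h.
have [_] := S (c (h *: 1 + t)) (c t) cr ltac:(by rewrite subrr normr0).
have : `|c' - h^-1 *: (c (h *: 1 + t) - c t)| <= Num.min 1 (e / 2 / (K + 1)).
  by near: h; exact: Q.
set d := c (h *: 1 + t) - c t; rewrite le_min => /andP[q1 q2] s.
have E1 : `|\sum_i pd i f (c t) * c' 0 i - h^-1 * (\sum_i pd i f (c t) * d 0 i)| <= e / 2.
  rewrite mulr_sumr -sumrB.
  have Si i : `|pd i f (c t) * c' 0 i - h^-1 * (pd i f (c t) * d 0 i)| <=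
     `|pd i f (c t)| * (e / 2 / (K + 1)).
    rewrite mulrCA -mulrBr normrM ler_wpM2l//; apply: le_trans q2.
    by have := normr_coord (c' - h^-1 *: d) i; rewrite !mxE.
  apply: le_trans (ler_norm_sum _ _ _) _.
  apply: le_trans (ler_sum _ (fun i _ => Si i)) _.
  rewrite -mulr_suml -/K mulrCA ler_piMr ?divr_ge0 ?(ltW e0)//.
  by rewrite ler_pdivrMr ?mul1r ?lerDl ?ltr_wpDl.
have E2 : `|h^-1 * (\sum_i pd i f (c t) * d 0 i) - h^-1 *: (f (c (h *: 1 + t)) - f (c t))| <= e / 2.
  rewrite -mulrBr normrM distrC; apply: le_trans (ler_wpM2l (normr_ge0 _) s) _.
  rewrite mulrCA -normrZ.
  have : `|h^-1 *: d| <= `|c'| + 1.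
    rewrite -[h^-1 *: d](subrK c') addrC (le_trans (ler_normD _ _))// lerD2l.
    by rewrite distrC.
  move=> H; apply: le_trans (ler_wpM2l (ltW eta0) H) _.
  by rewrite divfK// gt_eqF// ltr_wpDl.
rewrite [e]splitr; apply: le_trans (lerD E1 E2).
by rewrite -(subrKA (h^-1 * (\sum_i pd i f (c t) * d 0 i))) ler_normD.
Unshelve. all: by end_near. Qed.

Lemma is_derive_chain_rV (n m : nat) (U : set 'rV[R]_n) (f : 'rV[R]_n -> 'rV[R]_m)
    (c : R -> 'rV[R]_n) (t : R) (c' : 'rV[R]_n) :
  open U -> (forall j, Ck U 1 (fun p => f p 0 j)) -> U (c t) -> is_derive t 1 c c' ->
  is_derive t 1 (fun r => f (c r))
    (\row_j \sum_i pd i (fun p => f p 0 j) (c t) * c' 0 i).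
Proof.
move=> oU Cf Uc dc; apply/is_derive_rVP => j; rewrite mxE.
exact: (is_derive_chain oU (Cf j) Uc dc).
Qed.

(** The mean value theorem in the direction [i], followed by strict
    differentiability of [pd i f] in the direction [j].  The second difference is
    symmetric in [i] and [j] while the derivative on the right is not: comparing the
    two orders gives [pdC]. *)
Lemma second_difference (n : nat) (U : set 'rV[R]_n) (f : 'rV[R]_n -> R) p i j eta :
  open U -> Ck U 2 f -> U p -> 0 < eta ->
  exists2 rho, 0 < rho & forall h, 0 < h < rho ->
    `|f (h *: delta_mx 0 i + (h *: delta_mx 0 j + p)) - f (h *: delta_mx 0 i + p)
      - f (h *: delta_mx 0 j + p) + f p - h ^+ 2 * pd j (pd i f) p| <= eta * h ^+ 2.
Proof.
move=> oU Cf Up eta0.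
have [rho rho0 S] := C1_strict oU (Ck_pd i Cf) Up eta0.
exists (rho / 2); first by rewrite divr_gt0.
move=> h /andP[h0 hr].
have nd k (s : R) : `|s *: (delta_mx 0 k : 'rV[R]_n)| <= `|s|.
  by apply: normr_rV_le => // l; rewrite !mxE eqxx/=; case: eqP; rewrite ?mulr1 ?mulr0 ?normr0.
have hr2 : `|h| < rho / 2 by rewrite gtr0_norm.
have th t : 0 <= t <= 1 -> `|0 + t * (h - 0)| < rho / 2.
  move=> /andP[t0 t1]; rewrite add0r subr0 normrM (le_lt_trans _ hr2)//.
  by rewrite (ger0_norm t0) ler_piMl.
have in1 s : `|s| < rho / 2 -> `|s *: (delta_mx 0 i : 'rV[R]_n) + p - p| < rho.
  move=> sr; rewrite addrK (le_lt_trans (nd _ _))// (lt_trans sr)//.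
  by rewrite ltr_pdivrMr// ltr_pMr// ltr1n.
have in2 s : `|s| < rho / 2 ->
    `|s *: (delta_mx 0 i : 'rV[R]_n) + (h *: delta_mx 0 j + p) - p| < rho.
  move=> sr; rewrite addrA addrK (le_lt_trans (ler_normD _ _))//.
  by rewrite [rho]splitr ltrD// (le_lt_trans (nd _ _)).
have [|t t01 E] := @mvt_between R
    (fun s => f (s *: delta_mx 0 i + (h *: delta_mx 0 j + p)) - f (s *: delta_mx 0 i + p))
    (fun s => pd i f (s *: delta_mx 0 i + (h *: delta_mx 0 j + p)) -
              pd i f (s *: delta_mx 0 i + p)) 0 h.
- move=> t t01; apply: is_deriveB; apply: is_derive_line; apply: (Ck_derivable (CkW Cf)).
    by have [] := S _ _ (in2 _ (th t t01)) (in2 _ (th t t01)).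
  by have [] := S _ _ (in1 _ (th t t01)) (in1 _ (th t t01)).
rewrite !scale0r !add0r !subr0 in E.
have [_] := S _ _ (in2 _ (th t t01)) (in1 _ (th t t01)).
rewrite add0r subr0 opprD addrACA subrr add0r addrK.
have -> : \sum_k pd k (pd i f) p * (h *: delta_mx 0 j : 'rV[R]_n) 0 k = h * pd j (pd i f) p.
  rewrite (bigD1 j)//= big1 => [|k kj].
    by rewrite !mxE !eqxx/= mulr1 addr0 mulrC.
  by rewrite !mxE (negPf kj) andbF mulr0 mulr0.
move=> D; rewrite -[X in `|X - _|]/(_ - _ - _ + _).
have -> : f (h *: delta_mx 0 i + (h *: delta_mx 0 j + p)) - f (h *: delta_mx 0 i + p) -
   f (h *: delta_mx 0 j + p) + f p =
   f (h *: delta_mx 0 i + (h *: delta_mx 0 j + p)) - f (h *: delta_mx 0 i + p) -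
   (f (h *: delta_mx 0 j + p) - f p) by ring.
rewrite E expr2 -mulrA [X in `|X - _|]mulrC -mulrBr normrM (gtr0_norm h0) mulrCA.
rewrite ler_wpM2l ?(ltW h0)//; apply: le_trans D _.
by rewrite ler_wpM2l ?(ltW eta0)// (le_trans (nd _ _))// gtr0_norm.
Qed.

Lemma second_diff_gap (a b c q P Q u v : R) :
  `|a - b - c + q - P| <= u -> `|a - c - b + q - Q| <= v -> `|Q - P| <= u + v.
Proof.
by rewrite !ler_norml => /andP[? ?] /andP[? ?]; apply/andP; split; lra.
Qed.

Lemma pdC (n : nat) (U : set 'rV[R]_n) (f : 'rV[R]_n -> R) p i j :
  open U -> Ck U 2 f -> U p -> pd i (pd j f) p = pd j (pd i f) p.
Proof.
move=> oU Cf Up; apply/eqP; rewrite -subr_eq0 -normr_le0 leNgt; apply/negP => N0.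
set d := `|_| in N0.
have e0 : 0 < d / 4 by rewrite divr_gt0.
have [r1 r10 S1] := second_difference i j oU Cf Up e0.
have [r2 r20 S2] := second_difference j i oU Cf Up e0.
pose h := Num.min r1 r2 / 2.
have m0 : 0 < Num.min r1 r2 by rewrite lt_min r10.
have h0 : 0 < h by rewrite divr_gt0.
have hm : h < Num.min r1 r2 by rewrite /h ltr_pdivrMr// ltr_pMr// ltr1n.
move: (hm); rewrite lt_min => /andP[hr1 hr2].
have {}S1 := S1 h ltac:(by rewrite h0).
have {}S2 := S2 h ltac:(by rewrite h0).
have h2 : 0 < h ^+ 2 by rewrite exprn_gt0.
rewrite (addrCA (h *: delta_mx 0 j)) in S2.
have := second_diff_gap S1 S2.
rewrite -mulrBr normrM -/d (gtr0_norm h2) -mulrDl mulrC ler_pM2r//.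
by apply/negP; rewrite -ltNge; move: N0; clear; clearbody d; lra.
Qed.

End Chain.

Section Precomposition.
Variable R : realType.

Lemma lipschitz_continuous (V W : normedModType R) (f : V -> W) L : 0 <= L ->
  (forall x y, `|f x - f y| <= L * `|x - y|) -> continuous f.
Proof.
move=> L0 fL x; apply/cvgrPdist_le => e e0.
have d0 : 0 < e / (L + 1) by rewrite divr_gt0// ltr_wpDl.
near=> y; apply: le_trans (fL _ _) _.
apply: (@le_trans _ _ (L * (e / (L + 1)))).
  rewrite ler_wpM2l//; near: y; exact: (cvgrPdist_le _ _).1 _ _ d0.
by rewrite mulrCA ler_piMr ?(ltW e0)// ler_pdivrMr ?ltr_wpDl// mul1r lerDl.
Unshelve. all: by end_near. Qed.

Lemma contraction_continuous (V W : normedModType R) (A : V -> W) :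
  (forall x y, `|A x - A y| <= `|x - y|) -> continuous A.
Proof. by move=> AL; apply: (lipschitz_continuous ler01) => x y; rewrite mul1r. Qed.

Variables (m n : nat) (A : 'rV[R]_m -> 'rV[R]_n) (sigma : 'I_m -> option 'I_n).
Hypothesis A_contract : forall x y, `|A x - A y| <= `|x - y|.
Hypothesis A_delta : forall h i p,
  A (h *: delta_mx 0 i + p) = h *: oapp (delta_mx 0) 0 (sigma i) + A p.

(** The map [A] moves, for each basis direction of the source, either along one
    basis direction of the target or not at all; [sigma] records which.  Both the
    coordinate projections of a product and the inclusions of its slices are of
    this form. *)
Lemma pd_precomp (f : 'rV[R]_n -> R) i p :
  pd i (f \o A) p = oapp (fun j => pd j f (A p)) 0 (sigma i).
Proof.
rewrite /pd /derive; under eq_fun do rewrite /= A_delta.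
case: (sigma i) => [j|] //=.
under eq_fun do rewrite scaler0 add0r subrr scaler0.
exact: lim_cst.
Qed.

Lemma derivable_precomp (f : 'rV[R]_n -> R) i j p : sigma i = Some j ->
  derivable (f \o A) p (delta_mx 0 i) = derivable f (A p) (delta_mx 0 j).
Proof.
by move=> E; rewrite /derivable; under eq_fun do rewrite /= A_delta E /=.
Qed.

Lemma Ck_precomp (U : set 'rV[R]_n) k (f : 'rV[R]_n -> R) :
  Ck U k f -> Ck (A @^-1` U) k (f \o A).
Proof.
elim: k f => [|k IH] f [cf df]; split=> //.
1,2: move=> p Up; apply: continuous_comp; [exact: contraction_continuous|exact: cf].
move=> i; split=> [p Up|].
  case E : (sigma i) => [j|]; first by rewrite (derivable_precomp _ _ E); apply: (df j).1.
  rewrite /derivable; under eq_fun do rewrite /= A_delta E /= scaler0 add0r subrr scaler0.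
  exact: is_cvg_cst.
case E : (sigma i) => [j|].
  rewrite (_ : pd i (f \o A) = pd j f \o A); first by apply: IH; have [] := df j.
  by apply/funext => p; rewrite pd_precomp E.
rewrite (_ : pd i (f \o A) = fun=> 0); first exact: Ck_cst.
by apply/funext => p; rewrite pd_precomp E.
Qed.

End Precomposition.

(** * Gronwall's inequality *)

Section Gronwall.
Variable R : realType.

Lemma antiderivative_le (f f' : R -> R) (s : R) : 0 <= s ->
  (forall x, 0 <= x <= s -> is_derive x 1 f (f' x)) ->
  (forall x, 0 < x < s -> f' x <= 0) -> f s <= f 0.
Proof.
rewrite le_eqVlt => /predU1P[<-//|s0] df f'0.
have [| |x xs E] := @MVT R f f' 0 s s0.
- by move=> x; rewrite in_itv /= => /andP[? ?]; apply: df; rewrite !ltW.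
- apply: derivable_within_continuous => x; rewrite in_itv /= => xs.
  by have [] := df x xs.
rewrite in_itv /= in xs.
by rewrite -subr_le0 E subr0 mulr_le0_ge0 ?(ltW s0)// f'0.
Qed.

(** The differential inequality is required only while [N] stays below [r]: this
    is the situation of a curve close to a given one, where estimates hold in a tube.
    Since the resulting bound is itself below [r], the tube is never left. *)
Lemma gronwall_scalar (N N' : R -> R) (a A B r : R) :
  0 <= a -> 0 < A -> 0 <= N 0 -> 0 <= B ->
  (forall s, 0 <= s <= a -> is_derive s 1 N (N' s)) ->
  (forall s, 0 <= s <= a -> N s < r -> N' s <= A * N s + B) ->
  (N 0 + B / A) * expR (A * a) < r ->
  forall s, 0 <= s <= a -> N s + B / A <= (N 0 + B / A) * expR (A * a).
Proof.
move=> a0 A0 N0 B0 dN NA Nr.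
have BA0 : 0 <= B / A by rewrite divr_ge0// ltW.
have NB0 : 0 <= N 0 + B / A by rewrite addr_ge0.
(* The integrating factor: [M] is non-increasing as long as [N] is below [r]. *)
pose M s := (N s + B / A) * expR (- A * s).
pose M' s := (N' s - A * N s - B) * expR (- A * s).
have dM s : 0 <= s <= a -> is_derive s 1 M (M' s).
  move=> /dN dNs.
  have dE : is_derive s 1 (fun x => expR (- A * x)) (- A * expR (- A * s)).
    have dl : is_derive s 1 (fun x => - A * x) (- A).
      by apply: is_derive_eq; rewrite [LHS]mulr1.
    by have := is_derive1_comp (is_derive_expR (- A * s)) dl; rewrite mulrC.
  have dNB : is_derive s 1 (fun x => N x + B / A) (N' s + 0).
    exact: (is_deriveD dNs (is_derive_cst _ _ _)).
  have := is_deriveM dNB dE; congr is_derive.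
  rewrite /M' /GRing.scale /= addr0.
  have A1 : A != 0 by rewrite gt_eqF.
  by field.
have bound s : 0 <= s <= a -> (forall x, 0 <= x < s -> N x < r) ->
    N s + B / A <= (N 0 + B / A) * expR (A * a).
  move=> /andP[s0 sa] Nx.
  have := @antiderivative_le M M' s s0.
  rewrite /M mulr0 expR0 mulr1 mulNr expRN => H.
  have {H} : (N s + B / A) / expR (A * s) <= N 0 + B / A.
    apply: H => x /andP[x0 xs].
      by have := dM x; rewrite /M; under eq_fun do rewrite mulNr expRN; apply; rewrite x0 (le_trans xs).
    rewrite /M' mulr_le0_ge0 ?expR_ge0// -addrA -opprD subr_le0.
    by apply: NA; [rewrite ltW//= ltW// (lt_le_trans xs)|apply: Nx; rewrite ltW].
  rewrite ler_pdivrMr ?expR_gt0// => /le_trans; apply.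
  by rewrite ler_wpM2l// ler_expR ler_wpM2l// ltW.
suff small s : 0 <= s <= a -> N s < r.
  move=> s /[dup] /andP[s0 sa] sI; apply: bound => // x /andP[x0 xs].
  by apply: small; rewrite x0 ltW// (lt_le_trans xs).
move=> sI; rewrite ltNge; apply/negP => rN.
(* The first time at which [N] would reach [r]. *)
pose S := [set x | 0 <= x <= a /\ r <= N x].
have S0 : S !=set0 by exists s.
have lS : has_lbound S by exists 0 => x [/andP[]].
pose s1 := inf S.
have s1I : 0 <= s1 <= a.
  rewrite lb_le_inf//=; last by move=> x [/andP[]].
  by apply: le_trans (ge_inf lS _) _; [split; [exact: sI|exact: rN]|case/andP: sI].
have below x : 0 <= x < s1 -> N x < r.
  move=> /andP[x0 xs]; rewrite ltNge; apply/negP => rx.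
  have /(ge_inf lS) : S x.
    by split=> //; rewrite x0 ltW// (lt_le_trans xs)//; case/andP: s1I.
  by rewrite leNgt xs.
have Ns1 : N s1 < r.
  by apply: le_lt_trans Nr; apply: le_trans (bound _ s1I below); rewrite lerDl.
have cN : {for s1, continuous N}.
  by have [/derivable1_diffP/differentiable_continuous] := dN _ s1I.
have /nbhs_ballP[d /= d0 Hd] : \forall x \near s1, N x < r.
  exact: cvgr_lt cN _ Ns1.
have [x Sx xd] := inf_adherent d0 (conj S0 lS).
have s1x : s1 <= x by exact: ge_inf.
have : N x < r.
  by apply: Hd; rewrite -ball_normE /= distrC ger0_norm ?subr_ge0// ltrBlDl.
by case: Sx => _; rewrite leNgt => /negP.
Qed.

(** The supremum norm of a curve is not differentiable, so the scalar inequality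
    is applied to the sum of the squares of the components, at the price of a factor
    that depends on the dimension.  The constant [C] depends only on [m], [L] and
    [a], so the same one serves a whole family of curves. *)
Lemma gronwall (m : nat) (L a : R) : 0 <= L -> 0 <= a ->
  exists2 C, 0 < C & forall (y y' : R -> 'rV[R]_m) (eta r s0 s1 : R),
    0 <= eta -> `|s1 - s0| <= a ->
    (forall t : R, 0 <= t <= 1 -> let s := s0 + t * (s1 - s0) in
       is_derive s 1 y (y' s) /\ (`|y s| < r -> `|y' s| <= L * `|y s| + eta)) ->
    C * (`|y s0| + eta) < r -> `|y s1| <= C * (`|y s0| + eta).
Proof.
move=> L0 a0; pose A := a * m%:R * (2 * L + 1) + 1.
have am0 : 0 <= a * m%:R by rewrite mulr_ge0.
have L21 : 0 <= 2 * L + 1 by rewrite addr_ge0// mulr_ge0.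
have A1 : 1 <= A by rewrite lerDr mulr_ge0.
have A0 : 0 < A by apply: lt_le_trans A1.
pose K := (m%:R + a * m%:R) * expR A.
have K0 : 0 <= K by rewrite mulr_ge0 ?expR_ge0// addr_ge0.
exists (K + 1); first by rewrite ltr_wpDl.
move=> y y' eta r s0 s1 eta0 sa dy yr.
(* The interval from [s0] to [s1] is run through by a parameter in [[0, 1]], so
   that the sign of [s1 - s0] does not matter. *)
pose ell t : R := t * (s1 - s0) + s0.
pose N t := \sum_i y (ell t) 0 i ^+ 2.
pose N' t := \sum_i 2 * y (ell t) 0 i * (y' (ell t) 0 i * (s1 - s0)).
have yN t : `|y (ell t)| ^+ 2 <= N t.
  have N0 : 0 <= N t by apply: sumr_ge0 => i _; exact: sqr_ge0.
  rewrite -(sqr_sqrtr N0) ler_sqr ?nnegrE ?sqrtr_ge0//.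
  apply: normr_rV_le => [|i]; first exact: sqrtr_ge0.
  rewrite -sqrtr_sqr ler_wsqrtr// /N (bigD1 i)//= lerDl.
  by apply: sumr_ge0 => j _; exact: sqr_ge0.
have Ny t : N t <= m%:R * `|y (ell t)| ^+ 2.
  apply: (@le_trans _ _ (\sum_(i < m) `|y (ell t)| ^+ 2)).
    apply: ler_sum => i _; rewrite -(real_normK (num_real _)).
    by rewrite ler_sqr ?nnegrE//; exact: normr_coord.
  by rewrite sumr_const card_ord mulr_natl.
have dN (t : R) : 0 <= t <= 1 -> is_derive t 1 N (N' t).
  move=> /dy[]; rewrite addrC -/(ell t) => /is_derive_rVP dyi _.
  have dell : is_derive t 1 ell (s1 - s0).
    by apply: is_derive_eq; rewrite scaler0 add0r addr0 [LHS]mulr1.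
  have di i := is_deriveX 2 (is_derive1_comp (dyi i) dell).
  have := is_derive_sum di.
  rewrite /N /N'; congr is_derive.
    by apply/funext => x; rewrite fct_sumE; apply: eq_bigr => i _; rewrite !expr2.
have N0y : N 0 <= m%:R * (`|y s0| + eta) ^+ 2.
  apply: le_trans (Ny 0) _; rewrite /ell mul0r add0r ler_wpM2l//.
  by rewrite ler_sqr ?nnegrE ?addr_ge0// lerDl.
have NA (t : R) : 0 <= t <= 1 -> N t < r ^+ 2 -> N' t <= A * N t + a * m%:R * eta ^+ 2.
  move=> t01 Nr; have [_] := dy t t01; rewrite addrC -/(ell t) => bnd.
  have r0 : 0 <= r by rewrite (le_trans _ (ltW yr))// mulr_ge0 ?addr_ge0.
  have {}bnd : `|y' (ell t)| <= L * `|y (ell t)| + eta.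
    apply: bnd; rewrite -ltr_sqr ?nnegrE//; exact: le_lt_trans (yN t) Nr.
  have term i : 2 * y (ell t) 0 i * (y' (ell t) 0 i * (s1 - s0)) <=
      a * ((2 * L + 1) * `|y (ell t)| ^+ 2 + eta ^+ 2).
    apply: le_trans (ler_norm _) _; rewrite !normrM.
    apply: (@le_trans _ _ (2 * `|y (ell t)| * ((L * `|y (ell t)| + eta) * a))).
      rewrite ger0_norm// !ler_pM ?mulr_ge0//; try exact: normr_coord.
      exact: le_trans (normr_coord _ _) bnd.
    rewrite mulrA [leLHS]mulrC ler_wpM2l//.
    (* [2 q (L q + eta) <= (2 L + 1) q^2 + eta^2]. *)
    have := sqr_ge0 (`|y (ell t)| - eta).
    move: `|y (ell t)| => q; clear; nra.
  apply: le_trans (ler_sum _ (fun i _ => term i)) _.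
  rewrite sumr_const card_ord -[leLHS]mulr_natl.
  have -> : m%:R * (a * ((2 * L + 1) * `|y (ell t)| ^+ 2 + eta ^+ 2)) =
    a * m%:R * (2 * L + 1) * `|y (ell t)| ^+ 2 + a * m%:R * eta ^+ 2 by ring.
  rewrite lerD2r; apply: le_trans (ler_wpM2l _ (yN t)) _; first exact: mulr_ge0.
  by apply: ler_wpM2r; [rewrite (le_trans _ (yN t))// sqr_ge0|rewrite lerDl].
have B0 : 0 <= a * m%:R * eta ^+ 2 by rewrite mulr_ge0// sqr_ge0.
have start : (N 0 + a * m%:R * eta ^+ 2 / A) * expR (A * 1) <= K * (`|y s0| + eta) ^+ 2.
  rewrite mulr1 /K [leRHS]mulrAC ler_wpM2r ?expR_ge0// mulrDl lerD//.
  rewrite -mulrA ler_wpM2l// ler_pdivrMr//.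
  apply: (@le_trans _ _ ((`|y s0| + eta) ^+ 2)).
    by rewrite ler_sqr ?nnegrE ?addr_ge0// lerDr.
  by rewrite ler_peMr// sqr_ge0.
have KK : K * (`|y s0| + eta) ^+ 2 <= ((K + 1) * (`|y s0| + eta)) ^+ 2.
  by rewrite exprMn ler_wpM2r ?sqr_ge0//; move: K0; clearbody K; clear; nra.
have Cy : 0 <= (K + 1) * (`|y s0| + eta) by rewrite mulr_ge0 ?addr_ge0.
have start2 : (N 0 + a * m%:R * eta ^+ 2 / A) * expR (A * 1) < r ^+ 2.
  apply: le_lt_trans start _; apply: le_lt_trans KK _.
  by rewrite ltr_sqr ?nnegrE// (le_trans Cy)// ltW.
have N00 : 0 <= N 0 by apply: le_trans (yN 0); exact: sqr_ge0.
have := gronwall_scalar ler01 A0 N00 B0 dN NA start2.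
move=> /(_ 1); rewrite ler01 lexx => /(_ isT) N1.
rewrite -ler_sqr ?nnegrE//; apply: le_trans KK; apply: le_trans start.
apply: le_trans N1; apply: (@le_trans _ _ (N 1)); last by rewrite lerDl divr_ge0// ltW.
by apply: le_trans (yN 1); rewrite /ell mul1r subrK.
Qed.

End Gronwall.

(** * Local solutions of ordinary differential equations *)

Section Picard.
Variable R : realType.

(** Projection of the line onto [[-a, a]]: composing with it makes an estimate on
    a bounded set global. *)
Definition clamp (a x : R) : R := Num.max (- a) (Num.min x a).

Lemma clamp_itv (a x : R) : 0 <= a -> `|clamp a x| <= a.
Proof.
move=> a0; rewrite /clamp ler_norml le_max lexx /=.
by rewrite ge_max ge_min lexx orbT andbT -subr_ge0 opprK addr_ge0.
Qed.

Lemma clamp_id (a x : R) : `|x| <= a -> clamp a x = x.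
Proof. by rewrite ler_norml => /andP[ax xa]; rewrite /clamp min_l// max_r. Qed.

Lemma clamp_contract (a x y : R) : `|clamp a x - clamp a y| <= `|x - y|.
Proof.
wlog xy : x y / x <= y.
  by case: (leP x y) => [|/ltW] xy H; [|rewrite distrC (distrC x)]; exact: H.
have d0 : 0 <= y - x by rewrite subr_ge0.
rewrite distrC (distrC x) (ger0_norm d0) /clamp ger0_norm.
  rewrite lerBlDl addr_maxl addr_minl.
  by rewrite le_max2 ?lerDl// le_min2 ?lerDl// [x + _]addrC subrK.
by rewrite subr_ge0 le_max2// le_min2.
Qed.

Lemma clamp_continuous (a : R) : continuous (clamp a).
Proof. apply: contraction_continuous => x y; exact: clamp_contract. Qed.

Lemma primitive (f : R -> R) (a : R) : 0 <= a -> continuous f ->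
  exists2 F : R -> R, F 0 = 0 & forall x : R, `|x| <= a -> is_derive x 1 F (f x).
Proof.
(* The base point lies strictly to the left of [[-a, a]], where the fundamental
   theorem of calculus gives two-sided derivatives. *)
move=> a0 cf; pose lo := - a - 1; pose up := a + 1.
pose G x := (\int[@lebesgue_measure R]_(t in [set` `[lo, x]]) (f t))%R.
exists (fun x => G x - G 0); first by rewrite subrr.
move=> x; rewrite ler_norml => /andP[ax xa].
have fi : (@lebesgue_measure R).-integrable `[lo, up] (EFin \o f).
  apply: continuous_compact_integrable; first exact: segment_compact.
  exact: continuous_subspaceT.
have [dG GE] := @continuous_FTC1_closed R f lo x up ltac:(rewrite /up; lra) fi
   ltac:(rewrite /lo; lra) (cf x).
have dGx : is_derive x 1 G (f x).
  by apply: DeriveDef; [exact: dG|rewrite -derive1E; exact: GE].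
by have := is_deriveB dGx (is_derive_cst (G 0) x 1); rewrite subr0.
Qed.

Lemma primitive_rV (m : nat) (f : R -> 'rV[R]_m) (a : R) : 0 <= a -> continuous f ->
  exists2 F : R -> 'rV[R]_m, F 0 = 0 & forall x : R, `|x| <= a -> is_derive x 1 F (f x).
Proof.
move=> a0 cf.
have Fi i : exists F : R -> R, F 0 = 0 /\
    forall x : R, `|x| <= a -> is_derive x 1 F (f x 0 i).
  have [F F0 dF] := @primitive (fun x => f x 0 i) a a0 ltac:(move=> x;
    exact: (continuous_comp (cf x) (@coord_continuous _ _ _ 0 i _))).
  by exists F.
have [F FP] := choice Fi.
exists (fun x => \row_i F i x).
  by apply/rowP => i; rewrite !mxE; have [] := FP i.
move=> x xa; apply/is_derive_rVP => i; under eq_fun do rewrite mxE.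
by have [_] := FP i; exact.
Qed.

Lemma mean_value_le (m : nat) (y y' : R -> 'rV[R]_m) (K s0 s1 : R) : 0 <= K ->
  (forall t, 0 <= t <= 1 -> let s := s0 + t * (s1 - s0) in
     is_derive s 1 y (y' s) /\ `|y' s| <= K) ->
  `|y s1 - y s0| <= K * `|s1 - s0|.
Proof.
move=> K0 dy; apply: normr_rV_le => [|i]; first by rewrite mulr_ge0.
rewrite !mxE.
have [|t t01 ->] := @mvt_between R (fun s => y s 0 i) (fun s => y' s 0 i) s0 s1.
  by move=> t /dy[/is_derive_rVP + _]; exact.
have [_ le] := dy t t01.
by rewrite normrM ler_wpM2r// (le_trans (normr_coord _ _)).
Qed.

Lemma cvg_dist_le (T : Type) (F : set_system T) (FF : ProperFilter F)
    (V : normedModType R) (u : T -> V) (l x : V) (e : R) :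
  u @ F --> l -> (\forall n \near F, `|u n - x| <= e) -> `|l - x| <= e.
Proof.
move=> ul ux; apply/ler_addgt0Pl => d d0.
have /filter_ex [n [n1 n2]] : \forall n \near F, `|l - u n| <= d /\ `|u n - x| <= e.
  by apply: filterI => //; exact: (cvgrPdist_le _ _).1 ul d d0.
by rewrite -(subrKA (u n)); apply: le_trans (ler_normD _ _) _; exact: lerD.
Qed.

Lemma is_derive_cont (V : normedModType R) (y : R -> V) (s : R) l :
  is_derive s 1 y l -> {for s, continuous y}.
Proof. by case=> /derivable1_diffP/differentiable_continuous. Qed.

Lemma quarter_sum (q d : R) : q < d / 4 -> q + (d / 2 + q) <= d.
Proof. by move=> ?; lra. Qed.

Lemma half_sum (q1 q2 d : R) : 0 <= q1 -> q2 <= q1 -> q1 < d / 2 -> 2^-1 * q1 + q2 <= d.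
Proof. by move=> ? ? ?; lra. Qed.

(** The iterates converge uniformly at rate [1/2] because [L * a <= 2^-1]. *)
Lemma picard (m : nat) (f : 'rV[R]_m -> 'rV[R]_m) (L M a : R) (p : 'rV[R]_m) :
  0 <= L -> 0 <= M -> 0 <= a -> L * a <= 2^-1 ->
  (forall x y, `|f x - f y| <= L * `|x - y|) -> (forall x, `|f x| <= M) ->
  exists2 y : R -> 'rV[R]_m, y 0 = p & forall s : R, `|s| <= a ->
    is_derive s 1 y (f (y s)) /\ `|y s - p| <= M * a.
Proof.
move=> L0 M0 a0 La fL fM.
pose good (y : R -> 'rV[R]_m) := forall s : R, `|s| <= a -> {for s, continuous y}.
(* One Picard iteration. *)
have stepP (y : R -> 'rV[R]_m) : exists z : R -> 'rV[R]_m, good y ->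
    z 0 = p /\ forall s : R, `|s| <= a -> is_derive s 1 z (f (y s)).
  have [gy|] := pselect (good y); last by exists y.
  have [|F F0 dF] := @primitive_rV m (fun s => f (y (clamp a s))) a a0.
    move=> s; apply: continuous_comp; last exact: lipschitz_continuous fL _.
    apply: continuous_comp; first exact: clamp_continuous.
    by apply: gy; exact: clamp_itv.
  exists (fun s => F s + p) => _; rewrite F0 add0r; split=> // s sa.
  have := is_deriveD (dF s sa) (is_derive_cst p s 1).
  by rewrite addr0 clamp_id.
have [step stepE] := choice stepP.
pose y n := iter n step (fun=> p).
have gy n : good (y n).
  elim: n => [|n IH] s sa; first exact: cst_continuous.
  by have [_ /(_ s sa) /is_derive_cont] := stepE _ IH.
have ygap (u v u' v' : R -> 'rV[R]_m) (d : R) : 0 <= d ->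
    u' 0 = p -> v' 0 = p ->
    (forall s : R, `|s| <= a -> is_derive s 1 u' (f (u s)) /\
       is_derive s 1 v' (f (v s)) /\ `|u s - v s| <= d) ->
    forall s : R, `|s| <= a -> `|u' s - v' s| <= 2^-1 * d.
  move=> d0 u0 v0 H s sa.
  have D := @mean_value_le m (fun s => u' s - v' s) (fun s => f (u s) - f (v s)) (L * d) 0 s.
  rewrite u0 v0 subrr !subr0 in D; apply: le_trans (D _ _) _.
  - by rewrite mulr_ge0.
  - move=> t /andP[t0 t1]; rewrite add0r.
    have ts : `|t * s| <= a.
      by rewrite normrM (ger0_norm t0) (le_trans _ sa)// ler_piMl.
    have [du [dv uv]] := H _ ts; split; first exact: is_deriveB.
    by apply: le_trans (fL _ _) _; exact: ler_wpM2l.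
  - by rewrite mulrAC ler_wpM2r// (le_trans _ La)// ler_wpM2l.
have y1 n (s : R) : `|s| <= a -> `|y n.+1 s - y n s| <= M * a * 2^-1 ^+ n.
  elim: n s => [|n IH] s sa.
    have [s0 ds] := stepE _ (gy 0%N).
    have := @mean_value_le m (y 1%N) (fun s => f (y 0%N s)) M 0 s M0.
    rewrite subr0 {2}/y /= s0 expr0 mulr1; move=> D; apply: le_trans (D _) _.
      move=> t /andP[t0 t1]; rewrite add0r; split=> //; apply: ds.
      by rewrite normrM (ger0_norm t0) (le_trans _ sa)// ler_piMl.
    exact: ler_wpM2l.
  have [s0 ds] := stepE _ (gy n); have [s0' ds'] := stepE _ (gy n.+1).
  rewrite exprS mulrCA; apply: (ygap (y n.+1) (y n)) => //.
    by rewrite !mulr_ge0 ?exprn_ge0// invr_ge0.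
  by move=> r ra; split; [exact: ds'|split; [exact: ds|exact: IH]].
have yk n k (s : R) : `|s| <= a -> `|y (n + k)%N s - y n s| <=
    M * a * 2^-1 ^+ n * (2 * (1 - 2^-1 ^+ k)).
  move=> sa; elim: k => [|k IH].
    by rewrite addn0 subrr normr0 expr0 subrr mulr0 mulr0.
  rewrite addnS -(subrKA (y (n + k)%N s)); apply: le_trans (ler_normD _ _) _.
  apply: le_trans (lerD (y1 _ _ sa) IH) _.
  rewrite exprD mulrA -mulrDr ler_wpM2l ?mulr_ge0 ?exprn_ge0 ?invr_ge0// exprS.
  by rewrite le_eqVlt; apply/orP; left; apply/eqP; field.
pose e n := 2 * (M * a * 2^-1 ^+ n).
have yke n k (s : R) : `|s| <= a -> `|y (n + k)%N s - y n s| <= e n.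
  move=> sa; apply: le_trans (yk n k s sa) _; rewrite /e mulrC.
  rewrite ler_wpM2r ?mulr_ge0 ?exprn_ge0 ?invr_ge0//.
  by rewrite ler_piMr// gerBl exprn_ge0// invr_ge0.
have e_cvg : e n @[n --> \oo] --> (0 : R).
  have h1 : `|2^-1 : R| < 1 by rewrite gtr0_norm ?invr_gt0// invf_lt1// ltr1n.
  have -> : e = (fun n => 2 * (M * a) * 2^-1 ^+ n) by apply/funext => n; rewrite /e mulrA.
  by have := cvgM (cvg_cst (2 * (M * a))) (cvg_expr h1); rewrite mulr0; exact.
have ycvg (s : R) : `|s| <= a -> cvg (y n s @[n --> \oo]).
  move=> sa; apply/cauchy_cvgP/cauchy_exP => d d0.
  have /filter_ex [N eN] : \forall n \near \oo, e n < d by exact: cvgr_lt e_cvg _ d0.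
  exists (y N s); exists N => // n /= Nn; rewrite -ball_normE /= distrC.
  by apply: le_lt_trans eN; rewrite -(subnKC Nn); exact: yke.
pose yl s := lim (y n (clamp a s) @[n --> \oo]).
have yl_dist n (s : R) : `|s| <= a -> `|yl s - y n s| <= e n.
  move=> sa; rewrite /yl clamp_id//; apply: cvg_dist_le (ycvg s sa) _.
  exists n => // k /= nk; rewrite -(subnKC nk); exact: yke.
have cyl : continuous yl.
  move=> s; apply/cvgrPdist_le => d d0.
  have d4 : 0 < d / 4 by rewrite divr_gt0.
  have /filter_ex [N eN] : \forall n \near \oo, e n < d / 4.
    exact: cvgr_lt e_cvg _ d4.
  have ylc x : yl x = yl (clamp a x) by rewrite /yl [in RHS]clamp_id// clamp_itv.
  have cN : {for s, continuous (y N \o clamp a)}.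
    apply: continuous_comp; first exact: clamp_continuous.
    by apply: gy; exact: clamp_itv.
  near=> x.
  have N2 : `|y N (clamp a s) - y N (clamp a x)| <= d / 2.
    near: x; apply: (cvgrPdist_le _ _).1 cN _ _; by rewrite divr_gt0.
  rewrite ylc (ylc x).
  have A1 := yl_dist N _ (clamp_itv s a0); have A2 := yl_dist N _ (clamp_itv x a0).
  rewrite -(subrKA (y N (clamp a s))) -(subrKA (y N (clamp a x)) (y N (clamp a s))).
  apply: le_trans (ler_normD _ _) _.
  apply: le_trans (lerD A1 (ler_normD _ _)) _.
  rewrite [X in _ + (_ + X)]distrC.
  apply: le_trans (lerD (lexx _) (lerD N2 A2)) _.
  exact: quarter_sum.
have gyl : good yl by move=> s _; exact: cyl.
have [z0 dz] := stepE _ gyl.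
(* The uniform limit is a fixed point. *)
have zyl s : `|s| <= a -> step yl s = yl s.
  move=> sa; apply/eqP; rewrite -subr_eq0 -normr_le0; apply/ler_addgt0Pl => d d0.
  have /filter_ex [N eN] : \forall n \near \oo, e n < d / 2.
    by apply: cvgr_lt e_cvg _ _; rewrite divr_gt0.
  have [s0 ds] := stepE _ (gy N).
  have e0 n : 0 <= e n by rewrite /e !mulr_ge0 ?exprn_ge0 ?invr_ge0.
  have A1 := ygap yl (y N) (step yl) (y N.+1) (e N) (e0 N) z0 s0
     (fun r ra => conj (dz r ra) (conj (ds r ra) (yl_dist N r ra))) s sa.
  have A2 := yl_dist N.+1 s sa.
  have eS : e N.+1 <= e N.
    rewrite /e exprS ler_wpM2l// ler_wpM2l ?mulr_ge0//.
    by rewrite ler_piMl ?exprn_ge0 ?invr_ge0// invf_le1// ler1n.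
  rewrite addr0 -(subrKA (y N.+1 s)); apply: le_trans (ler_normD _ _) _.
  rewrite [X in _ + X]distrC; apply: le_trans (lerD A1 A2) _.
  exact: half_sum (e0 N) eS eN.
exists (step yl) => // s sa; split; first by rewrite zyl//; exact: dz.
have := @mean_value_le m (step yl) (fun s => f (yl s)) M 0 s M0.
rewrite z0 subr0 => D; apply: le_trans (D _) _.
  move=> t /andP[t0 t1]; rewrite add0r; split=> //; apply: dz.
  by rewrite normrM (ger0_norm t0) (le_trans _ sa)// ler_piMl.
exact: ler_wpM2l.
Unshelve. all: by end_near. Qed.

End Picard.

Section Jacobian.
Variables (R : realType) (n m : nat).
Implicit Types (U : set 'rV[R]_n) (f : 'rV[R]_n -> 'rV[R]_m) (p x y w : 'rV[R]_n).

Definition jac f p w : 'rV[R]_m :=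
  \row_j \sum_i pd i (fun q => f q 0 j) p * w 0 i.

Lemma jacB f p w1 w2 : jac f p (w1 - w2) = jac f p w1 - jac f p w2.
Proof.
apply/rowP => j; rewrite !mxE -sumrB; apply: eq_bigr => i _.
by rewrite !mxE mulrBr.
Qed.

Lemma jacZ f p a w : jac f p (a *: w) = a *: jac f p w.
Proof.
apply/rowP => j; rewrite !mxE mulr_sumr; apply: eq_bigr => i _.
by rewrite !mxE mulrCA.
Qed.

Lemma jac_bound f p : exists2 K, 0 <= K & forall w, `|jac f p w| <= K * `|w|.
Proof.
pose K := \sum_j \sum_i `|pd i (fun q => f q 0 j) p|.
have S0 j : 0 <= \sum_i `|pd i (fun q => f q 0 j) p| by apply: sumr_ge0.
have K0 : 0 <= K by apply: sumr_ge0.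
exists K => // w; apply: normr_rV_le => [|j]; first exact: mulr_ge0.
rewrite mxE; apply: le_trans (ler_norm_sum _ _ _) _.
apply: (@le_trans _ _ ((\sum_i `|pd i (fun q => f q 0 j) p|) * `|w|)).
  rewrite mulr_suml; apply: ler_sum => i _; rewrite normrM ler_wpM2l//.
  exact: normr_coord.
rewrite ler_wpM2r// /K (bigD1 j)//= lerDl; exact: sumr_ge0.
Qed.

Lemma jac_continuous U f p eta : (forall j, Ck U 1 (fun q => f q 0 j)) -> U p ->
  0 < eta -> exists2 rho, 0 < rho & forall y w, `|y - p| < rho ->
    `|jac f y w - jac f p w| <= eta * `|w|.
Proof.
move=> Cf Up eta0.
have e0 : 0 < eta / n.+1%:R by rewrite divr_gt0.
have : \forall y \near p, forall j i,
    `|pd i (fun q => f q 0 j) p - pd i (fun q => f q 0 j) y| < eta / n.+1%:R.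
  apply: (filter_forall (F := nbhs p)) => j; apply: (filter_forall (F := nbhs p)) => i.
  have [_ /(_ i) [_ [ci _]]] := Cf j.
  by move/cvgrPdist_lt : (ci p Up) => /(_ _ e0).
move=> /nbhs_ballP [rho /= rho0 H]; exists rho => // y w yr.
have {}H := H y ltac:(by rewrite -ball_normE /= distrC).
apply: normr_rV_le => [|j]; first by rewrite mulr_ge0// ltW.
rewrite !mxE -sumrB; apply: le_trans (ler_norm_sum _ _ _) _.
apply: (@le_trans _ _ (\sum_(i < n) eta / n.+1%:R * `|w|)).
  apply: ler_sum => i _; rewrite -mulrBl normrM distrC ler_pM//; last exact: normr_coord.
  by rewrite ltW.
rewrite sumr_const card_ord -[leLHS]mulr_natl mulrA ler_wpM2r//.
by rewrite mulrCA ler_piMr ?(ltW eta0)// ler_pdivrMr// mul1r ler_nat.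
Qed.

Lemma C1_strict_rV U f p eta : open U -> (forall j, Ck U 1 (fun q => f q 0 j)) ->
  U p -> 0 < eta ->
  exists2 rho, 0 < rho & forall x y, `|x - p| < rho -> `|y - p| < rho ->
    U x /\ `|f x - f y - jac f p (x - y)| <= eta * `|x - y|.
Proof.
move=> oU Cf Up eta0.
have : \forall rho \near (0 : R)^'+, 0 < rho /\ (forall x, `|x - p| < rho -> U x) /\
    forall j x y, `|x - p| < rho -> `|y - p| < rho ->
    `|(f x - f y - jac f p (x - y)) 0 j| <= eta * `|x - y|.
  apply: filterI; first exact: nbhs_right_gt.
  apply: filterI.
    have /nbhs_ballP [r /= r0 Hr] : nbhs p U by exact: open_nbhs_nbhs.
    apply: filterS (nbhs_right_lt r0) => rho rr x xr.
    by apply: Hr; rewrite -ball_normE /= distrC (lt_trans xr).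
  apply: (filter_forall (F := (0 : R)^'+)) => j.
  have [r r0 Hr] := C1_strict oU (Cf j) Up eta0.
  apply: filterS (nbhs_right_lt r0) => rho rr x y xr yr.
  have [_] := Hr x y (lt_trans xr rr) (lt_trans yr rr).
  by rewrite !mxE.
move=> /filter_ex [rho [rho0 [HU H]]]; exists rho => // x y xr yr.
split; first exact: HU.
apply: normr_rV_le => [|j]; first by rewrite mulr_ge0// ltW.
exact: H.
Qed.

Lemma C1_lipschitz U f p : open U -> (forall j, Ck U 1 (fun q => f q 0 j)) -> U p ->
  exists rho L, [/\ 0 < rho, 0 <= L & forall x y, `|x - p| < rho -> `|y - p| < rho ->
    U x /\ `|f x - f y| <= L * `|x - y|].
Proof.
move=> oU Cf Up; have [rho rho0 H] := C1_strict_rV oU Cf Up ltr01.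
have [K K0 HK] := jac_bound f p.
exists rho, (1 + K); split=> //; first by rewrite addr_ge0.
move=> x y xr yr; have [Ux D] := H x y xr yr; split=> //.
rewrite -(subrK (jac f p (x - y)) (f x - f y)) mulrDl.
by apply: le_trans (ler_normD _ _) _; exact: lerD.
Qed.

(** The differential may be taken at the second point rather than at the fixed
    centre: this is the form that is uniform along a compact curve. *)
Lemma C1_strict_moving U f p eta : open U -> (forall j, Ck U 1 (fun q => f q 0 j)) ->
  U p -> 0 < eta ->
  exists2 rho, 0 < rho & forall x y, `|x - p| < rho -> `|y - p| < rho ->
    U x /\ `|f x - f y - jac f y (x - y)| <= eta * `|x - y|.
Proof.
move=> oU Cf Up eta0; have e2 : 0 < eta / 2 by rewrite divr_gt0.
have [r1 r10 H1] := C1_strict_rV oU Cf Up e2.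
have [r2 r20 H2] := jac_continuous Cf Up e2.
exists (Num.min r1 r2) => [|x y]; rewrite ?lt_min ?r10//.
move=> /andP[x1 x2] /andP[y1 y2]; have [Ux D] := H1 x y x1 y1; split=> //.
have E := H2 y (x - y) y2.
rewrite -(subrKA (jac f p (x - y))) [eta]splitr mulrDl.
rewrite distrC in E; apply: le_trans (ler_normD _ _) _; exact: lerD D E.
Qed.

End Jacobian.

Section LocalExistence.
Variables (R : realType) (m : nat).

(** Near [p0] the field is Lipschitz and bounded; composed with the projection [P]
    onto a cube around [p0] it has these properties everywhere, and a solution that
    starts close to [p0] does not leave the cube during a short time.  That time is
    the same for all starting points near [p0]. *)
Lemma ode_local (W : set 'rV[R]_m) (f : 'rV[R]_m -> 'rV[R]_m) (p0 : 'rV[R]_m) :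
  open W -> (forall j, Ck W 1 (fun q => f q 0 j)) -> W p0 ->
  exists rho a, [/\ 0 < rho, 0 < a & forall p, `|p - p0| < rho ->
    exists2 y : R -> 'rV[R]_m, y 0 = p & forall s : R, `|s| <= a ->
      W (y s) /\ is_derive s 1 y (f (y s))].
Proof.
move=> oW Cf Wp0; have [r [L [r0 L0 H]]] := C1_lipschitz oW Cf Wp0.
pose r2 := r / 2; have r20 : 0 < r2 by rewrite divr_gt0.
have r2r : r2 < r by rewrite /r2 ltr_pdivrMr// ltr_pMr// ltr1n.
(* Coordinatewise projection onto the cube of radius [r2] around [p0]. *)
pose P (x : 'rV[R]_m) : 'rV[R]_m := \row_i (p0 0 i + clamp r2 (x 0 i - p0 0 i)).
have Pin x : `|P x - p0| < r.
  apply: le_lt_trans r2r; apply: normr_rV_le => [|i]; first exact: ltW.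
  by rewrite !mxE addrC addKr clamp_itv// ltW.
have Pc x y : `|P x - P y| <= `|x - y|.
  apply: normr_rV_le => // i; rewrite !mxE opprD addrACA subrr add0r.
  apply: le_trans (clamp_contract _ _ _) _.
  by rewrite opprB addrA subrK; have := normr_coord (x - y) i; rewrite !mxE.
have Pid x : `|x - p0| <= r2 -> P x = x.
  move=> xr; apply/rowP => i; rewrite mxE clamp_id ?subrKC//.
  by apply: le_trans xr; have := normr_coord (x - p0) i; rewrite !mxE.
have p0r : `|p0 - p0| < r by rewrite subrr normr0.
pose M := `|f p0| + L * r.
have M0 : 0 <= M by rewrite addr_ge0// mulr_ge0// ltW.
have fM x : `|f (P x)| <= M.
  rewrite -(subrK (f p0) (f (P x))) addrC; apply: le_trans (ler_normD _ _) _.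
  rewrite lerD2l; have [_ D] := H (P x) p0 (Pin x) p0r.
  by apply: le_trans D _; rewrite ler_wpM2l// ltW.
have fL x y : `|f (P x) - f (P y)| <= L * `|x - y|.
  have [_ D] := H _ _ (Pin x) (Pin y).
  by apply: le_trans D _; exact: ler_wpM2l.
(* The first bound makes the iteration contract; by the second one a solution that
   starts within [r2 / 2] of [p0] stays in the cube. *)
pose a := Num.min (2^-1 / (L + 1)) (r2 / 2 / (M + 1)).
have a0 : 0 < a by rewrite lt_min !divr_gt0// ?ltr_wpDl// invr_gt0.
have La : L * a <= 2^-1.
  apply: (@le_trans _ _ (L * (2^-1 / (L + 1)))).
    by rewrite ler_wpM2l// /a ge_min lexx.
  by rewrite mulrCA ler_piMr ?invr_ge0// ler_pdivrMr ?ltr_wpDl// mul1r lerDl.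
have Ma : M * a <= r2 / 2.
  apply: (@le_trans _ _ (M * (r2 / 2 / (M + 1)))).
    by rewrite ler_wpM2l// /a ge_min lexx orbT.
  have r22 : 0 <= r2 / 2 by rewrite divr_ge0// ltW.
  by rewrite mulrCA ler_piMr// ler_pdivrMr ?ltr_wpDl// mul1r lerDl.
exists (r2 / 2), a; split=> //; first by rewrite divr_gt0.
move=> p pr; have [y y0 dy] := picard p L0 M0 (ltW a0) La fL fM.
exists y => // s sa; have [d yp] := dy s sa.
have yr : `|y s - p0| <= r2.
  rewrite -(subrKA p) [r2]splitr; apply: le_trans (ler_normD _ _) _.
  by apply: lerD; [exact: le_trans yp Ma|exact: ltW].
split; first by have [] := H _ _ (le_lt_trans yr r2r) p0r.
by rewrite Pid in d.
Qed.

End LocalExistence.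

(** * Dependence of solutions on a parameter *)

Section Dependence.
Variables (R : realType) (m : nat) (W : set 'rV[R]_m) (f : 'rV[R]_m -> 'rV[R]_m).
Hypothesis oW : open W.
Hypothesis Cf : forall j, Ck W 1 (fun q => f q 0 j).

(** Compactness of the interval; this makes the local estimates uniform along an
    integral curve. *)
Lemma uniform_radius (a : R) (P : R -> R -> Prop) :
  (forall s, `|s| <= a -> exists2 rho, 0 < rho &
     forall s', `|s' - s| < rho -> `|s'| <= a -> P rho s') ->
  (forall rho rho' s, 0 < rho' <= rho -> P rho s -> P rho' s) ->
  exists2 rho, 0 < rho & forall s, `|s| <= a -> P rho s.
Proof.
move=> loc anti.
have cpt : compact (`[- a, a] : set R) by exact: segment_compact.
have inK s : (`[- a, a] : set R) s <-> `|s| <= a by rewrite /= in_itv /= ler_norml.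
have N : \forall rho \near (0 : R)^'+, `[- a, a] `<=` (fun s => `|s| <= a -> P rho s).
  apply: (compact_near_coveringP _).1 cpt _ _ _ _ _ => s /inK sa.
  have [rho rho0 H] := loc s sa.
  exists (ball s rho, [set r | 0 < r <= rho]).
    split=> /=; first exact: nbhsx_ballx.
    by near=> r; apply/andP; split; near: r; [exact: nbhs_right_gt|exact: nbhs_right_ltW].
  move=> [s' r] /= [s's rr] s'a; apply: anti rr _; apply: H => //.
  by move: s's; rewrite -ball_normE /= distrC.
have /filter_ex [rho [rho0 H]] : \forall rho \near (0 : R)^'+,
    0 < rho /\ `[- a, a] `<=` (fun s => `|s| <= a -> P rho s).
  by apply: filterI => //; exact: nbhs_right_gt.
by exists rho => // s sa; apply: H => //; apply/inK.
Unshelve. all: by end_near. Qed.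

Lemma curve_tube (g : R -> 'rV[R]_m) (a eta : R) : 0 < eta ->
  (forall s, `|s| <= a -> W (g s) /\ {for s, continuous g}) ->
  exists2 rho, 0 < rho & forall s, `|s| <= a -> forall x, `|x - g s| < rho ->
    `|f x - f (g s) - jac f (g s) (x - g s)| <= eta * `|x - g s|.
Proof.
move=> eta0 gW.
apply: (uniform_radius (P := fun rho s => forall x, `|x - g s| < rho ->
    `|f x - f (g s) - jac f (g s) (x - g s)| <= eta * `|x - g s|)) => [s sa|].
  have [Wg cg] := gW s sa; have [r r0 H] := C1_strict_moving oW Cf Wg eta0.
  have r2 : 0 < r / 2 by rewrite divr_gt0.
  have /nbhs_ballP [d /= d0 Hd] : \forall s' \near s, `|g s - g s'| < r / 2.
    exact: (cvgrPdist_lt _ _).1 cg _ r2.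
  exists (Num.min d (r / 2)); first by rewrite lt_min d0.
  move=> s'; rewrite lt_min => /andP[s'd _] _ x; rewrite lt_min => /andP[_ xr].
  have gs' : `|g s' - g s| < r / 2.
    by rewrite distrC; apply: Hd; rewrite -ball_normE /= distrC.
  have [||_] := H x (g s'); last exact.
    rewrite -(subrKA (g s')) [r]splitr; apply: le_lt_trans (ler_normD _ _) _.
    exact: ltrD.
  by apply: lt_trans gs' _; rewrite ltr_pdivrMr// ltr_pMr// ltr1n.
by move=> rho rho' s /andP[_ rr] H x xr; apply: H; exact: lt_le_trans xr rr.
Qed.

Lemma curve_jac_bound (g : R -> 'rV[R]_m) (a : R) :
  (forall s, `|s| <= a -> W (g s) /\ {for s, continuous g}) ->
  exists2 L, 0 <= L & forall s, `|s| <= a -> forall w, `|jac f (g s) w| <= L * `|w|.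
Proof.
move=> gW.
have [rho rho0 H] : exists2 rho, 0 < rho & forall s, `|s| <= a ->
    forall w, `|jac f (g s) w| <= rho^-1 * `|w|.
  apply: (uniform_radius (P := fun rho s => forall w,
      `|jac f (g s) w| <= rho^-1 * `|w|)) => [s sa|].
    have [Wg cg] := gW s sa; have [r r0 H] := jac_continuous Cf Wg ltr01.
    have /nbhs_ballP [d /= d0 Hd] : \forall s' \near s, `|g s - g s'| < r.
      exact: (cvgrPdist_lt _ _).1 cg _ r0.
    have [K K0 HK] := jac_bound f (g s).
    have K1 : 0 < (K + 1)^-1 by rewrite invr_gt0 ltr_wpDl.
    exists (Num.min d (K + 1)^-1); first by rewrite lt_min d0.
    move=> s'; rewrite lt_min => /andP[s'd _] _ w.
    have D : `|jac f (g s') w - jac f (g s) w| <= 1 * `|w|.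
      by apply: H; rewrite distrC; apply: Hd; rewrite -ball_normE /= distrC.
    rewrite -(subrK (jac f (g s) w) (jac f (g s') w)) addrC.
    apply: le_trans (ler_normD _ _) _; apply: le_trans (lerD (HK w) D) _.
    rewrite -mulrDl ler_wpM2r// -[leLHS]invrK lef_pV2 ?posrE ?lt_min ?d0//.
    by rewrite ge_min lexx orbT.
  move=> rho rho' s /andP[r0 rr] H w; apply: le_trans (H w) _.
  by rewrite ler_wpM2r// lef_pV2// posrE// (lt_le_trans r0).
by exists rho^-1; rewrite // invr_ge0 ltW.
Qed.

Lemma is_derive_little (V : normedModType R) (q : R -> V) (s0 : R) (v : V) :
  (forall eps, 0 < eps -> exists2 d, 0 < d & forall s, `|s - s0| < d ->
     `|q s - q s0 - (s - s0) *: v| <= eps * `|s - s0|) ->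
  is_derive s0 1 q v.
Proof.
move=> H; apply/is_derive_cvgP/cvgrPdist_le => eps eps0.
have [d d0 Hd] := H eps eps0.
near=> h.
have h0 : h != 0 by near: h; exact: nbhs_dnbhs_neq.
have hd : `|h| < d by near: h; exact: dnbhs0_lt.
have := Hd (h *: 1 + s0); rewrite addrK [h *: 1]mulr1 => /(_ hd) D.
rewrite distrC -[X in _ - X]scale1r -(mulVf h0) -scalerA -scalerBr normrZ normfV.
by rewrite ler_pdivrMl ?normr_gt0// mulrC.
Unshelve. all: by end_near. Qed.

End Dependence.

Section FlowDerivative.
Variables (R : realType) (m : nat) (W : set 'rV[R]_m) (f : 'rV[R]_m -> 'rV[R]_m).
Hypothesis oW : open W.
Hypothesis Cf : forall j, Ck W 1 (fun q => f q 0 j).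
Variables (G : R -> R -> 'rV[R]_m) (e t0 : R).
Hypothesis Gsol : \forall t \near t0, forall s, `|s| < e ->
  W (G s t) /\ is_derive s 1 (G ^~ t) (f (G s t)).
Hypothesis G0 : derivable (G 0) t0 1.

Let g s := G s t0.
Let quot (h s : R) := h^-1 *: (G s (h *: 1 + t0) - G s t0).
Let quot' (h s : R) := h^-1 *: (f (G s (h *: 1 + t0)) - f (G s t0)).

Let gsol (s : R) : `|s| < e -> W (g s) /\ is_derive s 1 g (f (g s)).
Proof. exact: (nbhs_singleton Gsol). Qed.

Let near_t0 (P : R -> Prop) :
  (\forall t \near t0, P t) -> \forall h \near (0 : R)^', P (h *: 1 + t0).
Proof.
move=> /nbhs_ballP [d /= d0 Hd]; near=> h; apply: Hd; rewrite -ball_normE /=.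
rewrite [h *: 1]mulr1 opprD addrCA subrr addr0 normrN.
by near: h; exact: dnbhs0_lt.
Unshelve. all: by end_near. Qed.

Let in_seg (a s t : R) : `|s| <= a -> 0 <= t <= 1 -> `|0 + t * (s - 0)| <= a.
Proof.
move=> sa /andP[t0' t1]; rewrite add0r subr0 normrM (ger0_norm t0').
by rewrite (le_trans _ sa)// ler_piMl.
Qed.

Let hn0 : \forall h \near (0 : R)^', h != 0.
Proof. exact: nbhs_dnbhs_neq. Qed.

Let quot_cvg0 : quot h 0 @[h --> 0^'] --> 'D_1 (G 0) t0.
Proof. exact: G0. Qed.

Let diff_small (d : R) : 0 < d ->
  \forall h \near (0 : R)^', `|G 0 (h *: 1 + t0) - g 0| < d.
Proof.
move=> d0; apply: (near_t0 (P := fun t => `|G 0 t - g 0| < d)).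
have c0 : {for t0, continuous (G 0)}.
  by apply: is_derive_cont; apply: DeriveDef G0 erefl.
have H : \forall t \near t0, `|G 0 t0 - G 0 t| < d.
  exact: (cvgrPdist_lt _ _).1 c0 _ d0.
by apply: filterS H => t; rewrite distrC.
Qed.

Section Fixed.
Variable a : R.
Hypotheses (a0 : 0 <= a) (ae : a < e).

Let gW (s : R) : `|s| <= a -> W (g s) /\ {for s, continuous g}.
Proof.
move=> sa; have [Wg dg] := gsol (le_lt_trans sa ae); split=> //.
exact: is_derive_cont dg.
Qed.

Let sol_near : \forall h \near (0 : R)^', forall s : R, `|s| <= a ->
  is_derive s 1 (G ^~ (h *: 1 + t0)) (f (G s (h *: 1 + t0))).
Proof.
apply: filterS (near_t0 Gsol) => h H s sa.
by have [] := H s (le_lt_trans sa ae).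
Qed.

Let diff_bound : exists2 C, 0 < C & \forall h \near (0 : R)^', forall s, `|s| <= a ->
  `|G s (h *: 1 + t0) - g s| <= C * `|G 0 (h *: 1 + t0) - g 0|.
Proof.
have [L L0 HL] := curve_jac_bound Cf gW.
have [rho rho0 Hr] := curve_tube oW Cf ltr01 gW.
have [C C0 HC] := @gronwall R m (L + 1) a ltac:(by rewrite addr_ge0) a0.
exists C => //; near=> h => s sa.
have sol : forall s : R, `|s| <= a ->
  is_derive s 1 (G ^~ (h *: 1 + t0)) (f (G s (h *: 1 + t0))) by near: h.
have small : `|G 0 (h *: 1 + t0) - g 0| < rho / C.
  by near: h; apply: diff_small; rewrite divr_gt0.
have := HC (fun s => G s (h *: 1 + t0) - g s)
  (fun s => f (G s (h *: 1 + t0)) - f (g s)) 0 rho 0 s (lexx _).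
rewrite subr0 addr0 => H; apply: H; [exact: sa| |]; last first.
  by rewrite -(ltr_pdivlMl _ _ C0) mulrC.
move=> t t01 r; have ra : `|r| <= a.
  by have := in_seg sa t01; rewrite subr0.
have [Wg dg] := gsol (le_lt_trans ra ae).
split=> [|small']; first exact: is_deriveB (sol r ra) dg.
rewrite addr0; set w := G r _ - g r in small' *.
rewrite -(subrK (jac f (g r) w) (f _ - f _)) addrC mulrDl.
by apply: le_trans (ler_normD _ _) _; apply: lerD; [exact: HL|exact: Hr].
Unshelve. all: by end_near. Qed.

(** The solutions depend on the parameter in a Lipschitz way, by Gronwall's
    inequality on the difference of two of them. *)
Let quot_bound : exists2 B, 0 <= B & \forall h \near (0 : R)^', forall s, `|s| <= a ->
  `|quot h s| <= B.
Proof.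
have [C C0 HC] := diff_bound.
exists (C * (`|'D_1 (G 0) t0| + 1)); first by rewrite mulr_ge0 ?(ltW C0)// addr_ge0.
near=> h => s sa.
have D : forall s, `|s| <= a ->
  `|G s (h *: 1 + t0) - g s| <= C * `|G 0 (h *: 1 + t0) - g 0| by near: h.
have q1 : `|'D_1 (G 0) t0 - quot h 0| <= 1.
  by near: h; exact: (cvgrPdist_le _ _).1 quot_cvg0 _ ltr01.
apply: (@le_trans _ _ (C * `|quot h 0|)).
  by rewrite !normrZ mulrCA; apply: ler_wpM2l => //; exact: D.
rewrite ler_wpM2l ?(ltW C0)// -(subrK ('D_1 (G 0) t0) (quot h 0)) addrC.
by apply: le_trans (ler_normD _ _) _; rewrite lerD2l distrC.
Unshelve. all: by end_near. Qed.

Let quot_ode eta : 0 < eta -> \forall h \near (0 : R)^', forall s : R, `|s| <= a ->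
  is_derive s 1 (quot h) (quot' h s) /\
  `|quot' h s - jac f (g s) (quot h s)| <= eta.
Proof.
move=> eta0; have [C C0 HC] := diff_bound; have [B B0 HB] := quot_bound.
have eB : 0 < eta / (B + 1) by rewrite divr_gt0// ltr_wpDl.
have [rho rho0 Hr] := curve_tube oW Cf eB gW.
near=> h => s sa.
have h0 : h != 0 by near: h.
have D : forall s, `|s| <= a ->
  `|G s (h *: 1 + t0) - g s| <= C * `|G 0 (h *: 1 + t0) - g 0| by near: h.
have bd : forall s, `|s| <= a -> `|quot h s| <= B by near: h.
have sol : forall s : R, `|s| <= a ->
  is_derive s 1 (G ^~ (h *: 1 + t0)) (f (G s (h *: 1 + t0))) by near: h.
have small : `|G 0 (h *: 1 + t0) - g 0| < rho / C.
  by near: h; apply: diff_small; rewrite divr_gt0.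
have [Wg dg] := gsol (le_lt_trans sa ae).
split; first by apply: is_deriveZ; exact: is_deriveB (sol s sa) dg.
have small' : `|G s (h *: 1 + t0) - g s| < rho.
  apply: le_lt_trans (D s sa) _; by rewrite -ltr_pdivlMl// mulrC.
rewrite /quot' /quot jacZ -scalerBr normrZ.
apply: le_trans (ler_wpM2l (normr_ge0 _) (Hr s sa _ small')) _.
rewrite mulrCA -normrZ; apply: le_trans (ler_wpM2l (ltW eB) (bd s sa)) _.
by rewrite mulrAC -mulrA ler_piMr ?(ltW eta0)// ler_pdivrMr ?ltr_wpDl// mul1r lerDl.
Unshelve. all: by end_near. Qed.

(** The difference of two quotients solves the linearised equation approximately
    and is small at [s = 0]. *)
Let quot_cauchy eps : 0 < eps -> exists2 h0, h0 != 0 &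
  \forall h \near (0 : R)^', forall s, `|s| <= a -> `|quot h s - quot h0 s| <= eps.
Proof.
move=> eps0; have [L L0 HL] := curve_jac_bound Cf gW.
have [C C0 HC] := @gronwall R m L a L0 a0.
pose eta := eps / (4 * C); have eta0 : 0 < eta by rewrite divr_gt0// mulr_gt0.
have Q0 : \forall h \near (0 : R)^', `|'D_1 (G 0) t0 - quot h 0| <= eta.
  exact: (cvgrPdist_le _ _).1 quot_cvg0 _ eta0.
have Q1 := quot_ode eta0.
have /filter_ex [h0 [h00 [A1 A2]]] : \forall h \near (0 : R)^', h != 0 /\
    `|'D_1 (G 0) t0 - quot h 0| <= eta /\ forall s : R, `|s| <= a ->
    is_derive s 1 (quot h) (quot' h s) /\
    `|quot' h s - jac f (g s) (quot h s)| <= eta.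
  by apply: filterI => //; exact: filterI.
exists h0 => //; near=> h => s sa.
have B1 : `|'D_1 (G 0) t0 - quot h 0| <= eta by near: h.
have B2 : forall s : R, `|s| <= a -> is_derive s 1 (quot h) (quot' h s) /\
  `|quot' h s - jac f (g s) (quot h s)| <= eta by near: h.
have D0 : `|quot h 0 - quot h0 0| <= eta + eta.
  rewrite -(subrKA ('D_1 (G 0) t0)); apply: le_trans (ler_normD _ _) _.
  by apply: lerD => //; rewrite distrC.
have := HC (fun s => quot h s - quot h0 s) (fun s => quot' h s - quot' h0 s)
   (eta + eta) (C * (`|quot h 0 - quot h0 0| + (eta + eta)) + 1) 0 s.
rewrite subr0 => H.
have {}H : `|quot h s - quot h0 s| <= C * (`|quot h 0 - quot h0 0| + (eta + eta)).
  apply: H; [by rewrite addr_ge0// ltW|exact: sa| |by rewrite ltrDl].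
  move=> t t01 r; have ra : `|r| <= a by have := in_seg sa t01; rewrite subr0.
  have [d1 e1] := A2 r ra; have [d2 e2] := B2 r ra.
  split=> [|_]; first exact: is_deriveB.
  have -> : quot' h r - quot' h0 r = jac f (g r) (quot h r - quot h0 r) +
    ((quot' h r - jac f (g r) (quot h r)) - (quot' h0 r - jac f (g r) (quot h0 r))).
    by rewrite jacB; apply/rowP => j; rewrite !mxE; ring.
  apply: le_trans (ler_normD _ _) _; apply: lerD; first exact: HL.
  by apply: le_trans (ler_normB _ _) _; exact: lerD.
apply: le_trans H _.
apply: (@le_trans _ _ (C * (eta + eta + (eta + eta)))).
  by rewrite ler_wpM2l ?(ltW C0)// lerD2r.
rewrite le_eqVlt; apply/orP; left; apply/eqP; rewrite /eta.
have C1 : C != 0 by rewrite gt_eqF.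
by field.
Unshelve. all: by end_near. Qed.

Let flow_derivable_le (s : R) : `|s| <= a -> derivable (G s) t0 1.
Proof.
move=> sa; apply/cauchy_cvgP/cauchy_exP => eps eps0.
have e2 : 0 < eps / 2 by rewrite divr_gt0.
have [h0 _ H] := quot_cauchy e2; exists (quot h0 s).
apply: filterS H => h /(_ s sa) D; rewrite -ball_normE /= distrC.
by apply: le_lt_trans D _; rewrite ltr_pdivrMr// ltr_pMr// ltr1n.
Qed.

Let q s := 'D_1 (G s) t0.

Let quot_cvg (s : R) : `|s| <= a -> quot h s @[h --> 0^'] --> q s.
Proof. by move=> sa; exact: flow_derivable_le sa. Qed.

(** The quotients satisfy the linearised equation only up to a small error, so the
    limit is shown to be differentiable from the mean value inequality for
    [quot h s - s *: v], whose derivative is at most [eps] near [s0]. *)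
Let flow_ode_lt (s0 : R) : `|s0| < a -> is_derive s0 1 q (jac f (g s0) (q s0)).
Proof.
move=> s0a; set v := jac _ _ _.
have [L L0 HL] := curve_jac_bound Cf gW.
have [B B0 HB] := quot_bound.
apply: is_derive_little => eps eps0.
have s0a' := ltW s0a; have [Wg cg] := gW s0a'.
have e4 : 0 < eps / 4 by rewrite divr_gt0.
pose kap := eps / 4 / (L + 1).
have kap0 : 0 < kap by rewrite divr_gt0// ltr_wpDl.
have Lkap : L * kap <= eps / 4.
  by rewrite mulrCA ler_piMr ?(ltW e4)// ler_pdivrMr ?ltr_wpDl// mul1r lerDl.
have LB0 : 0 <= L * B + eps / 4 by rewrite addr_ge0 ?mulr_ge0// ltW.
pose d1 := kap / (L * B + eps / 4 + 1).
have d10 : 0 < d1 by rewrite divr_gt0// ltr_wpDl.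
have Ld1 : (L * B + eps / 4) * d1 <= kap.
  by rewrite mulrCA ler_piMr ?(ltW kap0)// ler_pdivrMr ?ltr_wpDl// mul1r lerDl.
have q0 : 0 < eps / 4 / (`|q s0| + 1) by rewrite divr_gt0// ltr_wpDl.
have [r r0 Hr] := jac_continuous Cf Wg q0.
have /nbhs_ballP [d2 /= d20 Hd2] : \forall s' \near s0, `|g s0 - g s'| < r.
  exact: (cvgrPdist_lt _ _).1 cg _ r0.
have as0 : 0 < a - `|s0| by rewrite subr_gt0.
exists (Num.min (a - `|s0|) (Num.min d1 d2)); first by rewrite !lt_min as0 d10.
move=> s; rewrite !lt_min => /and3P[sa sd1 sd2].
have near_s0 x : `|x - s0| <= `|s - s0| -> `|x| <= a.
  move=> xs; rewrite -(subrK s0 x) (le_trans (ler_normD _ _))//.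
  by rewrite -lerBrDr (le_trans xs)// ltW.
have sa' : `|s| <= a by apply: near_s0.
have lim1 : (quot h s - quot h s0 - (s - s0) *: v) @[h --> 0^'] -->
    q s - q s0 - (s - s0) *: v.
  by apply: cvgB; [apply: cvgB; exact: quot_cvg|exact: cvg_cst].
have := cvg_dist_le (x := 0) (e := eps * `|s - s0|) _ lim1; rewrite subr0; apply.
have Q1 := quot_ode e4.
near=> h; rewrite subr0.
have A2 : forall s : R, `|s| <= a -> is_derive s 1 (quot h) (quot' h s) /\
  `|quot' h s - jac f (g s) (quot h s)| <= eps / 4 by near: h.
have bd : forall s, `|s| <= a -> `|quot h s| <= B by near: h.
have qk : `|q s0 - quot h s0| <= kap.
  by near: h; exact: (cvgrPdist_le _ _).1 (quot_cvg s0a') _ kap0.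
have on_seg t : 0 <= t <= 1 -> `|s0 + t * (s - s0) - s0| <= `|s - s0|.
  move=> /andP[t0' t1]; rewrite addrC addKr normrM (ger0_norm t0').
  by rewrite ler_piMl.
have lip x : `|x - s0| <= `|s - s0| -> `|quot h x - quot h s0| <= kap.
  move=> xs; have M := @mean_value_le R m (quot h) (quot' h) (L * B + eps / 4) s0 x LB0.
  apply: le_trans (M _) _.
    move=> t t01 y; have ya : `|y| <= a.
      apply: near_s0; apply: le_trans xs; move: t01 => /andP[t0' t1].
      by rewrite /y addrC addKr normrM (ger0_norm t0') ler_piMl.
    have [dy ey] := A2 y ya; split=> //.
    rewrite -(subrK (jac f (g y) (quot h y)) (quot' h y)) addrC.
    apply: le_trans (ler_normD _ _) _; apply: lerD => //.
    by apply: le_trans (HL _ ya _) _; rewrite ler_wpM2l// bd.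
  apply: le_trans Ld1; rewrite ler_wpM2l//; apply: le_trans xs _; exact: ltW.
have -> : quot h s - quot h s0 - (s - s0) *: v =
   (quot h s - s *: v) - (quot h s0 - s0 *: v).
  by apply/rowP => j; rewrite !mxE; ring.
apply: (@mean_value_le R m (fun x => quot h x - x *: v) (fun x => quot' h x - v)).
  exact: ltW.
move=> t t01 y; have ys := on_seg t t01; have ya := near_s0 _ ys.
have dv : is_derive (y : R) 1 (fun x : R => x *: v) v.
  apply/is_derive_rVP => j; under eq_fun do rewrite mxE.
  by apply: is_derive_eq; rewrite scaler0 add0r [LHS]mulr1.
have [dy ey] := A2 y ya; split; first exact: is_deriveB dy dv.
have -> : quot' h y - v = (quot' h y - jac f (g y) (quot h y)) +
   (jac f (g y) (quot h y - quot h s0) +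
   (jac f (g y) (quot h s0 - q s0) + (jac f (g y) (q s0) - jac f (g s0) (q s0)))).
  by rewrite !jacB /v; apply/rowP => j; rewrite !mxE; ring.
have -> : eps = eps / 4 + (eps / 4 + (eps / 4 + eps / 4)) by field.
apply: le_trans (ler_normD _ _) _; apply: lerD; first exact: ey.
apply: le_trans (ler_normD _ _) _; apply: lerD.
  apply: le_trans (HL _ ya _) _; apply: le_trans Lkap.
  by rewrite ler_wpM2l// lip.
apply: le_trans (ler_normD _ _) _; apply: lerD.
  apply: le_trans (HL _ ya _) _; apply: le_trans Lkap.
  by rewrite ler_wpM2l// distrC.
apply: (@le_trans _ _ (eps / 4 / (`|q s0| + 1) * `|q s0|)).
  apply: Hr; rewrite distrC; apply: Hd2; rewrite -ball_normE /= distrC.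
  exact: le_lt_trans ys sd2.
by rewrite mulrAC -mulrA ler_piMr ?(ltW e4)// ler_pdivrMr ?ltr_wpDl// mul1r lerDl.
Unshelve. all: by end_near. Qed.

Lemma flow_derivative_lt (s : R) : `|s| < a ->
  derivable (G s) t0 1 /\
  is_derive s 1 (fun r => 'D_1 (G r) t0) (jac f (G s t0) ('D_1 (G s) t0)).
Proof.
by move=> sa; split; [exact: flow_derivable_le (ltW sa)|exact: flow_ode_lt].
Qed.

End Fixed.

(** The difference quotients of the solutions in the parameter satisfy the
    linearised equation up to an error that tends to zero uniformly in [s]; Gronwall's
    inequality makes them a Cauchy family, and the limit satisfies the linearised
    equation itself. *)
Lemma flow_derivative (s : R) : `|s| < e ->
  derivable (G s) t0 1 /\
  is_derive s 1 (fun r => 'D_1 (G r) t0) (jac f (G s t0) ('D_1 (G s) t0)).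
Proof.
move=> se; apply: (@flow_derivative_lt ((`|s| + e) / 2)).
- by rewrite divr_ge0// addr_ge0// (le_trans _ (ltW se)).
- by rewrite ltr_pdivrMr// mulr_natr mulr2n ltrD2r.
- by rewrite ltr_pdivlMr// mulr_natr mulr2n ltrD2l.
Qed.

End FlowDerivative.

(** * The Levi-Civita connection and its Lie derivative *)

Local Notation Γ := christoffel.
Local Notation dΓ x g i j k := (pd x (fun q => christoffel g q i j k)).
Local Notation dmx x A i j := (pd x (fun q => A q i j)).

Section MoreRegularity.
Variables (R : realType) (n : nat).
Implicit Types (U : set 'rV[R]_n).

Lemma Ck_sub U U' k (f : 'rV[R]_n -> R) : U' `<=` U -> Ck U k f -> Ck U' k f.
Proof.
move=> UU; elim: k f => [|k IH] f [cf df]; split=> //.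
1,2: by move=> p /UU; exact: cf.
move=> i; have [dfi Ci] := df i; split; last exact: IH.
by move=> p /UU; exact: dfi.
Qed.

Lemma Ck_det U k m (A : 'rV[R]_n -> 'M[R]_m) : open U ->
  (forall i j, Ck U k (fun p => A p i j)) -> Ck U k (fun p => \det (A p)).
Proof.
move=> oU CA; rewrite /determinant; apply: Ck_sum => // s.
by apply: CkM => //; [exact: Ck_cst|apply: Ck_prod].
Qed.

(** Cramer's formula. *)
Lemma Ck_invmx U k m (A : 'rV[R]_n -> 'M[R]_m) i j : open U ->
  (forall p, U p -> A p \in unitmx) ->
  (forall i j, Ck U k (fun p => A p i j)) -> Ck U k (fun p => invmx (A p) i j).
Proof.
move=> oU uA CA.
have Cadj : Ck U k (fun p => (\det (A p))^-1 * cofactor (A p) j i).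
  apply: CkM => //.
    apply: CkV => //; last exact: Ck_det.
    by move=> p /uA; rewrite unitmxE unitfE.
  rewrite /cofactor; apply: CkM => //; first exact: Ck_cst.
  apply: Ck_det => // a b.
  by apply: (Ck_congr oU _ (CA (lift j a) (lift i b))) => p _; rewrite !mxE.
apply: (Ck_congr oU _ Cadj) => p; rewrite inE => Up.
by rewrite /invmx uA// !mxE.
Qed.

Lemma smooth_christoffel U (g : 'rV[R]_n -> 'M[R]_n) i j k :
  open U -> is_metric U g -> smooth U (fun p => Γ g p i j k).
Proof.
move=> oU [sg _ ug] r; rewrite /christoffel.
apply: CkM => //; first exact: Ck_cst.
apply: Ck_sum => // l; apply: CkM => //.
  by apply: Ck_invmx => // a b; exact: sg.
by apply: CkB => //; first apply: CkD => //; apply: Ck_pd; exact: sg.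
Qed.

Lemma christoffelC U (g : 'rV[R]_n -> 'M[R]_n) p i j k :
  open U -> is_metric U g -> U p -> Γ g p i j k = Γ g p i k j.
Proof.
move=> oU [_ tg _] Up; rewrite /christoffel; congr (_ * _); apply: eq_bigr => l _.
congr (_ * _); rewrite [X in X - _]addrC; congr (_ - _).
apply: (@pd_congr R n U (fun q => g q j k) (fun q => g q k j) p l oU) => [q|//].
by rewrite inE => /tg E; rewrite -{1}E mxE.
Qed.

End MoreRegularity.

Section Blocks.
Variables (R : realType) (m n : nat).

Lemma lsubmx_contract (x y : 'rV[R]_(m + n)) : `|lsubmx x - lsubmx y| <= `|x - y|.
Proof.
apply: normr_rV_le => // i; rewrite !mxE.
by have := normr_coord (x - y) (lshift n i); rewrite !mxE.
Qed.

Lemma rsubmx_contract (x y : 'rV[R]_(m + n)) : `|rsubmx x - rsubmx y| <= `|x - y|.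
Proof.
apply: normr_rV_le => // i; rewrite !mxE.
by have := normr_coord (x - y) (rshift m i); rewrite !mxE.
Qed.

Definition lsub_index (i : 'I_(m + n)) : option 'I_m :=
  match fintype.split i with inl a => Some a | inr _ => None end.

Lemma lsub_index_l a : lsub_index (lshift n a) = Some a.
Proof. by rewrite /lsub_index -[lshift n a]/(unsplit (inl a)) unsplitK. Qed.

Lemma lsub_index_r a : lsub_index (rshift m a) = None.
Proof. by rewrite /lsub_index -[rshift m a]/(unsplit (inr a)) unsplitK. Qed.

Lemma lsubmx_delta h (i : 'I_(m + n)) (p : 'rV[R]_(m + n)) :
  lsubmx (h *: delta_mx 0 i + p) =
  h *: oapp (delta_mx 0) 0 (lsub_index i) + lsubmx p.
Proof.
apply/rowP => j; rewrite !mxE; congr (h * _ + _).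
case: (split_ordP i) => a ->; rewrite ?lsub_index_l ?lsub_index_r /= !mxE ?eq_lshift//.
by rewrite eq_lrshift ?andbF.
Qed.

Lemma pd_lsubmx_l (f : 'rV[R]_m -> R) i p :
  pd (lshift n i) (fun q => f (lsubmx q)) p = pd i f (lsubmx p).
Proof. by rewrite (pd_precomp lsubmx_delta f) lsub_index_l. Qed.

Lemma pd_lsubmx_r (f : 'rV[R]_m -> R) i p :
  pd (rshift m i) (fun q : 'rV[R]_(m + n) => f (lsubmx q)) p = 0.
Proof. by rewrite (pd_precomp lsubmx_delta f) lsub_index_r. Qed.

Lemma Ck_lsubmx (U : set 'rV[R]_m) k (f : 'rV[R]_m -> R) : Ck U k f ->
  Ck [set p : 'rV[R]_(m + n) | U (lsubmx p)] k (fun p => f (lsubmx p)).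
Proof. exact: (Ck_precomp lsubmx_contract lsubmx_delta). Qed.

Lemma open_lsubmx (U : set 'rV[R]_m) : open U ->
  open [set p : 'rV[R]_(m + n) | U (lsubmx p)].
Proof.
move=> oU; have /continuousP := contraction_continuous lsubmx_contract; exact.
Qed.

Lemma is_derive_row_mx (V : normedModType R) (x v : V) (a : V -> 'rV[R]_m)
    (b : V -> 'rV[R]_n) a' b' :
  is_derive x v a a' -> is_derive x v b b' ->
  is_derive x v (fun y => row_mx (a y) (b y)) (row_mx a' b').
Proof.
move=> /is_derive_rVP da /is_derive_rVP db; apply/is_derive_rVP => i.
case: (split_ordP i) => j ->; rewrite ?row_mxEl ?row_mxEr.
  by under eq_fun do rewrite row_mxEl.
by under eq_fun do rewrite row_mxEr.
Qed.

Lemma is_derive_row_mxl (V : normedModType R) (x v : V) (a : V -> 'rV[R]_(m + n)) a' :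
  is_derive x v a a' -> is_derive x v (fun y => lsubmx (a y)) (lsubmx a').
Proof.
move=> /is_derive_rVP da; apply/is_derive_rVP => i; rewrite mxE.
by under eq_fun do rewrite mxE.
Qed.

Lemma is_derive_row_mxr (V : normedModType R) (x v : V) (a : V -> 'rV[R]_(m + n)) a' :
  is_derive x v a a' -> is_derive x v (fun y => rsubmx (a y)) (rsubmx a').
Proof.
move=> /is_derive_rVP da; apply/is_derive_rVP => i; rewrite mxE.
by under eq_fun do rewrite mxE.
Qed.

End Blocks.

Section Variation.
Variables (R : realType) (n : nat) (D : set 'rV[R]_n) (g : 'rV[R]_n -> 'M[R]_n).
Hypotheses (oD : open D) (mg : is_metric D g).

(** The quadratic term of the geodesic equation. *)
Definition geo_acc (p X : 'rV[R]_n) : 'rV[R]_n :=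
  \row_i \sum_j \sum_k Γ g p i j k * X 0 j * X 0 k.

Variable v : 'rV[R]_n -> 'rV[R]_n.
Hypothesis sv : vector_field D v.

(** The Lie derivative along [v] of the connection, a symmetric tensor of type
    (1,2), evaluated at [(X, X)].  The terms are the second derivatives of [v], the
    derivative of the Christoffel symbols along [v], and the change of their two
    arguments and of their value under the differential of [v]. *)
Definition lie_conn (p X : 'rV[R]_n) : 'rV[R]_n :=
  \row_i (\sum_j \sum_k (pd j (dmx k v 0 i) p
            + \sum_l dΓ l g i j k p * v p 0 l) * X 0 j * X 0 k
          + \sum_j \sum_k Γ g p i j k *
              (jac v p X 0 j * X 0 k + X 0 j * jac v p X 0 k))
  - jac v p (geo_acc p X).

(** The complete lift of [v] to the tangent bundle: its flow is the differential of
    the flow of [v].  Through it the second derivatives of a family of curves in the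
    curve parameter are covered by the theorem on first derivatives. *)
Definition lifted_field (q : 'rV[R]_(n + n)) : 'rV[R]_(n + n) :=
  row_mx (v (lsubmx q)) (jac v (lsubmx q) (rsubmx q)).

Let TD : set 'rV[R]_(n + n) := [set q | D (lsubmx q)].

Lemma lifted_field_C1 j : Ck TD 1 (fun q => lifted_field q 0 j).
Proof.
have oT : open TD by exact: open_lsubmx.
case: (split_ordP j) => i ->.
  have C : Ck TD 1 (fun q => v (lsubmx q) 0 i) by exact: Ck_lsubmx (sv i 1%N).
  by apply: (Ck_congr oT _ C) => q _; rewrite row_mxEl.
have C : Ck TD 1 (fun q => \sum_k dmx k v 0 i (lsubmx q) * q 0 (rshift n k)).
  apply: Ck_sum => // k; apply: CkM => //; last exact: Ck_coord.
  by apply: Ck_lsubmx; exact: (Ck_pd _ (sv i 2%N)).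
apply: (Ck_congr oT _ C) => q _; rewrite row_mxEr mxE.
by apply: eq_bigr => k _; rewrite !mxE.
Qed.

Lemma pd_lifted_l q i j : D (lsubmx q) ->
  dmx (lshift n j) lifted_field 0 (rshift n i) q =
  \sum_k pd j (dmx k v 0 i) (lsubmx q) * rsubmx q 0 k.
Proof.
move=> Dq; have E : (fun q => lifted_field q 0 (rshift n i)) =
    \sum_k (fun q => dmx k v 0 i (lsubmx q) * q 0 (rshift n k)).
  apply/funext => r; rewrite /lifted_field row_mxEr mxE fct_sumE.
  by apply: eq_bigr => k _; rewrite mxE.
rewrite E /pd; apply: derive_val; apply: is_derive_sum => k.
have dk : is_derive q (delta_mx 0 (lshift n j)) (fun q => dmx k v 0 i (lsubmx q))
    (pd j (dmx k v 0 i) (lsubmx q)).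
  apply: DeriveDef; last exact: pd_lsubmx_l.
  have := @Ck_lsubmx R n n D 1 _ (Ck_pd k (sv i 2%N)).
  by move=> /Ck_derivable; apply.
have := is_deriveM dk (is_derive_coord q (delta_mx 0 (lshift n j)) (rshift n k)).
congr is_derive; rewrite !mxE eq_rlshift andbF scaler0 add0r /GRing.scale /=.
by rewrite mulrC.
Qed.

Lemma pd_lifted_r q i j : D (lsubmx q) ->
  dmx (rshift n j) lifted_field 0 (rshift n i) q =
  dmx j v 0 i (lsubmx q).
Proof.
move=> Dq; have E : (fun q => lifted_field q 0 (rshift n i)) =
    \sum_k (fun q => dmx k v 0 i (lsubmx q) * q 0 (rshift n k)).
  apply/funext => r; rewrite /lifted_field row_mxEr mxE fct_sumE.
  by apply: eq_bigr => k _; rewrite mxE.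
have E2 : dmx j v 0 i (lsubmx q) =
    \sum_k dmx k v 0 i (lsubmx q) * (delta_mx 0 (rshift n j) : 'rV[R]_(n + n)) 0 (rshift n k).
  rewrite (bigD1 j)//= big1 ?addr0 => [|k kj]; rewrite mxE eq_rshift ?eqxx ?mulr1//.
  by rewrite (negPf kj) andbF mulr0.
rewrite E E2 /pd; apply: derive_val; apply: is_derive_sum => k.
have dk : is_derive q (delta_mx 0 (rshift n j)) (fun q => dmx k v 0 i (lsubmx q)) 0.
  apply: DeriveDef; last exact: pd_lsubmx_r.
  have := @Ck_lsubmx R n n D 1 _ (Ck_pd k (sv i 2%N)).
  by move=> /Ck_derivable; apply.
have := is_deriveM dk (is_derive_coord q (delta_mx 0 (rshift n j)) (rshift n k)).
congr is_derive; by rewrite scaler0 addr0.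
Qed.


Lemma jac_lifted_r q X A i : D (lsubmx q) ->
  rsubmx (jac lifted_field q (row_mx X A)) 0 i =
  \sum_j \sum_k pd j (dmx k v 0 i) (lsubmx q) * X 0 j * rsubmx q 0 k
  + jac v (lsubmx q) A 0 i.
Proof.
move=> Dq; rewrite !mxE big_split_ord /=; congr (_ + _); apply: eq_bigr => j _.
  rewrite row_mxEl pd_lifted_l// mulr_suml; apply: eq_bigr => k _.
  by rewrite mulrAC.
by rewrite row_mxEr pd_lifted_r.
Qed.

End Variation.

Section VariationFormula.
Variables (R : realType) (n : nat) (D : set 'rV[R]_n) (g : 'rV[R]_n -> 'M[R]_n).
Hypotheses (oD : open D) (mg : is_metric D g).

Lemma jacD (f : 'rV[R]_n -> 'rV[R]_n) p w1 w2 :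
  jac f p (w1 + w2) = jac f p w1 + jac f p w2.
Proof.
apply/rowP => j; rewrite !mxE -big_split /=; apply: eq_bigr => i _.
by rewrite !mxE mulrDr.
Qed.

Lemma jac0 (f : 'rV[R]_n -> 'rV[R]_n) p : jac f p 0 = 0.
Proof. by have := jacB f p 0 0; rewrite subr0 subrr. Qed.

Lemma is_derive_geo_acc (p X : R -> 'rV[R]_n) (s : R) p' X' : D (p s) ->
  is_derive s 1 p p' -> is_derive s 1 X X' ->
  is_derive s 1 (fun r => geo_acc g (p r) (X r))
    (\row_i \sum_j \sum_k
      ((\sum_l dΓ l g i j k (p s) * p' 0 l)
         * X s 0 j * X s 0 k
       + Γ g (p s) i j k * (X' 0 j * X s 0 k + X s 0 j * X' 0 k))).
Proof.
move=> Dp dp /is_derive_rVP dX; apply/is_derive_rVP => i; rewrite mxE.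
have -> : (fun r => geo_acc g (p r) (X r) 0 i) = \sum_j \sum_k
    (fun r => Γ g (p r) i j k * X r 0 j * X r 0 k).
  apply/funext => r; rewrite mxE fct_sumE; apply: eq_bigr => j _.
  by rewrite fct_sumE; apply: eq_bigr.
apply: is_derive_sum => j; apply: is_derive_sum => k.
have dG := is_derive_chain oD (smooth_christoffel i j k oD mg 1%N) Dp dp.
have := is_deriveM (is_deriveM dG (dX j)) (dX k).
congr is_derive; rewrite mulrfctE /GRing.scale /=; ring.
Qed.

(** The covariant derivative of the tangent vector along the curve. *)
Definition covacc (gamma : R -> 'rV[R]_n) (t : R) : 'rV[R]_n :=
  'D_1 (fun r => 'D_1 gamma r) t + geo_acc g (gamma t) ('D_1 gamma t).

Variable v : 'rV[R]_n -> 'rV[R]_n.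
Hypothesis sv : vector_field D v.

(** The theorem on the dependence of solutions on a parameter is used for [v], which
    gives the tangent of [F s], and for the lifted field, which gives the second
    derivative.  What remains is the product rule for the quadratic term; the Lie
    derivative of the connection is exactly what it leaves over. *)
Lemma variation (J : set R) (c : R -> 'rV[R]_n) (F : R -> R -> 'rV[R]_n) (e t0 : R) :
  0 < e -> open J -> J t0 ->
  (forall t, J t -> [/\ derivable c t 1, F 0 t = c t & forall s, `|s| < e ->
     D (F s t) /\ is_derive s 1 (F ^~ t) (v (F s t))]) ->
  derivable (fun t => 'D_1 c t) t0 1 ->
  forall s, `|s| < e ->
  [/\ forall t, J t -> derivable (F s) t 1,
      derivable (fun t => 'D_1 (F s) t) t0 1,
      is_derive s 1 (fun r => 'D_1 (F r) t0) (jac v (F s t0) ('D_1 (F s) t0))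
    & is_derive s 1 (fun r => covacc (F r) t0)
        (lie_conn g v (F s t0) ('D_1 (F s) t0) + jac v (F s t0) (covacc (F s) t0))].
Proof.
move=> e0 oJ Jt0 FP dc2 s se.
have nJ t (P : R -> Prop) : J t -> (forall r, J r -> P r) -> \forall r \near t, P r.
  by move=> Jt JP; apply: filterS JP _; exact: open_nbhs_nbhs.
have FP0 t : J t -> F 0 t = c t by move=> /FP[].
have cD0 t : J t -> 'D_1 (F 0) t = 'D_1 c t.
  by move=> Jt; apply: near_eq_derive; apply: (nJ t) => // r /FP0.
have F1 t (r : R) : J t -> `|r| < e -> derivable (F r) t 1 /\
    is_derive r 1 (fun r => 'D_1 (F r) t) (jac v (F r t) ('D_1 (F r) t)).
  move=> Jt re; apply: (flow_derivative oD (fun j => sv j 1%N) _ _ re).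
    by apply: nJ Jt _ => t' /FP[_ _].
  have [dc _ _] := FP t Jt; apply: near_eq_derivable dc.
  by apply: (nJ t) => // t' /FP0.
pose G r t := row_mx (F r t) ('D_1 (F r) t).
have GP : \forall t \near t0, forall r, `|r| < e ->
    D (lsubmx (G r t)) /\ is_derive r 1 (G ^~ t) (lifted_field v (G r t)).
  apply: nJ Jt0 _ => t Jt r re; rewrite row_mxKl.
  have [_ _ /(_ r re)[DF dF]] := FP t Jt; have [_ dF1] := F1 t r Jt re.
  split=> //; rewrite /lifted_field row_mxKl row_mxKr.
  exact: is_derive_row_mx.
have G0 : derivable (G 0) t0 1.
  have [dc _ _] := FP t0 Jt0.
  have E : \forall t \near t0, row_mx (c t) ('D_1 c t) = G 0 t.
    by apply: nJ Jt0 _ => t Jt; rewrite /G (FP0 _ Jt) (cD0 _ Jt).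
  apply: near_eq_derivable E _.
  by have [] := is_derive_row_mx (derivableP dc) (derivableP dc2).
have [dG dGs] := flow_derivative (open_lsubmx oD) (lifted_field_C1 oD sv) GP G0 se.
have dF2 (r : R) : `|r| < e -> derivable (fun t => 'D_1 (F r) t) t0 1 /\
   'D_1 (G r) t0 = row_mx ('D_1 (F r) t0) ('D_1 (fun t => 'D_1 (F r) t) t0).
  move=> re; have [dGr _] := flow_derivative (open_lsubmx oD) (lifted_field_C1 oD sv) GP G0 re.
  have dR := is_derive_row_mxr (derivableP dGr).
  have E : (fun y => rsubmx (G r y)) = (fun t => 'D_1 (F r) t).
    by apply/funext => t; rewrite row_mxKr.
  rewrite E in dR; have [d1 d2] := dR; split=> //.
  have [dFr _] := F1 t0 r Jt0 re.
  have [_ ->] := is_derive_row_mx (derivableP dFr) (derivableP d1).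
  by [].
have [_ _ /(_ s se)[DF dF]] := FP t0 Jt0; have [dFs dF1] := F1 t0 s Jt0 se.
have [d2 GE] := dF2 s se.
split; [by move=> t Jt; have [] := F1 t s Jt se|exact: d2|exact: dF1|].
set X := 'D_1 (F s) t0; set A := 'D_1 (fun t => 'D_1 (F s) t) t0.
have dA : is_derive s 1 (fun r => 'D_1 (fun t => 'D_1 (F r) t) t0)
    (rsubmx (jac (lifted_field v) (G s t0) (row_mx X A))).
  have := is_derive_row_mxr dGs; rewrite GE; apply: near_eq_is_derive.
  have ns : \forall r \near s, `|r| < e.
    have := @cvgr_lt R R (nbhs s) _ (fun r => `|r|) `|s| _ e se; apply.
    exact: norm_continuous.
  by apply: filterS ns => r re; have [_ ->] := dF2 r re; rewrite row_mxKr.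
have dS := is_derive_geo_acc DF dF dF1.
have := is_deriveD dA dS; congr is_derive.
rewrite /covacc -/X -/A jacD.
apply/rowP => i.
have DG : D (lsubmx (G s t0)) by rewrite row_mxKl.
rewrite [in LHS]mxE (jac_lifted_r sv _ _ _ DG) row_mxKl row_mxKr -/X.
rewrite [in RHS]mxE /lie_conn [in X in _ = X + _]mxE [in X in _ = _ + X]mxE.
rewrite [in X in _ = (X + _) + _]mxE [in X in _ = (_ + X) + _]mxE.
rewrite [X in _ + X = _]mxE.
set j1 := jac v (F s t0) A 0 i; set j2 := jac v (F s t0) (geo_acc g (F s t0) X) 0 i.
have -> : forall a b : R, a + b - j2 + (j1 + j2) = a + b + j1 by move=> *; ring.
rewrite [in LHS]addrAC; congr (_ + _).
rewrite -!big_split /=; apply: eq_bigr => j _; rewrite -!big_split /=.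
apply: eq_bigr => k _; rewrite !mulrDl -!addrA; congr (_ + _).
Qed.

End VariationFormula.

(** * Projective vector fields *)

Section LinearODE.
Variables (R : realType) (n : nat) (D : set 'rV[R]_n) (f : 'rV[R]_n -> 'rV[R]_n).
Hypotheses (oD : open D) (Cf : forall j, Ck D 1 (fun q => f q 0 j)).

(** Gronwall's inequality with zero initial value. *)
Lemma linear_ode_zero (g z : R -> 'rV[R]_n) (e s1 s2 : R) :
  (forall s : R, `|s| < e -> [/\ D (g s), {for s, continuous g} &
     is_derive s 1 z (jac f (g s) (z s))]) ->
  `|s1| < e -> `|s2| < e -> z s1 = 0 -> z s2 = 0.
Proof.
move=> gz s1e s2e z1; pose a := Num.max `|s1| `|s2|.
have ae : a < e by rewrite gt_max s1e.
have a0 : 0 <= a by rewrite le_max normr_ge0.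
have gW (s : R) : `|s| <= a -> D (g s) /\ {for s, continuous g}.
  by move=> sa; have [] := gz s (le_lt_trans sa ae).
have [L L0 HL] := curve_jac_bound Cf gW.
have [C C0 HC] := @gronwall R n L (a + a) L0 (addr_ge0 a0 a0).
have a1 : `|s1| <= a by rewrite le_max lexx.
have a2 : `|s2| <= a by rewrite le_max lexx orbT.
have := HC z (fun s => jac f (g s) (z s)) 0 1 s1 s2 (lexx _).
rewrite z1 normr0 addr0 mulr0 => H; apply/eqP; rewrite -normr_le0.
apply: H; last exact: ltr01.
  by apply: le_trans (ler_normB _ _) _; exact: lerD.
move=> t /andP[t0 t1] s.
have sa : `|s| <= a.
  have -> : s = (1 - t) * s1 + t * s2 by rewrite /s; ring.
  have -> : a = (1 - t) * a + t * a by ring.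
  apply: le_trans (ler_normD _ _) _; rewrite !normrM (ger0_norm t0).
  have t1' : 0 <= 1 - t by rewrite subr_ge0.
  by rewrite (ger0_norm t1'); apply: lerD; exact: ler_wpM2l.
have [_ _ dz] := gz s (le_lt_trans sa ae).
by split=> [|_]; [exact: dz|rewrite addr0; exact: HL].
Qed.

End LinearODE.

Lemma open_norm_lt (R : realType) (b : R) : open [set t : R | `|t| < b].
Proof.
rewrite (_ : [set t | _] = (fun t : R => `|t|) @^-1` [set x | x < b])//.
by move/continuousP : (@norm_continuous R R); apply; exact: open_lt.
Qed.

Section Projective.
Variables (R : realType) (n : nat) (D : set 'rV[R]_n) (g : 'rV[R]_n -> 'M[R]_n).
Hypotheses (oD : open D) (mg : is_metric D g).
Variable v : 'rV[R]_n -> 'rV[R]_n.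
Hypothesis sv : vector_field D v.

Lemma derive1_fun (V : normedModType R) (c : R -> V) : derive1 c = 'D_1 c.
Proof. by apply/funext => t; rewrite derive1E. Qed.

Lemma derive_congr_open (V : normedModType R) (J : set R) (c c' : R -> V) t :
  open J -> J t -> (forall r, J r -> c r = c' r) -> 'D_1 c t = 'D_1 c' t.
Proof.
move=> oJ Jt E; apply: near_eq_derive; apply: filterS E _; exact: open_nbhs_nbhs.
Qed.

Lemma covacc_congr (J : set R) (c c' : R -> 'rV[R]_n) t :
  open J -> J t -> (forall r, J r -> c r = c' r) -> covacc g c t = covacc g c' t.
Proof.
move=> oJ Jt E.
have E1 r : J r -> 'D_1 c r = 'D_1 c' r by move=> Jr; exact: derive_congr_open E.
by rewrite /covacc (derive_congr_open oJ Jt E1) (E1 t Jt) (E t Jt).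
Qed.

Lemma geodesicP (J : set R) (c : R -> 'rV[R]_n) :
  geodesic g D J c <-> forall t, J t ->
    [/\ D (c t), derivable c t 1, derivable ('D_1 c) t 1, 'D_1 c t != 0
      & covacc g c t = 0].
Proof.
rewrite /geodesic !derive1_fun; split=> H t Jt; have [H1 H2 H3 H4 H5] := H t Jt; split=> //.
  by apply/rowP => i; rewrite !mxE.
by move=> i; move/rowP : H5 => /(_ i); rewrite !mxE.
Qed.

(** The covariant acceleration of the transported geodesic solves a homogeneous
    linear equation in the flow time and is zero at first.  Its tangent solves one
    too; if it vanished at some flow time it would have vanished at the beginning.
    The affine parameter is preserved, so the reparametrisation [tau] is kept. *)
Lemma lie_conn0_projective :
  (forall p X, D p -> lie_conn g v p X = 0) -> projective_field D g v.
Proof.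
move=> L0 V e phi [oV VD e0 flow] s se J gamma [oiJ [J' [c [tau [oiJ' geo stau tauJ tg]]]]].
split=> //; exists J', (fun t => phi s (c t)), tau; split=> //; last first.
  by move=> t /tg[? ->].
have {}geo t : J' t -> [/\ V (c t), derivable c t 1, derivable ('D_1 c) t 1,
    'D_1 c t != 0 & covacc g c t = 0].
  move=> Jt; have := geo; rewrite /geodesic !derive1_fun => /(_ t Jt) [? ? ? ? H].
  by split=> //; apply/rowP => i; rewrite !mxE.
apply/geodesicP => t Jt; have [oJ' _] := oiJ'.
pose F r t := phi r (c t).
have FP r : J' r -> [/\ derivable c r 1, F 0 r = c r & forall s, `|s| < e ->
     D (F s r) /\ is_derive s 1 (F ^~ r) (v (F s r))].
  by move=> /geo[Vc dc _ _ _]; have [f0 fl] := flow _ Vc; split.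
have [Vc dc dc2 c1 cov0] := geo t Jt.
have var := variation oD mg sv e0 oJ' Jt FP dc2.
have [dF dF2 _ _] := var s se.
have [_ _ /(_ s se) [DF _]] := FP t Jt.
have F0 : forall r, J' r -> F 0 r = c r by move=> r /FP[].
have n0 : `|0 : R| < e by rewrite normr0.
have base (r : R) : `|r| < e -> D (F r t) /\ {for r, continuous (F ^~ t)}.
  move=> re; have [_ _ /(_ r re) [DFr dFr]] := FP t Jt; split=> //.
  exact: is_derive_cont dFr.
split; [exact: DF|exact: dF|exact: dF2| |].
- apply/eqP => z; move/eqP : c1; apply.
  rewrite -(derive_congr_open oJ' Jt F0).
  apply: (@linear_ode_zero R n D v (fun j => sv j 1%N) (F ^~ t)
    (fun r => 'D_1 (F r) t) e s 0 _ se n0 z) => r re.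
  by have [Db cb] := base r re; have [_ _ d1 _] := var r re; split.
- have z0 : covacc g (F 0) t = 0 by rewrite (covacc_congr oJ' Jt F0).
  apply: (@linear_ode_zero R n D v (fun j => sv j 1%N) (F ^~ t)
    (fun r => covacc g (F r) t) e 0 s _ n0 se z0) => r re.
  have [Db cb] := base r re; have [_ _ _] := var r re.
  rewrite (L0 _ _ Db) add0r => dE.
  by split; [exact: Db|exact: cb|exact: dE].
Qed.

(** A change of parameter adds to the acceleration a multiple of the tangent. *)
Lemma unparametrised_covacc (J : set R) (gamma : R -> 'rV[R]_n) t :
  unparametrised_geodesic g D J gamma -> J t ->
  exists mu : R, covacc g gamma t = mu *: 'D_1 gamma t.
Proof.
move=> [[oJ _] [J' [c [tau [[oJ' _] /geodesicP geo stau tauJ tg]]]]] Jt.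
have Jtau r : J r -> J' (tau r) by move=> Jr; rewrite -tauJ; exists r.
have dtau r : J r -> is_derive r 1 tau ('D_1 tau r).
  by move=> Jr; apply: derivableP; have := stau 0%N r Jr.
have dtau2 : is_derive t 1 ('D_1 tau) ('D_1 ('D_1 tau) t).
  by apply: derivableP; have := stau 1%N t Jt; rewrite derive1n1 derive1_fun.
have chain (b : R -> 'rV[R]_n) r : J r -> derivable b (tau r) 1 ->
    is_derive r 1 (fun x => b (tau x)) ('D_1 tau r *: 'D_1 b (tau r)).
  move=> Jr /derivableP /is_derive_rVP db; apply/is_derive_rVP => i.
  rewrite mxE mulrC; exact: is_derive1_comp (db i) (dtau r Jr).
have Eg r : J r -> gamma r = c (tau r) by move=> /tg[].
have D1 r : J r -> 'D_1 gamma r = 'D_1 tau r *: 'D_1 c (tau r).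
  move=> Jr; rewrite (derive_congr_open oJ Jr Eg).
  have [_ dc _ _ _] := geo _ (Jtau r Jr).
  by have [_ ->] := chain c r Jr dc.
have [_ _ dc2 _ cov0] := geo _ (Jtau t Jt).
have D2 : 'D_1 ('D_1 gamma) t = 'D_1 ('D_1 tau) t *: 'D_1 c (tau t) +
    ('D_1 tau t) ^+ 2 *: 'D_1 ('D_1 c) (tau t).
  rewrite (derive_congr_open oJ Jt D1).
  suff [_ ->] : is_derive t 1 (fun r => 'D_1 tau r *: 'D_1 c (tau r))
     ('D_1 ('D_1 tau) t *: 'D_1 c (tau t) + ('D_1 tau t) ^+ 2 *: 'D_1 ('D_1 c) (tau t)) by [].
  apply/is_derive_rVP => i; under eq_fun do rewrite mxE.
  have /is_derive_rVP/(_ i) dci := chain _ t Jt dc2.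
  have := is_deriveM dtau2 dci; congr is_derive; rewrite !mxE /GRing.scale /=; ring.
have tau1 : 'D_1 tau t != 0 by have [] := tg t Jt; rewrite derive1_fun.
exists ('D_1 ('D_1 tau) t / 'D_1 tau t).
rewrite /covacc D2 (D1 t Jt) (Eg t Jt) scalerA (divfK tau1).
have -> : geo_acc g (c (tau t)) ('D_1 tau t *: 'D_1 c (tau t)) =
    'D_1 tau t ^+ 2 *: geo_acc g (c (tau t)) ('D_1 c (tau t)).
  apply/rowP => i; rewrite !mxE mulr_sumr; apply: eq_bigr => j _.
  rewrite mulr_sumr; apply: eq_bigr => k _; rewrite !mxE; ring.
by rewrite -addrA -scalerDr -/(covacc g c (tau t)) cov0 scaler0 addr0.
Qed.

(** The geodesic spray, a field on the tangent bundle whose integral curves project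
    to geodesics. *)
Definition geo_spray (q : 'rV[R]_(n + n)) : 'rV[R]_(n + n) :=
  row_mx (rsubmx q) (- geo_acc g (lsubmx q) (rsubmx q)).

(** An integral curve of the spray; the open set [W] excludes zero velocities, so
    that the projected curve is regular. *)
Lemma geodesic_exists (p X : 'rV[R]_n) : D p -> X != 0 ->
  exists2 b : R, 0 < b & exists c : R -> 'rV[R]_n,
    [/\ geodesic g D [set t | `|t| < b] c, c 0 = p & 'D_1 c 0 = X].
Proof.
move=> Dp X0.
pose W : set 'rV[R]_(n + n) := [set q | D (lsubmx q)] `&` [set q | rsubmx q != 0].
have oT : open [set q : 'rV[R]_(n + n) | D (lsubmx q)] by exact: open_lsubmx.
have oW : open W.
  apply: openI => //.
  have cn : continuous (fun q : 'rV[R]_(n + n) => `|rsubmx q|).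
    apply: contraction_continuous => x y.
    exact: le_trans (ler_dist_dist _ _) (rsubmx_contract x y).
  rewrite (_ : [set q | _] = (fun q : 'rV[R]_(n + n) => `|rsubmx q|) @^-1` [set x | x != 0]).
    by move/continuousP : cn; apply; exact: open_neq.
  by apply/seteqP; split=> q /=; rewrite normr_eq0.
have CS j : Ck W 1 (fun q => geo_spray q 0 j).
  apply: (@Ck_sub _ _ [set q | D (lsubmx q)]) => [q []//|].
  case: (split_ordP j) => i ->.
    apply: (Ck_congr oT _ (Ck_coord 1%N (rshift n i) oT)) => q _.
    by rewrite row_mxEl mxE.
  have C : Ck [set q : 'rV[R]_(n + n) | D (lsubmx q)] 1
      (fun q => - \sum_j \sum_k Γ g (lsubmx q) i j k *
         q 0 (rshift n j) * q 0 (rshift n k)).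
    apply: CkN => //; apply: Ck_sum => // a; apply: Ck_sum => // b.
    apply: CkM => //; last exact: Ck_coord.
    apply: CkM => //; last exact: Ck_coord.
    exact: (@Ck_lsubmx R n n D 1 (fun p => Γ g p i a b)
      (smooth_christoffel i a b oD mg 1%N)).
  apply: (Ck_congr oT _ C) => q _; rewrite row_mxEr !mxE; congr (- _).
  by apply: eq_bigr => a _; apply: eq_bigr => b _; rewrite !mxE.
have W0 : W (row_mx p X) by split; rewrite /= ?row_mxKl ?row_mxKr.
have [rho [b [rho0 b0 sol]]] := ode_local oW CS W0.
have [|y y0 dy] := sol (row_mx p X); first by rewrite subrr normr0.
exists b => //; exists (fun t => lsubmx (y t)).
have {}dy (t : R) : `|t| < b -> [/\ D (lsubmx (y t)), rsubmx (y t) != 0,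
    is_derive t 1 (fun t => lsubmx (y t)) (rsubmx (y t)) &
    is_derive t 1 (fun t => rsubmx (y t)) (- geo_acc g (lsubmx (y t)) (rsubmx (y t)))].
  move=> tb; have [[Dy y1] dyt] := dy t (ltW tb); split; [exact: Dy|exact: y1| |].
    by have := is_derive_row_mxl dyt; rewrite row_mxKl.
  by have := is_derive_row_mxr dyt; rewrite row_mxKr.
have oJ : open [set t : R | `|t| < b] by exact: open_norm_lt.
have D1 (t : R) : `|t| < b -> 'D_1 (fun t => lsubmx (y t)) t = rsubmx (y t).
  by move=> /dy[_ _ [_ ->]].
split; last 2 first.
- by rewrite y0 row_mxKl.
- by rewrite D1 ?normr0// y0 row_mxKr.
apply/geodesicP => t tb; have [Dy y1 d1 d2] := dy t tb.
have ns : \forall r \near t, `|r| < b by apply: open_nbhs_nbhs.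
have E : \forall r \near t, rsubmx (y r) = 'D_1 (fun t => lsubmx (y t)) r.
  by apply: filterS ns => r /D1 ->.
have d3 := near_eq_is_derive E d2.
split; [exact: Dy|by have [] := d1|by have [] := d3|by rewrite D1|].
by rewrite /covacc D1//; have [_ ->] := d3; rewrite addNr.
Qed.

End Projective.

Section ProjectiveNecessary.
Variables (R : realType) (n : nat) (D : set 'rV[R]_n) (g : 'rV[R]_n -> 'M[R]_n).
Hypotheses (oD : open D) (mg : is_metric D g).
Variable v : 'rV[R]_n -> 'rV[R]_n.
Hypothesis sv : vector_field D v.

Lemma derive1n_id (k : nat) : derive1n k.+1 (id : R -> R) = fun=> (k == 0)%:R.
Proof.
elim: k => [|k IH]; first by rewrite derive1n1; apply/funext => t; rewrite derive1_id.
by rewrite derive1nS IH; apply/funext => t; rewrite derive1_cst.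
Qed.

(** A geodesic through [p] with tangent [X] is transported by the flow.  At [t = 0]
    its acceleration [E s] and its tangent [T s] stay parallel, that is
    [E_i T_m - E_m T_i = 0] for all small [s]; as [E] vanishes at [s = 0], the
    derivative of this relation there is [L_i X_m - L_m X_i = 0]. *)
Lemma projective_lie_conn p X i m : projective_field D g v -> D p ->
  lie_conn g v p X 0 i * X 0 m = lie_conn g v p X 0 m * X 0 i.
Proof.
move=> proj Dp; have [->|X0] := eqVneq X 0; first by rewrite !mxE !mulr0.
have [rho [a [rho0 a0 sol]]] := ode_local oD (fun j => sv j 1%N) Dp.
pose V := ball p rho `&` D.
have oV : open V by apply: openI => //; exact: ball_open.
have Vp : V p by split=> //; exact: ballxx.
have yP q : exists y : R -> 'rV[R]_n, V q -> y 0 = q /\ forall s : R, `|s| <= a ->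
    D (y s) /\ is_derive s 1 y (v (y s)).
  have [Vq|] := pselect (V q); last by exists (fun=> 0).
  have [|y y0 dy] := sol q; last by exists y.
  by case: Vq; rewrite -ball_normE /= distrC.
have [Y YP] := choice yP.
pose phi s q := Y q s.
have flow : local_flow D v V a phi.
  split=> // [q []//|q Vq]; have [y0 dy] := YP q Vq; split=> // s sa.
  by have [] := dy s (ltW sa).
have mgV : is_metric V g.
  have [sg tg ug] := mg; have VD : V `<=` D by move=> q [].
  split=> [i' j' r|q /VD|q /VD]; [exact: Ck_sub VD (sg i' j' r)|exact: tg|exact: ug].
have [b b0 [c [geo c0 c1]]] := geodesic_exists oV mgV Vp X0.
pose J := [set t : R | `|t| < b].
have J0 : J 0 by rewrite /J /= normr0.
have oJ : open J by exact: open_norm_lt.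
have oiJ : open_interval J.
  split=> // x y; rewrite /J /= !ltr_norml => /andP[x1 x2] /andP[y1 y2] z /andP[xz zy].
  by rewrite /= ltr_norml (lt_le_trans x1 xz) (le_lt_trans zy y2).
have ug : unparametrised_geodesic g V J c.
  split=> //; exists J, c, id; split=> //; last 2 first.
  - by rewrite image_id.
  - by move=> t _; rewrite derive1_id oner_neq0.
  case=> [|k] t _; first exact: derivable_id.
  by rewrite derive1n_id; exact: derivable_cst.
have geo' := (@geodesicP R n V g J c).1 geo.
pose F (r t : R) := phi r (c t).
have FP t : J t -> [/\ derivable c t 1, F 0 t = c t & forall s, `|s| < a ->
     D (F s t) /\ is_derive s 1 (F ^~ t) (v (F s t))].
  move=> /geo'[Vc dc _ _ _]; have [y0 dy] := YP _ Vc.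
  by split; [exact: dc|exact: y0|move=> s sa; exact: (dy s (ltW sa))].
have [Vc dc dc2 c1n cov0] := geo' 0 J0.
have var := variation oD mg sv a0 oJ J0 FP dc2.
have F0 t : J t -> F 0 t = c t by move=> /FP[].
pose E s := covacc g (F s) 0; pose T s := 'D_1 (F s) 0.
have na : `|0 : R| < a by rewrite normr0.
have [_ _ dT dE] := var 0 na.
have E0 : E 0 = 0 by rewrite /E (@covacc_congr R n g J (F 0) c 0 oJ J0 F0).
have T0 : T 0 = X by rewrite /T (derive_congr_open oJ J0 F0).
rewrite -/(E 0) E0 jac0 addr0 -/(T 0) T0 F0// c0 in dE.
rewrite -/(T 0) T0 F0// c0 in dT.
have par s : `|s| < a -> E s 0 i * T s 0 m - E s 0 m * T s 0 i = 0.
  move=> sa; have [mu muE] := unparametrised_covacc (proj V a phi flow s sa J c ug) J0.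
  by rewrite /E muE !mxE; ring.
have dP : is_derive (0 : R) 1 (fun s => E s 0 i * T s 0 m - E s 0 m * T s 0 i)
    (lie_conn g v p X 0 i * X 0 m - lie_conn g v p X 0 m * X 0 i).
  have /is_derive_rVP dEi := dE; have /is_derive_rVP dTi := dT.
  have := is_deriveB (is_deriveM (dEi i) (dTi m)) (is_deriveM (dEi m) (dTi i)).
  congr is_derive; rewrite -/(E 0) -/(T 0) E0 T0 !mxE /GRing.scale /=; ring.
have nz : \forall s \near (0 : R), 0 = E s 0 i * T s 0 m - E s 0 m * T s 0 i.
  have ns : \forall s \near (0 : R), `|s| < a.
    by apply: open_nbhs_nbhs; split=> //; exact: open_norm_lt.
  by apply: filterS ns => s /par ->.
have [_ d0] := near_eq_is_derive nz (is_derive_cst (0 : R) (0 : R) 1).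
by move: dP => [_]; rewrite d0 => /esym/eqP; rewrite subr_eq0 => /eqP.
Qed.

End ProjectiveNecessary.

(** * Unique continuation for linear first-order systems *)

Section UniqueContinuation.
Variables (R : realType) (n : nat) (U : set 'rV[R]_n).
Hypotheses (oU : open U) (cU : connected U).

Lemma term_le_sum (J : finType) (F : J -> R) (i : J) :
  (forall j, 0 <= F j) -> F i <= \sum_j F j.
Proof. by move=> F0; rewrite (bigD1 i)//= lerDl sumr_ge0. Qed.

(** The zero set of [w] in [U] is closed in [U] by continuity, and open because on
    a segment that starts at a zero the system becomes a linear differential
    equation, to which Gronwall's inequality applies. *)
Lemma unique_continuation (J : finType) (w : J -> 'rV[R]_n -> R)
    (M : 'I_n -> J -> J -> 'rV[R]_n -> R) (p0 : 'rV[R]_n) :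
  (forall b, Ck U 1 (w b)) -> (forall a b c, Ck U 0 (M a b c)) ->
  (forall p a b, U p -> pd a (w b) p = \sum_c M a b c p * w c p) ->
  U p0 -> (forall b, w b p0 = 0) -> forall p b, U p -> w b p = 0.
Proof.
move=> Cw CM wM Up0 w0.
pose y p : 'rV[R]_#|J| := \row_i w (enum_val i) p.
have yE p : y p = 0 <-> forall b, w b p = 0.
  split=> [/rowP y0 b|H]; first by have := y0 (enum_rank b); rewrite !mxE enum_rankK.
  by apply/rowP => i; rewrite !mxE.
have wy b p : `|w b p| <= `|y p|.
  by have := normr_coord (y p) (enum_rank b); rewrite mxE enum_rankK.
have Cy i : Ck U 1 (fun p => y p 0 i).
  by apply: (Ck_congr oU _ (Cw (enum_val i))) => p _; rewrite mxE.
pose B := [set p | U p /\ y p = 0].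
suff BU : B = U by move=> p b Up; move: Up; rewrite -BU => -[_ /yE].
apply: cU.
- by exists p0; split=> //; apply/yE.
- exists B; last by apply/seteqP; split=> p; [move=> [Up yp]|move=> [_ []]].
  rewrite openE => p [Up yp].
  have /nbhs_ballP [r1 /= r10 H1] : nbhs p U by exact: open_nbhs_nbhs.
  have : \forall q \near p, forall a b c, `|M a b c p - M a b c q| < 1.
    apply: (filter_forall (F := nbhs p)) => a; apply: (filter_forall (F := nbhs p)) => b.
    apply: (filter_forall (F := nbhs p)) => c.
    exact: (cvgrPdist_lt _ _).1 (Ck_continuous (CM a b c) Up) _ ltr01.
  move=> /nbhs_ballP [r2 /= r20 H2].
  pose L := \sum_a \sum_b \sum_c (`|M a b c p| + 1).
  have t0 a b c : 0 <= `|M a b c p| + 1 by rewrite addr_ge0.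
  have L0 : 0 <= L by do 3 (apply: sumr_ge0 => ? _).
  have ML q : `|q - p| < r2 -> forall a b, \sum_c `|M a b c q| <= L.
    move=> qr a b.
    have Hq := H2 q ltac:(by rewrite -ball_normE /= distrC).
    apply: (@le_trans _ _ (\sum_c (`|M a b c p| + 1))).
      apply: ler_sum => c _; rewrite -(subrK (M a b c p) (M a b c q)) addrC.
      apply: le_trans (ler_normD _ _) _; rewrite lerD2l distrC ltW//; exact: Hq.
    apply: le_trans (term_le_sum b (F := fun b => \sum_c (`|M a b c p| + 1)) _) _.
      by move=> ?; apply: sumr_ge0.
    apply: (term_le_sum a (F := fun a => \sum_b \sum_c (`|M a b c p| + 1))) => ?.
    by do 2 (apply: sumr_ge0 => ? _).
  pose r := Num.min r1 r2.
  have r0 : 0 < r by rewrite lt_min r10.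
  have [C C0 HC] := @gronwall R #|J| (L * (n%:R * r)) 1 ltac:(by rewrite !mulr_ge0// ltW) ler01.
  apply/nbhs_ballP; exists r => //= q; rewrite -ball_normE /= distrC => qr.
  have seg t : 0 <= t <= 1 -> `|t *: (q - p) + p - p| < r.
    move=> /andP[t1 t2]; rewrite addrK normrZ (ger0_norm t1).
    by apply: le_lt_trans qr; rewrite ler_piMl.
  have segU t : 0 <= t <= 1 -> U (t *: (q - p) + p).
    move=> /seg; rewrite lt_min => /andP[s1 _]; apply: H1.
    by rewrite -ball_normE /= distrC.
  split; first by have := segU 1; rewrite scale1r subrK; apply; rewrite ler01 lexx.
  have dy (t : R) : 0 <= t <= 1 -> is_derive t 1 (fun t => y (t *: (q - p) + p))
      (jac y (t *: (q - p) + p) (q - p)).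
    move=> t01.
    have dl : is_derive t 1 (fun t : R => t *: (q - p) + p) (q - p).
      apply/is_derive_rVP => i; under eq_fun do rewrite mxE mxE.
      by apply: is_derive_eq; rewrite scaler0 add0r addr0 [LHS]mulr1.
    exact: is_derive_chain_rV (segU t t01) dl.
  (* The system is linear on the whole segment, so the threshold of the inequality
     can be any positive number. *)
  have := HC (fun t => y (t *: (q - p) + p)) (fun t => jac y (t *: (q - p) + p) (q - p))
     0 1 0 1 (lexx _).
  rewrite scale0r add0r scale1r subrK yp normr0 addr0 mulr0 subr0 normr1 => H.
  apply/eqP; rewrite -normr_le0; apply: H; [exact: lexx| |exact: ltr01].
  move=> t t01; rewrite add0r mulr1 /=; split; first exact: dy.
  move=> _; rewrite addr0.
  have := seg t t01; rewrite lt_min => /andP[_ s2].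
  have Uq := segU t t01; set x := t *: (q - p) + p in s2 Uq *.
  apply: normr_rV_le => [|i]; first by rewrite !mulr_ge0// ltW.
  rewrite mxE; apply: le_trans (ler_norm_sum _ _ _) _.
  apply: (@le_trans _ _ (\sum_(a < n) (L * `|y x|) * r)).
    apply: ler_sum => a _; rewrite normrM ler_pM//; last first.
      by apply: le_trans (normr_coord _ _) _; exact: ltW (le_lt_trans _ qr).
    have -> : dmx a y 0 i x = \sum_c M a (enum_val i) c x * w c x.
      by rewrite -wM//; congr pd; apply/funext => z; rewrite mxE.
    apply: le_trans (ler_norm_sum _ _ _) _.
    apply: (@le_trans _ _ (\sum_c `|M a (enum_val i) c x| * `|y x|)).
      by apply: ler_sum => c _; rewrite normrM ler_wpM2l.
    by rewrite -mulr_suml ler_wpM2r// ML.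
  rewrite sumr_const card_ord -[leLHS]mulr_natl.
  by rewrite le_eqVlt; apply/orP; left; apply/eqP; ring.
- exists (closure B); first exact: closed_closure.
  apply/seteqP; split=> [p Bp|p [Up clB]].
    by split; [case: Bp|exact: subset_closure].
  split=> //; apply/eqP; rewrite -normr_le0; apply/ler_addgt0Pl => eps eps0.
  have /clB [q [[Uq yq] qe]] : \forall q \near p, forall i, `|y p 0 i - y q 0 i| < eps.
    apply: (filter_forall (F := nbhs p)) => i.
    exact: (cvgrPdist_lt _ _).1 (Ck_continuous (Cy i) Up) _ eps0.
  rewrite addr0; apply: normr_rV_le => [|i]; first exact: ltW.
  by have /ltW := qe i; rewrite yq [X in _ - X]mxE subr0.
Qed.

End UniqueContinuation.

(** * Curvature as an integrability condition *)

Section PdRules.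
Variables (R : realType) (n : nat) (U : set 'rV[R]_n).
Implicit Types (f g : 'rV[R]_n -> R).

Lemma pd_add f g p i : Ck U 1 f -> Ck U 1 g -> U p ->
  pd i (fun q => f q + g q) p = pd i f p + pd i g p.
Proof. by move=> Cf Cg Up; apply: deriveD; [exact: Ck_derivable Cf Up|exact: Ck_derivable Cg Up]. Qed.

Lemma pd_opp f p i : Ck U 1 f -> U p -> pd i (fun q => - f q) p = - pd i f p.
Proof. by move=> Cf Up; apply: deriveN; exact: Ck_derivable Cf Up. Qed.

Lemma pd_mul f g p i : Ck U 1 f -> Ck U 1 g -> U p ->
  pd i (fun q => f q * g q) p = pd i f p * g p + f p * pd i g p.
Proof.
move=> Cf Cg Up; rewrite /pd (deriveM (f := f) (g := g));
  [|exact: Ck_derivable Cf Up|exact: Ck_derivable Cg Up].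
by rewrite /GRing.scale /= addrC mulrC.
Qed.

Lemma pd_scale f p i (a : R) : Ck U 1 f -> U p ->
  pd i (fun q => a * f q) p = a * pd i f p.
Proof.
move=> Cf Up; rewrite (pd_mul i (Ck_cst U 1 a) Cf Up).
by rewrite /pd derive_cst mul0r add0r.
Qed.

End PdRules.

Lemma sum_I2 (V : nmodType) (F : 'I_2 -> V) : \sum_i F i = F 0 + F 1.
Proof.
rewrite !big_ord_recl big_ord0 addr0; congr (F _ + F _); exact: val_inj.
Qed.

Lemma I2_cases (i : 'I_2) : i = 0 \/ i = 1.
Proof. by case: i => -[|[|//]] lt2; [left|right]; exact: val_inj. Qed.

Section LeviCivita.
Variables (R : realType) (n : nat) (U : set 'rV[R]_n) (h : 'rV[R]_n -> 'M[R]_n).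
Hypotheses (oU : open U) (mh : is_metric U h).

Lemma metricC p i j : U p -> h p i j = h p j i.
Proof. by have [_ th _] := mh => /th {1}<-; rewrite mxE. Qed.

Lemma pd_metricC p a i j : U p -> dmx a h i j p = dmx a h j i p.
Proof.
move=> Up; apply: (@pd_congr R n U (fun q => h q i j) (fun q => h q j i) p a oU) => // q.
by rewrite inE; exact: metricC.
Qed.

(** The Christoffel symbols with the upper index lowered are the combination of
    derivatives in their definition: the inverse matrix cancels. *)
Lemma christoffel_lowered p d j k : U p ->
  \sum_e h p d e * Γ h p e j k =
  2^-1 * (dmx j h d k p + dmx k h d j p
          - dmx d h j k p).
Proof.
move=> Up; have [_ _ uh] := mh.
pose A l := dmx j h l k p + dmx k h l j p - dmx l h j k p.
rewrite /christoffel -/(A d).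
have -> : \sum_e h p d e * (2^-1 * \sum_l invmx (h p) e l * A l) =
    2^-1 * \sum_l (h p *m invmx (h p)) d l * A l.
  rewrite mulr_sumr; under eq_bigr do rewrite mulrCA mulr_sumr mulr_sumr.
  rewrite exchange_big /=; apply: eq_bigr => l _.
  rewrite mxE mulr_suml mulr_sumr; apply: eq_bigr => e _; ring.
rewrite mulmxV ?uh// (bigD1 d)//= mxE eqxx mul1r big1 ?addr0// => l ld.
by rewrite mxE eq_sym (negPf ld) mul0r.
Qed.

(** The covariant derivative of the metric vanishes: of the lowered Christoffel
    symbols of the two terms only the derivative of [h] is left. *)
Lemma metric_compat p a b c : U p ->
  dmx a h b c p =
  \sum_e (Γ h p e a b * h p e c + Γ h p e a c * h p e b).
Proof.
move=> Up; rewrite big_split /=.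
have E x y z : \sum_e Γ h p e x y * h p e z = \sum_e h p z e * Γ h p e x y.
  by apply: eq_bigr => e _; rewrite mulrC (metricC _ _ Up).
rewrite !E !christoffel_lowered// (pd_metricC a c b Up) (pd_metricC b c a Up) (pd_metricC c b a Up).
by field.
Qed.

Lemma riemannC p i j k l : riemann h p i j l k = - riemann h p i j k l.
Proof.
rewrite /riemann opprD opprB; congr (_ + _); rewrite -sumrN.
by apply: eq_bigr => m _; rewrite opprB.
Qed.

End LeviCivita.

Section CurvatureAlgebra.
Variables (R : comNzRingType) (I : eqType) (e0 e1 : I).
Variables (G : I -> I -> I -> R) (dG : I -> I -> I -> I -> R).

(** The components of the curvature tensor at one point as polynomials in the
    Christoffel symbols [G] and their derivatives [dG], so that the integrability
    conditions below become polynomial identities. *)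
Definition curv (i j k l : I) : R :=
  dG k i l j - dG l i k j
  + (G i k e0 * G e0 l j - G i l e0 * G e0 k j
    + (G i k e1 * G e1 l j - G i l e1 * G e1 k j)).

(** Ricci identity for a parallel 1-form [w]: [S x y] stands for the second
    derivative of [w_b] in the directions [x] and [y], obtained by differentiating the
    equation for [w], and its symmetry says that the curvature annihilates [w]. *)
Lemma curv_form (w : I -> R) (dw : I -> I -> R) (S : I -> I -> R) a b d :
  (forall x z, dw x z = G e0 x z * w e0 + G e1 x z * w e1) ->
  (forall x y, S x y = dG x e0 y b * w e0 + G e0 y b * dw x e0
    + (dG x e1 y b * w e1 + G e1 y b * dw x e1)) ->
  S d a = S a d -> curv e0 b d a * w e0 + curv e1 b d a * w e1 = 0.
Proof.
move=> dwE SE; rewrite !SE !dwE => /eqP; rewrite -subr_eq0 => /eqP H.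
by rewrite -[RHS]H /curv; ring.
Qed.

(** The same for a vector field whose covariant derivative is [phi] times the
    identity, with [phi] constant. *)
Lemma curv_vector (y : I -> R) (dy : I -> I -> R) (S : I -> I -> R) (phi : R) a b d :
  (forall i, i = e0 \/ i = e1) -> e0 != e1 ->
  (forall i j k, G i j k = G i k j) ->
  (forall x z, dy x z = (z == x)%:R * phi - (G z x e0 * y e0 + G z x e1 * y e1)) ->
  (forall x z, S x z = - (dG x a z e0 * y e0 + G a z e0 * dy x e0
    + (dG x a z e1 * y e1 + G a z e1 * dy x e1))) ->
  S d b = S b d -> curv a e0 d b * y e0 + curv a e1 d b * y e1 = 0.
Proof.
move=> cover e01 GC dyE SE; rewrite !SE !dyE => /eqP; rewrite -subr_eq0 => /eqP H.
rewrite -[RHS]oppr0 -H /curv.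
have e10 : (e1 == e0) = false by rewrite eq_sym (negPf e01).
by case: (cover b) (cover d) => -> [] ->; rewrite ?eqxx ?(negPf e01) ?e10 ?(GC a e1 e0) /=; ring.
Qed.

(** The same for a parallel symmetric tensor of degree two. *)
Lemma curv_tensor (s : I -> I -> R) (ds : I -> I -> I -> R) (S : I -> I -> R) a b c d :
  (forall x z t, ds x z t = G e0 x z * s e0 t + G e0 x t * s e0 z
     + (G e1 x z * s e1 t + G e1 x t * s e1 z)) ->
  (forall x y, S x y = dG x e0 y b * s e0 c + G e0 y b * ds x e0 c
    + (dG x e0 y c * s e0 b + G e0 y c * ds x e0 b)
    + (dG x e1 y b * s e1 c + G e1 y b * ds x e1 c
    + (dG x e1 y c * s e1 b + G e1 y c * ds x e1 b))) ->
  s e1 e0 = s e0 e1 ->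
  S d a = S a d ->
  curv e0 b d a * s e0 c + curv e0 c d a * s e0 b
  + (curv e1 b d a * s e1 c + curv e1 c d a * s e1 b) = 0.
Proof.
move=> dsE SE sC; rewrite !SE !dsE => /eqP; rewrite -subr_eq0 => /eqP H.
by rewrite -[RHS]H /curv sC; ring.
Qed.

End CurvatureAlgebra.

Section Surface.
Variables (R : realType) (U : set 'rV[R]_2) (h : 'rV[R]_2 -> 'M[R]_2).
Hypotheses (oU : open U) (mh : is_metric U h).
Let Gam (i j k : 'I_2) (p : 'rV[R]_2) : R := Γ h p i j k.

Let CG i j k : Ck U 1 (Gam i j k).
Proof. exact: smooth_christoffel. Qed.

Lemma riemann_curv p i j k l : riemann h p i j k l =
  curv 0 1 (Γ h p)
    (fun x i j k => dΓ x h i j k p) i j k l.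
Proof. by rewrite /riemann sum_I2. Qed.

Lemma parallel_form_curvature (w : 'I_2 -> 'rV[R]_2 -> R) p a b d :
  (forall b, Ck U 2 (w b)) ->
  (forall p a b, U p -> pd a (w b) p = \sum_c Γ h p c a b * w c p) ->
  U p -> \sum_c riemann h p c b d a * w c p = 0.
Proof.
move=> Cw wP Up; have Cw1 c : Ck U 1 (w c) := CkW (Cw c).
have second x y : pd x (pd y (w b)) p =
    pd x (Gam 0 y b) p * w 0 p + Gam 0 y b p * pd x (w 0) p
    + (pd x (Gam 1 y b) p * w 1 p + Gam 1 y b p * pd x (w 1) p).
  have E : {in U, pd y (w b) =1 fun q => Gam 0 y b q * w 0 q + Gam 1 y b q * w 1 q}.
    by move=> q; rewrite inE => Uq; rewrite (wP _ _ _ Uq) sum_I2.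
  have C z t u : Ck U 1 (fun q => Gam z t u q * w z q) by exact: CkM.
  rewrite (pd_congr x oU E Up) (pd_add x (C 0 y b) (C 1 y b) Up).
  by rewrite !(pd_mul x (CG _ _ _) (Cw1 _) Up).
rewrite sum_I2 !riemann_curv.
have dw x z : pd x (w z) p = Γ h p 0 x z * w 0 p + Γ h p 1 x z * w 1 p.
  by rewrite (wP _ _ _ Up) sum_I2.
exact: (curv_form (w := fun z => w z p) dw second (pdC d a oU (Cw b) Up)).
Qed.

Lemma conformal_gradient_curvature (y : 'I_2 -> 'rV[R]_2 -> R) (phi : R) p a b d :
  (forall a, Ck U 2 (y a)) ->
  (forall p a b, U p ->
     pd b (y a) p + \sum_c Γ h p a b c * y c p = (a == b)%:R * phi) ->
  U p -> \sum_c riemann h p a c d b * y c p = 0.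
Proof.
move=> Cy yP Up; have Cy1 c : Ck U 1 (y c) := CkW (Cy c).
have first q x z : U q -> pd x (y z) q = (z == x)%:R * phi - (Gam z x 0 q * y 0 q + Gam z x 1 q * y 1 q).
  by move=> Uq; rewrite -(yP q z x Uq) sum_I2 addrK.
have second x z : pd x (pd z (y a)) p =
    - (pd x (Gam a z 0) p * y 0 p + Gam a z 0 p * pd x (y 0) p
    + (pd x (Gam a z 1) p * y 1 p + Gam a z 1 p * pd x (y 1) p)).
  have E : {in U, pd z (y a) =1 fun q => (a == z)%:R * phi + - (Gam a z 0 q * y 0 q + Gam a z 1 q * y 1 q)}.
    by move=> q; rewrite inE => Uq; exact: first.
  have C1 t : Ck U 1 (fun q => Gam a z t q * y t q) by exact: CkM.
  have C : Ck U 1 (fun q => Gam a z 0 q * y 0 q + Gam a z 1 q * y 1 q) by exact: CkD.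
  rewrite (pd_congr x oU E Up) (pd_add x (Ck_cst U 1 _) (CkN oU C) Up).
  rewrite (pd_opp x C Up) {1}/pd derive_cst add0r (pd_add x (C1 0) (C1 1) Up).
  by rewrite !(pd_mul x (CG _ _ _) (Cy1 _) Up).
have GC i j k : Γ h p i j k = Γ h p i k j by exact: christoffelC Up.
rewrite sum_I2 !riemann_curv.
exact: (curv_vector (y := fun z => y z p) I2_cases isT GC (fun x z => first p x z Up)
  second (pdC d b oU (Cy a) Up)).
Qed.

Lemma parallel_tensor_curvature (s : 'I_2 -> 'I_2 -> 'rV[R]_2 -> R) p a b c d :
  (forall b c, Ck U 2 (s b c)) ->
  (forall p a b c, U p -> pd a (s b c) p =
     \sum_e (Γ h p e a b * s e c p + Γ h p e a c * s e b p)) ->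
  (forall p b c, U p -> s b c p = s c b p) ->
  U p -> \sum_e (riemann h p e b d a * s e c p + riemann h p e c d a * s e b p) = 0.
Proof.
move=> Cs sP sC Up; have Cs1 b' c' : Ck U 1 (s b' c') := CkW (Cs b' c').
have second x y : pd x (pd y (s b c)) p =
    pd x (Gam 0 y b) p * s 0 c p + Gam 0 y b p * pd x (s 0 c) p
    + (pd x (Gam 0 y c) p * s 0 b p + Gam 0 y c p * pd x (s 0 b) p)
    + (pd x (Gam 1 y b) p * s 1 c p + Gam 1 y b p * pd x (s 1 c) p
    + (pd x (Gam 1 y c) p * s 1 b p + Gam 1 y c p * pd x (s 1 b) p)).
  have E : {in U, pd y (s b c) =1 fun q =>
      (Gam 0 y b q * s 0 c q + Gam 0 y c q * s 0 b q)
      + (Gam 1 y b q * s 1 c q + Gam 1 y c q * s 1 b q)}.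
    by move=> q; rewrite inE => Uq; rewrite (sP _ _ _ _ Uq) sum_I2.
  have C z t u v : Ck U 1 (fun q => Gam z t u q * s z v q) by exact: CkM.
  have C2 z : Ck U 1 (fun q => Gam z y b q * s z c q + Gam z y c q * s z b q) by exact: CkD.
  rewrite (pd_congr x oU E Up) (pd_add x (C2 0) (C2 1) Up).
  rewrite !(pd_add x (C _ _ _ _) (C _ _ _ _) Up).
  by rewrite !(pd_mul x (CG _ _ _) (Cs1 _ _) Up).
rewrite sum_I2 !riemann_curv.
have ds x z t : pd x (s z t) p = Γ h p 0 x z * s 0 t p + Γ h p 0 x t * s 0 z p
    + (Γ h p 1 x z * s 1 t p + Γ h p 1 x t * s 1 z p).
  by rewrite (sP _ _ _ _ Up) sum_I2.
exact: (curv_tensor (s := fun z t => s z t p) ds second (sC p 1 0 Up)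
  (pdC d a oU (Cs b c) Up)).
Qed.

End Surface.

Section SurfaceAlgebra.
Variable R : realFieldType.

(** The three equations say that the endomorphism [K] is skew for the symmetric form
    with entries [a], [b], [c]; in dimension two such endomorphisms form a line. *)
Lemma nonflat_alg (a b c K00 K01 K10 K11 : R) : a * c - b ^+ 2 != 0 ->
  K00 * a + K10 * b = 0 -> K01 * b + K11 * c = 0 ->
  K00 * b + K01 * a + K10 * c + K11 * b = 0 ->
  exists mu, [/\ K00 = mu * b, K01 = mu * c, K10 = - (mu * a) & K11 = - (mu * b)].
Proof.
move=> d0 E1 E2 E3; exists ((a * K01 + b * K11) / (a * c - b ^+ 2)).
split; apply: (mulIf d0); rewrite ?mulNr mulrAC divfK//; apply/eqP; rewrite -subr_eq0; apply/eqP.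
- transitivity (c * (K00 * a + K10 * b) - b * (K00 * b + K01 * a + K10 * c + K11 * b)).
    by ring.
  by rewrite E1 E3 !mulr0 subrr.
- transitivity (- b * (K01 * b + K11 * c)); first by ring.
  by rewrite E2 mulr0.
- transitivity (a * (K00 * b + K01 * a + K10 * c + K11 * b) - b * (K00 * a + K10 * b)).
    by ring.
  by rewrite E1 E3 !mulr0 subrr.
- transitivity (a * (K01 * b + K11 * c)); first by ring.
  by rewrite E2 mulr0.
Qed.

Lemma cramer2 (a b c x y : R) : a * c - b ^+ 2 != 0 ->
  a * x + b * y = 0 -> b * x + c * y = 0 -> x = 0 /\ y = 0.
Proof.
move=> d0 E1 E2; split; apply: (mulIf d0); rewrite mul0r.
  transitivity (c * (a * x + b * y) - b * (b * x + c * y)); first by ring.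
  by rewrite E1 E2 !mulr0 subrr.
transitivity (a * (b * x + c * y) - b * (a * x + b * y)); first by ring.
by rewrite E1 E2 !mulr0 subrr.
Qed.

(** The hypotheses are the vanishing of the [2 x 2] minors. *)
Lemma proportional2 (a b c s00 s01 s11 : R) : a * c - b ^+ 2 != 0 ->
  b * s00 = a * s01 -> c * s01 = b * s11 -> a * s11 = c * s00 ->
  exists l, [/\ s00 = l * a, s01 = l * b & s11 = l * c].
Proof.
move=> d0 E1 E2 E3.
have [a0|a0] := eqVneq a 0; last first.
  exists (s00 / a); split; first by rewrite divfK.
    by apply: (mulfI a0); rewrite -E1; field.
  by apply: (mulfI a0); rewrite E3; field.
have b0 : b != 0 by apply: contraNneq d0 => ->; rewrite a0 mul0r expr0n subrr.
exists (s01 / b); split; last by apply: (mulfI b0); rewrite -E2; field.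
  by apply: (mulfI b0); rewrite E1 a0; field.
by rewrite divfK.
Qed.

End SurfaceAlgebra.

Section LieAlgebra.
Variables (R : comNzRingType) (I : eqType) (e0 e1 : I).
Variables (G : I -> I -> I -> R) (dG : I -> I -> I -> I -> R).
Variables (u : I -> R) (du : I -> I -> R) (ddu : I -> I -> I -> R).

(** The component [i; a, c] of the Lie derivative of the connection along [u], with
    [du a i] and [ddu a c i] the derivatives of the component [i] of [u]. *)
Definition lieT (i a c : I) : R :=
  ddu a c i
  + (dG e0 i a c * u e0 - G e0 a c * du e0 i + G i e0 c * du a e0 + G i a e0 * du c e0)
  + (dG e1 i a c * u e1 - G e1 a c * du e1 i + G i e1 c * du a e1 + G i a e1 * du c e1).

Lemma lieT_sym i a c : (forall i j k, G i j k = G i k j) ->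
  (forall x i j k, dG x i j k = dG x i k j) -> ddu a c i = ddu c a i ->
  lieT i a c = lieT i c a.
Proof.
move=> GC dGC dduC; rewrite /lieT dduC !(dGC _ i c a) !(GC _ c a).
by rewrite (GC i e0 c) (GC i e1 c) (GC i e0 a) (GC i e1 a); ring.
Qed.

Lemma lieT_quadratic (X : I -> R) i :
  let jX j := du e0 j * X e0 + du e1 j * X e1 in
  (ddu e0 e0 i + (dG e0 i e0 e0 * u e0 + dG e1 i e0 e0 * u e1)) * X e0 * X e0
  + (ddu e0 e1 i + (dG e0 i e0 e1 * u e0 + dG e1 i e0 e1 * u e1)) * X e0 * X e1
  + ((ddu e1 e0 i + (dG e0 i e1 e0 * u e0 + dG e1 i e1 e0 * u e1)) * X e1 * X e0
  + (ddu e1 e1 i + (dG e0 i e1 e1 * u e0 + dG e1 i e1 e1 * u e1)) * X e1 * X e1)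
  + (G i e0 e0 * (jX e0 * X e0 + X e0 * jX e0) + G i e0 e1 * (jX e0 * X e1 + X e0 * jX e1)
  + (G i e1 e0 * (jX e1 * X e0 + X e1 * jX e0) + G i e1 e1 * (jX e1 * X e1 + X e1 * jX e1)))
  - (du e0 i * (G e0 e0 e0 * X e0 * X e0 + G e0 e0 e1 * X e0 * X e1
       + (G e0 e1 e0 * X e1 * X e0 + G e0 e1 e1 * X e1 * X e1))
   + du e1 i * (G e1 e0 e0 * X e0 * X e0 + G e1 e0 e1 * X e0 * X e1
       + (G e1 e1 e0 * X e1 * X e0 + G e1 e1 e1 * X e1 * X e1)))
  = lieT i e0 e0 * (X e0 * X e0) + lieT i e0 e1 * (X e0 * X e1)
    + lieT i e1 e0 * (X e1 * X e0) + lieT i e1 e1 * (X e1 * X e1).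
Proof. by rewrite /= /lieT; ring. Qed.

(** This is the identity
    [nabla_a (L_u h)_bc = h_eb T^e_ac + h_ec T^e_ab], where [T] is the Lie derivative
    of the connection: [sigma] is [L_u h], and the left side is its derivative [d_a],
    computed by the product rule.  It comes from applying the Lie derivative to
    [nabla h = 0]. *)
Lemma lie_derivative_covariant (h : I -> I -> R) (dh : I -> I -> I -> R)
    (ddh : I -> I -> I -> I -> R) a b c :
  (forall i j, h i j = h j i) ->
  (forall k b c, dh k b c = G e0 k b * h e0 c + G e0 k c * h e0 b
     + (G e1 k b * h e1 c + G e1 k c * h e1 b)) ->
  (forall k, ddh a k b c =
     dG k e0 a b * h e0 c + G e0 a b * dh k e0 c
     + (dG k e0 a c * h e0 b + G e0 a c * dh k e0 b)
     + (dG k e1 a b * h e1 c + G e1 a b * dh k e1 c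
     + (dG k e1 a c * h e1 b + G e1 a c * dh k e1 b))) ->
  let sigma i j := u e0 * dh e0 i j + h e0 j * du i e0 + h i e0 * du j e0
    + (u e1 * dh e1 i j + h e1 j * du i e1 + h i e1 * du j e1) in
  let D k := du a k * dh k b c + u k * ddh a k b c + (dh a k c * du b k + h k c * ddu a b k)
    + (dh a b k * du c k + h b k * ddu a c k) in
  D e0 + D e1 =
  (G e0 a b * sigma e0 c + G e0 a c * sigma e0 b
   + (G e1 a b * sigma e1 c + G e1 a c * sigma e1 b))
  + (h e0 b * lieT e0 a c + h e0 c * lieT e0 a b
   + (h e1 b * lieT e1 a c + h e1 c * lieT e1 a b)).
Proof.
move=> hC dhE ddhE /=; rewrite !ddhE !dhE /lieT.
rewrite (hC b e0) (hC b e1) (hC e1 e0); ring.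
Qed.

End LieAlgebra.

Section SurfaceGeometry.
Variables (R : realType) (U : set 'rV[R]_2) (h : 'rV[R]_2 -> 'M[R]_2).
Hypotheses (oU : open U) (mh : is_metric U h).

Lemma metric_det p : U p -> h p 0 0 * h p 1 1 - h p 0 1 ^+ 2 != 0.
Proof.
move=> Up; have [_ _ /(_ p Up) uh] := mh.
have /matrixP E := mulmxV uh; have h10 : h p 1 0 = h p 0 1 by exact: metricC Up.
have := E 0 0; have := E 0 1; have := E 1 0; have := E 1 1.
rewrite !mxE !sum_I2 h10 /= => E11 E10 E01 E00.
apply/eqP => d0; have : (1 : R) = 0; last by apply/eqP; exact: oner_neq0.
set x := invmx (h p) in E11 E10 E01 E00.
transitivity ((h p 0 0 * x 0 0 + h p 0 1 * x 1 0) * (h p 0 1 * x 0 1 + h p 1 1 * x 1 1)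
  - (h p 0 0 * x 0 1 + h p 0 1 * x 1 1) * (h p 0 1 * x 0 0 + h p 1 1 * x 1 0)).
  by rewrite E11 E10 E01 E00 !mulr1n !mulr0n mul0r subr0 mulr1.
transitivity ((h p 0 0 * h p 1 1 - h p 0 1 ^+ 2) * (x 0 0 * x 1 1 - x 0 1 * x 1 0)).
  by clear; move: (x 0 0) (x 0 1) (x 1 0) (x 1 1) (h p 0 0) (h p 0 1) (h p 1 1) => *; ring.
by rewrite d0 mul0r.
Qed.

Definition nonflat_at (p : 'rV[R]_2) : Prop := exists a b c d, riemann h p a b c d != 0.

(** The metric itself is a parallel tensor, so its integrability condition says that
    the curvature endomorphism is skew.  It is not the zero
    endomorphism, because by skew symmetry in the last two indices the components
    with last indices [0] and [1] determine all others. *)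
Lemma nonflat_shape p : U p -> nonflat_at p ->
  exists2 mu, mu != 0 &
  [/\ riemann h p 0 0 0 1 = mu * h p 0 1, riemann h p 0 1 0 1 = mu * h p 1 1,
      riemann h p 1 0 0 1 = - (mu * h p 0 0) & riemann h p 1 1 0 1 = - (mu * h p 0 1)].
Proof.
move=> Up nf; have [sh _ _] := mh.
have P (b c : 'I_2) := @parallel_tensor_curvature R U h oU mh (fun i j q => h q i j) p 1 b c 0
  (fun i j => sh i j 2%N) (fun q a i j => @metric_compat R 2 U h oU mh q a i j)
  (fun q i j => @metricC R 2 U h mh q i j) Up.
have h10 : h p 1 0 = h p 0 1 by exact: metricC Up.
have := P 0 0; have := P 1 1; have := P 0 1; rewrite !sum_I2 h10.
move: (metric_det Up) nf.
rewrite /nonflat_at.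
have RC := riemannC h p.
move: (riemann h p) RC => K RC d0 nf E01 E11 E00.
have [||||mu [K1 K2 K3 K4]] := @nonflat_alg R (h p 0 0) (h p 0 1) (h p 1 1) (K 0 0 0 1) (K 0 1 0 1) (K 1 0 0 1) (K 1 1 0 1).
- exact: d0.
- by move: E00; clear; move: (K 0 0 0 1) (K 1 0 0 1) => x y ?; lra.
- by move: E11; clear; move: (K 0 1 0 1) (K 1 1 0 1) => x y ?; lra.
- by rewrite -[RHS]E01; ring.
exists mu => //; apply/eqP => mu0; case: nf => [a [b [c [d]]]] /negP; apply.
have K0 i j : K i j 0 1 = 0.
  by case: (I2_cases i) (I2_cases j) => -> [] ->; rewrite ?K1 ?K2 ?K3 ?K4 mu0 !mul0r ?oppr0.
have Kd i j k : K i j k k = 0.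
  by have /eqP := RC i j k k; rewrite -subr_eq0 opprK -mulr2n mulrn_eq0 => /eqP.
by case: (I2_cases c) (I2_cases d) => -> [] ->; rewrite ?Kd ?(RC a b 0 1) ?K0 ?oppr0.
Qed.

Lemma nonflat_form p (w : 'I_2 -> R) : U p -> nonflat_at p ->
  (forall b, \sum_c riemann h p c b 0 1 * w c = 0) -> forall c, w c = 0.
Proof.
move=> Up /(nonflat_shape Up)[mu mu0 [K1 K2 K3 K4]] H.
have := H 0; have := H 1; rewrite !sum_I2 K1 K2 K3 K4 => H1 H0.
have [||x0 y0] := @cramer2 R _ _ _ (w 1) (- w 0) (metric_det Up).
- by apply: (mulfI mu0); rewrite mulr0 -[RHS]oppr0 -H0; ring.
- by apply: (mulfI mu0); rewrite mulr0 -[RHS]oppr0 -H1; ring.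
by move=> c; case: (I2_cases c) => ->; [apply/eqP; rewrite -oppr_eq0; apply/eqP|].
Qed.

Lemma nonflat_vector p (y : 'I_2 -> R) : U p -> nonflat_at p ->
  (forall a, \sum_c riemann h p a c 0 1 * y c = 0) -> forall c, y c = 0.
Proof.
move=> Up /(nonflat_shape Up)[mu mu0 [K1 K2 K3 K4]] H.
have := H 0; have := H 1; rewrite !sum_I2 K1 K2 K3 K4 => H1 H0.
have [||x0 y0] := @cramer2 R _ _ _ (y 0) (y 1) (metric_det Up).
- by apply: (mulfI mu0); rewrite mulr0 -[RHS]oppr0 -H1; ring.
- by apply: (mulfI mu0); rewrite mulr0 -H0; ring.
by move=> c; case: (I2_cases c) => ->.
Qed.

(** By [nonflat_shape] the form [s] is annihilated by [so(h)], and in dimension two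
    the equations that express this are the proportionality of [s] and [h]. *)
Lemma nonflat_tensor p (s : 'I_2 -> 'I_2 -> R) : U p -> nonflat_at p ->
  (forall b c, s b c = s c b) ->
  (forall b c, \sum_e (riemann h p e b 0 1 * s e c + riemann h p e c 0 1 * s e b) = 0) ->
  exists l, forall b c, s b c = l * h p b c.
Proof.
move=> Up /(nonflat_shape Up)[mu mu0 [K1 K2 K3 K4]] sC H.
have h10 : h p 1 0 = h p 0 1 by exact: metricC Up.
have := H 0 0; have := H 1 1; have := H 0 1; rewrite !sum_I2 K1 K2 K3 K4 (sC 1 0).
move=> E01 E11 E00; have mu2 : mu * 2 != 0 by rewrite mulf_neq0.
have [|||l [s00 s01 s11]] := @proportional2 R _ _ _ (s 0 0) (s 0 1) (s 1 1) (metric_det Up).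
- by apply: (mulfI mu2); apply/eqP; rewrite -subr_eq0 -E00; apply/eqP; ring.
- by apply: (mulfI mu2); apply/eqP; rewrite -subr_eq0 -E11; apply/eqP; ring.
- apply: (mulfI mu0); apply/eqP; rewrite -subr_eq0 -[X in _ == X]oppr0 -E01; apply/eqP; ring.
exists l => b c; case: (I2_cases b) (I2_cases c) => -> [] ->; rewrite ?(sC 1 0) ?h10//.
Qed.

End SurfaceGeometry.

(** * Affine and homothetic fields of a surface *)

Lemma lieT_sum (R : comNzRingType) (G : 'I_2 -> 'I_2 -> 'I_2 -> R)
    (dG : 'I_2 -> 'I_2 -> 'I_2 -> 'I_2 -> R) (u : 'I_2 -> R) (du : 'I_2 -> 'I_2 -> R)
    (ddu : 'I_2 -> 'I_2 -> 'I_2 -> R) (X : 'I_2 -> R) i :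
  \sum_j \sum_k (ddu j k i + \sum_l dG l i j k * u l) * X j * X k
  + \sum_j \sum_k G i j k * ((\sum_l du l j * X l) * X k + X j * (\sum_l du l k * X l))
  - \sum_l du l i * (\sum_j \sum_k G l j k * X j * X k)
  = lieT 0 1 G dG u du ddu i 0 0 * (X 0 * X 0) + lieT 0 1 G dG u du ddu i 0 1 * (X 0 * X 1)
    + lieT 0 1 G dG u du ddu i 1 0 * (X 1 * X 0) + lieT 0 1 G dG u du ddu i 1 1 * (X 1 * X 1).
Proof. by rewrite !sum_I2 lieT_quadratic. Qed.

Lemma polarisation (R : realFieldType) (a b c : R) :
  a * (1 * 1) + b * (1 * 0) + b * (0 * 1) + c * (0 * 0) = 0 ->
  a * (0 * 0) + b * (0 * 1) + b * (1 * 0) + c * (1 * 1) = 0 ->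
  a * (1 * 1) + b * (1 * 1) + b * (1 * 1) + c * (1 * 1) = 0 ->
  [/\ a = 0, b = 0 & c = 0].
Proof. by move=> ? ? ?; split; lra. Qed.

Section SurfaceLie.
Variables (R : realType) (U : set 'rV[R]_2) (h : 'rV[R]_2 -> 'M[R]_2).
Hypotheses (oU : open U) (mh : is_metric U h).
Variable u : 'rV[R]_2 -> 'rV[R]_2.
Hypothesis su : vector_field U u.

Definition lie_coef (p : 'rV[R]_2) : 'I_2 -> 'I_2 -> 'I_2 -> R :=
  lieT 0 1 (Γ h p) (fun x i j k => dΓ x h i j k p)
    (fun i => u p 0 i) (fun a i => dmx a u 0 i p)
    (fun a c i => pd a (dmx c u 0 i) p).

Lemma lie_conn_coef p X i : lie_conn h u p X 0 i =
  lie_coef p i 0 0 * (X 0 0 * X 0 0) + lie_coef p i 0 1 * (X 0 0 * X 0 1)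
  + lie_coef p i 1 0 * (X 0 1 * X 0 0) + lie_coef p i 1 1 * (X 0 1 * X 0 1).
Proof.
rewrite -lieT_sum /lie_conn [LHS]mxE [X in X + _ = _]mxE [X in _ + X = _]mxE [X in _ - X = _]mxE.
congr (_ + _ - _).
  apply: eq_bigr => j _; apply: eq_bigr => k _.
  by rewrite [jac _ _ _ _ j]mxE [jac _ _ _ _ k]mxE.
by apply: eq_bigr => l _; rewrite [geo_acc _ _ _ _ _]mxE.
Qed.

Lemma lie_coefC p i a c : U p -> lie_coef p i a c = lie_coef p i c a.
Proof.
move=> Up; apply: lieT_sym.
- by move=> l j k; exact: christoffelC Up.
- move=> x l j k.
  apply: (@pd_congr R 2 U (fun q => Γ h q l j k)
    (fun q => Γ h q l k j) p x oU); last exact: Up.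
  by move=> q; rewrite inE => Uq; exact: christoffelC Uq.
- exact: (pdC a c oU (su i 2%N) Up).
Qed.

(** A symmetric tensor is determined by its quadratic form. *)
Lemma lie_conn0_coef p : U p -> (forall X, lie_conn h u p X = 0) ->
  forall i a c, lie_coef p i a c = 0.
Proof.
move=> Up H i.
have Q x y : lie_coef p i 0 0 * (x * x) + lie_coef p i 0 1 * (x * y)
    + lie_coef p i 1 0 * (y * x) + lie_coef p i 1 1 * (y * y) = 0.
  have := congr1 (fun A : 'rV[R]_2 => A 0 i) (H (\row_j (if j == 0 then x else y))).
  by rewrite lie_conn_coef !mxE /=.
have C10 := lie_coefC i 1 0 Up.
have Q00 := Q 1 0; have Q11 := Q 0 1; have Q01 := Q 1 1.
rewrite C10 in Q00 Q11 Q01.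
have [T0 T1 T2] := polarisation Q00 Q11 Q01.
move=> a c; case: (I2_cases a) => ->; case: (I2_cases c) => ->;
  [exact: T0|exact: T1|rewrite C10; exact: T1|exact: T2].
Qed.

Lemma pd_lie_derivative p a b c : U p ->
  pd a (fun q => lie_derivative u h q b c) p =
  \sum_e (Γ h p e a b * lie_derivative u h p e c
        + Γ h p e a c * lie_derivative u h p e b)
  + \sum_e (h p e b * lie_coef p e a c + h p e c * lie_coef p e a b).
Proof.
move=> Up; have [sh _ _] := mh.
pose S i j k q := u q 0 k * dmx k h i j q + h q k j * dmx i u 0 k q
  + h q i k * dmx j u 0 k q.
have sE q i j : lie_derivative u h q i j = S i j 0 q + S i j 1 q by rewrite mxE sum_I2.
have Cu k : Ck U 1 (fun q => u q 0 k) by exact: su.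
have Cdu i k : Ck U 1 (dmx i u 0 k) by exact: Ck_pd (su k 2%N).
have Ch i j : Ck U 1 (fun q => h q i j) by exact: sh.
have Cdh k i j : Ck U 1 (dmx k h i j) by exact: Ck_pd (sh i j 2%N).
have CG i j k : Ck U 1 (fun q => Γ h q i j k).
  exact: smooth_christoffel.
have C1 k : Ck U 1 (fun q => u q 0 k * dmx k h b c q) by exact: CkM.
have C2 k : Ck U 1 (fun q => h q k c * dmx b u 0 k q) by exact: CkM.
have C3 k : Ck U 1 (fun q => h q b k * dmx c u 0 k q) by exact: CkM.
have C12 k := CkD oU (C1 k) (C2 k); have C123 k := CkD oU (C12 k) (C3 k).
have Dk k : pd a (S b c k) p =
    dmx a u 0 k p * dmx k h b c p
      + u p 0 k * pd a (dmx k h b c) p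
    + (dmx a h k c p * dmx b u 0 k p
      + h p k c * pd a (dmx b u 0 k) p)
    + (dmx a h b k p * dmx c u 0 k p
      + h p b k * pd a (dmx c u 0 k) p).
  rewrite (pd_add a (C12 k) (C3 k) Up) (pd_add a (C1 k) (C2 k) Up).
  rewrite (pd_mul a (Cu k) (Cdh k b c) Up) (pd_mul a (Ch k c) (Cdu b k) Up).
  by rewrite (pd_mul a (Ch b k) (Cdu c k) Up).
have -> : pd a (fun q => lie_derivative u h q b c) p = pd a (fun q => S b c 0 q + S b c 1 q) p.
  by congr pd; apply/funext => q; exact: sE.
rewrite (pd_add a (C123 0) (C123 1) Up) (Dk 0) (Dk 1).
have compat q k i j : U q -> dmx k h i j q =
    Γ h q 0 k i * h q 0 j + Γ h q 0 k j * h q 0 i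
    + (Γ h q 1 k i * h q 1 j + Γ h q 1 k j * h q 1 i).
  by move=> Uq; rewrite (metric_compat oU mh _ _ _ Uq) sum_I2.
have second k : pd a (dmx k h b c) p =
   dΓ k h 0 a b p * h p 0 c + Γ h p 0 a b * dmx k h 0 c p
   + (dΓ k h 0 a c p * h p 0 b + Γ h p 0 a c * dmx k h 0 b p)
   + (dΓ k h 1 a b p * h p 1 c + Γ h p 1 a b * dmx k h 1 c p
   + (dΓ k h 1 a c p * h p 1 b + Γ h p 1 a c * dmx k h 1 b p)).
  rewrite (pdC a k oU (sh b c 2%N) Up).
  have E : {in U, dmx a h b c =1 fun q =>
      Γ h q 0 a b * h q 0 c + Γ h q 0 a c * h q 0 b
    + (Γ h q 1 a b * h q 1 c + Γ h q 1 a c * h q 1 b)}.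
    by move=> q; rewrite inE; exact: compat.
  have D1 i x y : Ck U 1 (fun q => Γ h q i a x * h q i y) by exact: CkM.
  have Ei i : pd k (fun q => Γ h q i a b * h q i c + Γ h q i a c * h q i b) p =
      dΓ k h i a b p * h p i c
        + Γ h p i a b * dmx k h i c p
      + (dΓ k h i a c p * h p i b
        + Γ h p i a c * dmx k h i b p).
    rewrite (pd_add k (D1 i b c) (D1 i c b) Up).
    rewrite (pd_mul k (CG i a b) (Ch i c) Up).
    by rewrite (pd_mul k (CG i a c) (Ch i b) Up).
  rewrite (pd_congr k oU E Up).
  rewrite (pd_add k (CkD oU (D1 0 b c) (D1 0 c b)) (CkD oU (D1 1 b c) (D1 1 c b)) Up).
  by rewrite (Ei 0) (Ei 1).
have hC i j : h p i j = h p j i by exact: metricC Up.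
have := @lie_derivative_covariant R 'I_2 0 1 (Γ h p)
  (fun x i j k => dΓ x h i j k p)
  (fun i => u p 0 i) (fun a i => dmx a u 0 i p)
  (fun a c i => pd a (dmx c u 0 i) p)
  (fun i j => h p i j) (fun k i j => dmx k h i j p)
  (fun a k i j => pd a (dmx k h i j) p) a b c
  hC (fun k b c => compat p k b c Up) second.
cbv zeta beta => ->.
rewrite [X in _ = X + _]sum_I2 [X in _ = _ + X]sum_I2.
by rewrite (sE p 0 c) (sE p 0 b) (sE p 1 c) (sE p 1 b).
Qed.

End SurfaceLie.

Section Homothety.
Variables (R : realType) (U : set 'rV[R]_2) (h : 'rV[R]_2 -> 'M[R]_2).
Hypotheses (oU : open U) (mh : is_metric U h).

Lemma smooth_lie_derivative u b c : vector_field U u ->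
  smooth U (fun q => lie_derivative u h q b c).
Proof.
move=> su k; have [sh _ _] := mh.
have C : Ck U k (fun q => \sum_l (u q 0 l * dmx l h b c q
     + h q l c * dmx b u 0 l q + h q b l * dmx c u 0 l q)).
  apply: Ck_sum => // l; apply: CkD => //; first apply: CkD => //; apply: CkM => //.
  - exact: su.
  - exact: Ck_pd (sh b c k.+1).
  - exact: sh.
  - exact: Ck_pd (su l k.+1).
  - exact: sh.
  - exact: Ck_pd (su l k.+1).
by apply: (Ck_congr oU _ C) => q _; rewrite mxE.
Qed.

Lemma lie_derivativeC u p b c : U p ->
  lie_derivative u h p b c = lie_derivative u h p c b.
Proof.
move=> Up; rewrite !mxE; apply: eq_bigr => k _.
rewrite (pd_metricC oU mh k b c Up) (metricC mh k c Up) (metricC mh b k Up).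
exact: addrAC.
Qed.

(** The equation of a parallel tensor is a linear first-order system for its
    components, indexed here by pairs. *)
Lemma parallel_tensor_unique (s : 'I_2 -> 'I_2 -> 'rV[R]_2 -> R) p0 :
  connected U -> (forall b c, Ck U 1 (s b c)) ->
  (forall p a b c, U p -> pd a (s b c) p =
     \sum_e (Γ h p e a b * s e c p + Γ h p e a c * s e b p)) ->
  U p0 -> (forall b c, s b c p0 = 0) -> forall p b c, U p -> s b c p = 0.
Proof.
move=> cU Cs sP Up0 s0 p b c Up.
(* The sum over pairs [y] picks the terms [s e c] and [s e b] of the equation. *)
pose M (a : 'I_2) (x y : 'I_2 * 'I_2) (q : 'rV[R]_2) : R :=
  Γ h q y.1 a x.1 * (y.2 == x.2)%:R + Γ h q y.1 a x.2 * (y.2 == x.1)%:R.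
apply: (@unique_continuation R 2 U oU cU ('I_2 * 'I_2)%type (fun x => s x.1 x.2) M p0
  _ _ _ Up0 _ p (b, c) Up) => [x|a x y|q a [b' c'] Uq|[b' c']] /=.
- exact: Cs.
- have CG i j k : Ck U 0 (fun q => Γ h q i j k) by exact: smooth_christoffel.
  exact: (CkD oU (CkM oU (CG _ _ _) (Ck_cst U 0 _)) (CkM oU (CG _ _ _) (Ck_cst U 0 _))).
- rewrite sP// -(pair_bigA _ (fun d e => M a (b', c') (d, e) q * s d e q)) /=.
  apply: eq_bigr => d _; rewrite /M /=.
  have pick (x : R) (f : 'I_2 -> R) i : \sum_e x * (e == i)%:R * f e = x * f i.
    rewrite (bigD1 i)//= eqxx mulr1 big1 ?addr0// => e /negPf ->.
    by rewrite mulr0 mul0r.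
  under eq_bigr do rewrite mulrDl.
  by rewrite big_split /= !pick.
- exact: s0.
Qed.

(** For an affine field the tensor [L_u h] is parallel.  At the non-flat point the
    curvature annihilates it, so there it is a multiple [l *: h]; the difference
    [L_u h - l *: h] is parallel and vanishes at that point. *)
Lemma affine_homothetic u p0 : connected U -> vector_field U u ->
  U p0 -> nonflat_at h p0 -> (forall p X, U p -> lie_conn h u p X = 0) ->
  exists l : R, forall p, U p -> lie_derivative u h p = l *: h p.
Proof.
move=> cU su Up0 nf aff; have [sh _ _] := mh.
pose s b c q := lie_derivative u h q b c.
have Cs b c := smooth_lie_derivative b c su.
have sP p a b c : U p -> pd a (s b c) p =
    \sum_e (Γ h p e a b * s e c p + Γ h p e a c * s e b p).
  move=> Up; rewrite (pd_lie_derivative oU mh su _ _ _ Up) [X in _ + X]big1 ?addr0// => e _.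
  by rewrite !(lie_conn0_coef oU mh su Up (fun X => aff p X Up)) !mulr0 addr0.
have [|b c|l sl] := nonflat_tensor oU mh (s := fun b c => s b c p0) Up0 nf.
- by move=> b c; exact: lie_derivativeC.
- exact: (@parallel_tensor_curvature R U h oU mh s p0 1 b c 0 (fun b c => Cs b c 2%N) sP
    (fun p b c Up => lie_derivativeC u b c Up) Up0).
exists l => p Up; apply/matrixP => b c; rewrite [RHS]mxE; apply/eqP.
rewrite -subr_eq0; apply/eqP.
have Clh i j : Ck U 1 (fun q => l * h q i j).
  by apply: CkM => //; [exact: Ck_cst|exact: sh].
apply: (@parallel_tensor_unique (fun b c q => s b c q - l * h q b c) p0 cU _ _ Up0 _ p b c Up).
- by move=> i j; apply: CkB => //; exact: Cs.
- move=> q a i j Uq.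
  rewrite (pd_add a (Cs i j 1%N) (CkN oU (Clh i j)) Uq) (pd_opp a (Clh i j) Uq).
  rewrite (pd_scale a l (sh i j 1%N) Uq) sP// (metric_compat oU mh a i j Uq).
  rewrite mulr_sumr -sumrB; apply: eq_bigr => e _.
  by rewrite mulrDr !mulrBr opprD addrACA [l * _]mulrCA [l * (_ * h q e i)]mulrCA.
- by move=> i j; rewrite /= sl subrr.
Qed.

(** Since [l *: h] is parallel, the lowered tensor [B b a c] is skew in [b] and [c],
    and it is symmetric in [a] and [c]; such a tensor is zero. *)
Lemma homothetic_affine u l : vector_field U u ->
  (forall p, U p -> lie_derivative u h p = l *: h p) ->
  forall p X, U p -> lie_conn h u p X = 0.
Proof.
move=> su homo p X Up; have [sh _ _] := mh.
have hom q b c : U q -> lie_derivative u h q b c = l * h q b c.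
  by move=> Uq; rewrite homo// mxE.
pose B b a c := \sum_e h p e b * lie_coef h u p e a c.
have BC b a c : B b a c = B b c a.
  by apply: eq_bigr => e _; rewrite (lie_coefC oU mh su e a c Up).
have BB b a c : B b a c = - B c a b.
  apply/eqP; rewrite -addr_eq0 /B -big_split /=; apply/eqP.
  have E : pd a (fun q => lie_derivative u h q b c) p =
      \sum_e (Γ h p e a b * lie_derivative u h p e c
        + Γ h p e a c * lie_derivative u h p e b).
    have Ec : {in U, (fun q => lie_derivative u h q b c) =1 (fun q => l * h q b c)}.
      by move=> q; rewrite inE; exact: hom.
    rewrite (pd_congr a oU Ec Up) (pd_scale a l (sh b c 1%N) Up).
    rewrite (metric_compat oU mh a b c Up) mulr_sumr; apply: eq_bigr => e _.
    by rewrite (hom p e c Up) (hom p e b Up) mulrDr [l * _]mulrCA [l * (_ * h p e b)]mulrCA.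
  have := pd_lie_derivative oU mh su a b c Up; rewrite E => /eqP.
  by rewrite -[X in X == _]addr0 (inj_eq (addrI _)) => /eqP/esym.
have B0 b a c : B b a c = 0.
  have : B b a c = - B b a c.
    (* Alternate the two symmetries three times each, as for the uniqueness of the
       Levi-Civita connection. *)
    by rewrite {1}BB BC BB opprK BC BB BC.
  by move/eqP; rewrite -addr_eq0 -mulr2n mulrn_eq0 => /eqP.
have T0 i a c : lie_coef h u p i a c = 0.
  have H b := B0 b a c; rewrite /B in H.
  have h10 : h p 1 0 = h p 0 1 by exact: metricC Up.
  have H0 := H 0; have H1 := H 1.
  rewrite sum_I2 h10 in H0; rewrite sum_I2 in H1.
  have [x0 x1] := cramer2 (metric_det mh Up) H0 H1.
  by case: (I2_cases i) => ->; [exact: x0|exact: x1].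
apply/rowP => i; rewrite lie_conn_coef !T0 !mul0r !addr0 mxE.
by [].
Qed.

End Homothety.

(** * The metric of the product *)

Local Notation xyi := (lshift 1).
Local Notation zi := (rshift 2 (@ord0 0)).

Lemma rescale (R : realFieldType) (k m x y z : R) : k != 0 ->
  k^-1 * m * (k * x + k * y - k * z) = m * (x + y - z).
Proof. by move=> k0; field. Qed.

Lemma swap_factors (R : comNzRingType) (a b c d : R) :
  a * (b * c * d) = b * a * c * d.
Proof. by ring. Qed.

(** The second-order part of [lie_conn] is such a form in [X = x + t d/dz]; it is the
    splitting by powers of [t] that separates the conditions on [v]. *)
Lemma sum_split3 (R : comNzRingType) (A : 'I_(2 + 1) -> 'I_(2 + 1) -> R) (x : 'rV[R]_2) (t : R) :
  \sum_i \sum_j A i j * (row_mx x (t%:M : 'M[R]_1)) 0 i * (row_mx x (t%:M : 'M[R]_1)) 0 j =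
  \sum_b \sum_c A (xyi b) (xyi c) * x 0 b * x 0 c
  + t * (\sum_b (A (xyi b) zi + A zi (xyi b)) * x 0 b)
  + t ^+ 2 * A zi zi.
Proof.
have xl a : (row_mx x (t%:M : 'M[R]_1)) 0 (xyi a) = x 0 a by rewrite row_mxEl.
have xz : (row_mx x (t%:M : 'M[R]_1)) 0 zi = t.
  by rewrite row_mxEr mxE eqxx mulr1n.
rewrite big_split_ord /= big_ord1 [X in _ + X]big_split_ord /= big_ord1 !xz.
have -> : \sum_(i < 2) \sum_j A (xyi i) j * row_mx x t%:M 0 (xyi i) * row_mx x t%:M 0 j =
    \sum_b (\sum_c A (xyi b) (xyi c) * x 0 b * x 0 c
      + A (xyi b) zi * x 0 b * t).
  apply: eq_bigr => b _; rewrite big_split_ord /= big_ord1 xl xz; congr (_ + _).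
  by apply: eq_bigr => c _; rewrite xl.
rewrite big_split /= -!addrA; congr (_ + _); rewrite !addrA; congr (_ + _); last by ring.
rewrite mulr_sumr -big_split /=; apply: eq_bigr => b _; rewrite xl; ring.
Qed.

Lemma cross_terms (R : comNzRingType) (g jb jc pb pc xb xc t : R) :
  g * ((jb + pb * t) * xc + xb * (jc + pc * t)) =
  g * (jb * xc + xb * jc) + t * (g * (pb * xc + xb * pc)).
Proof. by ring. Qed.

Lemma regroup (R : comNzRingType) (S1 S2 J t B C Z : R) :
  S1 + t * B + t ^+ 2 * Z + (S2 + t * C) - J =
  S1 + S2 - J + t * (B + C) + t ^+ 2 * Z.
Proof. by ring. Qed.

Section Product.
Variables (R : realType) (U : set 'rV[R]_2) (I : set R) (h : 'rV[R]_2 -> 'M[R]_2) (k : R).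
Hypotheses (oU : open U) (oI : open I) (mh : is_metric U h) (k0 : k != 0).

Let D := cylinder U I.
Let G := product_metric k h.

Lemma xy_vec3 x z : xy (vec3 x z) = x :> 'rV[R]_2.
Proof. by rewrite /xy /vec3 row_mxKl. Qed.

Lemma zc_vec3 (x : 'rV[R]_2) z : zc (vec3 x z) = z.
Proof. by rewrite /zc /vec3 row_mxKr mxE eqxx mulr1n. Qed.

Lemma vec3_l (x : 'rV[R]_2) z a : vec3 x z 0 (xyi a) = x 0 a.
Proof. by rewrite /vec3 row_mxEl. Qed.

Lemma vec3_z (x : 'rV[R]_2) z : vec3 x z 0 zi = z.
Proof. by rewrite /vec3 row_mxEr mxE eqxx mulr1n. Qed.

Lemma vec3_xyz (p : 'rV[R]_(2 + 1)) : vec3 (xy p) (zc p) = p.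
Proof.
rewrite /vec3 -[RHS]hsubmxK; congr row_mx.
by apply/rowP => i; rewrite (ord1 i) /zc mxE eqxx mulr1n.
Qed.

Lemma I3_cases (i : 'I_(2 + 1)) : (exists a, i = xyi a) \/ i = zi.
Proof.
case: (split_ordP i) => a ->; [by left; exists a|right].
by rewrite (ord1 a).
Qed.

Lemma open_cylinder : open (cylinder U I).
Proof.
rewrite (_ : cylinder U I = [set p | U (lsubmx p)] `&` (fun p : 'rV[R]_(2 + 1) => zc p) @^-1` I)//.
apply: openI; first exact: open_lsubmx.
have cz : continuous (fun p : 'rV[R]_(2 + 1) => zc p).
  apply: contraction_continuous => x y; rewrite /zc.
  apply: le_trans (rsubmx_contract x y).
  by have := normr_coord (rsubmx x - rsubmx y) ord0; rewrite !mxE.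
by move/continuousP : cz; apply.
Qed.

Let oD : open D := open_cylinder.

Let DU : D `<=` [set p | U (lsubmx p)].
Proof. by move=> p []. Qed.

Let F (x : 'rV[R]_2) : 'M[R]_(2 + 1) := k *: block_mx (h x) 0 0 (1%:M : 'M[R]_1).

Let F_ll x a b : F x (xyi a) (xyi b) = k * h x a b.
Proof. by rewrite mxE block_mxEul. Qed.

Let F_lz x a : F x (xyi a) zi = 0.
Proof. by rewrite mxE block_mxEur mxE mulr0. Qed.

Let F_zl x a : F x zi (xyi a) = 0.
Proof. by rewrite mxE block_mxEdl mxE mulr0. Qed.

Let F_zz x : F x zi zi = k.
Proof. by rewrite mxE block_mxEdr mxE eqxx mulr1n mulr1. Qed.

Let invF x : h x \in unitmx ->
  F x *m (k^-1 *: block_mx (invmx (h x)) 0 0 1%:M) = 1%:M.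
Proof.
move=> uh; rewrite -scalemxAl -scalemxAr scalerA mulfV// scale1r.
by rewrite mulmx_block !mulmx0 !mul0mx mulmxV// mulmx1 !addr0 add0r -scalar_mx_block.
Qed.

Lemma is_metric_product : is_metric D G.
Proof.
have [sh th uh] := mh; split=> [i j r|p [Up _]|p [Up _]].
- apply: (Ck_sub DU).
  have CF (f : 'rV[R]_2 -> R) : Ck U r f -> Ck [set p : 'rV[R]_(2 + 1) | U (lsubmx p)] r (fun q => f (lsubmx q)).
    exact: Ck_lsubmx.
  apply: (CF (fun x => F x i j)).
  case: (I3_cases i) => [[a]|] ->; case: (I3_cases j) => [[b]|] ->.
  + apply: (Ck_congr oU _ (CkM oU (Ck_cst U r k) (sh a b r))) => x _.
    by rewrite F_ll.
  + by apply: (Ck_congr oU _ (Ck_cst U r 0)) => x _; rewrite F_lz.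
  + by apply: (Ck_congr oU _ (Ck_cst U r 0)) => x _; rewrite F_zl.
  + by apply: (Ck_congr oU _ (Ck_cst U r k)) => x _; rewrite F_zz.
- by rewrite /G /product_metric linearZ /= tr_block_mx th// !trmx0 trmx1.
- by have /mulmx1_unit[] := invF (uh _ Up).
Qed.

Let pdF_z p i j : dmx zi G i j p = 0.
Proof. exact: (pd_lsubmx_r (m := 2) (n := 1) (fun x => F x i j) ord0 p). Qed.

Let pdF_l p c i j : dmx (xyi c) G i j p = dmx c F i j (xy p).
Proof. exact: (pd_lsubmx_l (m := 2) (n := 1) (fun x => F x i j) c p). Qed.

Let pd_const (n : nat) (i : 'I_n) (f : 'rV[R]_n -> R) p (a : R) : (forall x, f x = a) -> pd i f p = 0.
Proof.
by move=> /funext ->; rewrite /pd derive_cst.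
Qed.

Let pdF_lll p a b c : U (xy p) ->
  dmx (xyi c) G (xyi a) (xyi b) p = k * dmx c h a b (xy p).
Proof.
move=> Up; have [sh _ _] := mh; rewrite pdF_l.
apply: etrans _ (pd_scale c k (sh a b 1%N) Up).
exact: (congr1 (fun f => pd c f (xy p)) (funext (fun x => F_ll x a b))).
Qed.

Let pdF_zl p i j : dmx i G zi j p = 0.
Proof.
case: (I3_cases i) => [[c]|] ->; last exact: pdF_z.
rewrite pdF_l; case: (I3_cases j) => [[b]|] ->.
  by apply: (@pd_const _ _ _ _ 0) => x; exact: F_zl.
by apply: (@pd_const _ _ _ _ k) => x; exact: F_zz.
Qed.

Let pdF_lz p i j : dmx i G j zi p = 0.
Proof.
case: (I3_cases i) => [[c]|] ->; last exact: pdF_z.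
rewrite pdF_l; case: (I3_cases j) => [[b]|] ->.
  by apply: (@pd_const _ _ _ _ 0) => x; exact: F_lz.
by apply: (@pd_const _ _ _ _ k) => x; exact: F_zz.
Qed.

Let invG p : U (xy p) -> invmx (G p) = k^-1 *: block_mx (invmx (h (xy p))) 0 0 1%:M.
Proof.
move=> Up; have [_ _ uh] := mh; have E := invF (uh _ Up).
have [uF _] := mulmx1_unit E.
by rewrite -[RHS](mulKmx uF) E mulmx1.
Qed.

(** In the product only the Christoffel symbols with three horizontal indices are
    non-zero, and the constant [k] drops out of them. *)
Lemma christoffel_product_l p a b c : U (xy p) ->
  Γ G p (xyi a) (xyi b) (xyi c) = Γ h (xy p) a b c.
Proof.
move=> Up; rewrite /christoffel big_split_ord /= big_ord1 (invG Up).
rewrite [X in _ + X]mulrC [X in _ + _ * X]mxE block_mxEur mxE !mulr0 addr0.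
congr (_ * _); apply: eq_bigr => d _.
rewrite (pdF_lll d c b Up) (pdF_lll d b c Up) (pdF_lll b c d Up) mxE block_mxEul.
exact: rescale.
Qed.

Lemma christoffel_product_z0 p i j : U (xy p) ->
  Γ G p zi i j = 0.
Proof.
move=> Up; rewrite /christoffel big_split_ord /= big_ord1 (invG Up).
rewrite big1 => [|d _]; last by rewrite mxE block_mxEdl mxE mulr0 mul0r.
by rewrite add0r !pdF_zl pdF_z addr0 subr0 mulr0 mulr0.
Qed.

Lemma christoffel_product_z1 p i j : Γ G p i zi j = 0.
Proof.
rewrite /christoffel big1 ?mulr0// => d _.
by rewrite pdF_z (pdF_lz p j d) pdF_zl addr0 subr0 mulr0.
Qed.

Lemma christoffel_product_z2 p i j : Γ G p i j zi = 0.
Proof.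
rewrite /christoffel big1 ?mulr0// => d _.
by rewrite pdF_z (pdF_lz p j d) pdF_lz addr0 subr0 mulr0.
Qed.

Lemma pd_christoffel_product_l p a b c d : D p ->
  dΓ (xyi d) G (xyi a) (xyi b) (xyi c) p =
  dΓ d h a b c (xy p).
Proof.
move=> Dp; rewrite -(pd_lsubmx_l (m := 2) (n := 1) (fun x => Γ h x a b c) d p).
apply: (@pd_congr R (2 + 1) D (fun q => Γ G q (xyi a) (xyi b) (xyi c))
  (fun q => Γ h (lsubmx q) a b c) p (xyi d) oD); last exact: Dp.
by move=> q; rewrite inE => -[Uq _]; exact: christoffel_product_l.
Qed.

Lemma pd_christoffel_product_zd p a b c : D p ->
  dΓ zi G (xyi a) (xyi b) (xyi c) p = 0.
Proof.
move=> Dp.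
rewrite -(pd_lsubmx_r (m := 2) (n := 1) (fun x => Γ h x a b c) ord0 p).
apply: (@pd_congr R (2 + 1) D (fun q => Γ G q (xyi a) (xyi b) (xyi c))
  (fun q => Γ h (lsubmx q) a b c) p zi oD); last exact: Dp.
by move=> q; rewrite inE => -[Uq _]; exact: christoffel_product_l.
Qed.

Lemma pd_christoffel_product_z0 p m i j : D p ->
  dΓ m G zi i j p = 0.
Proof.
move=> Dp; rewrite -(@pd_const _ m (fun=> 0) p 0)//.
apply: (@pd_congr R (2 + 1) D (fun q => Γ G q zi i j) (fun=> 0) p m oD) => //.
by move=> q; rewrite inE => -[Uq _]; exact: christoffel_product_z0.
Qed.

Lemma pd_christoffel_product_z1 p m i j :
  dΓ m G i zi j p = 0.
Proof. by apply: (@pd_const _ _ _ _ 0) => q; exact: christoffel_product_z1. Qed.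

Lemma pd_christoffel_product_z2 p m i j :
  dΓ m G i j zi p = 0.
Proof. by apply: (@pd_const _ _ _ _ 0) => q; exact: christoffel_product_z2. Qed.

Lemma geo_acc_product_l p x t a : U (xy p) ->
  geo_acc G p (vec3 x t) 0 (xyi a) = geo_acc h (xy p) x 0 a.
Proof.
move=> Up; rewrite !mxE big_split_ord /= big_ord1.
rewrite [X in _ + X]big1 => [|j _]; last by rewrite christoffel_product_z1 !mul0r.
rewrite addr0; apply: eq_bigr => b _.
rewrite big_split_ord /= big_ord1 christoffel_product_z2 !mul0r addr0.
by apply: eq_bigr => c _; rewrite christoffel_product_l// !vec3_l.
Qed.

Lemma geo_acc_product_z p X : U (xy p) -> geo_acc G p X 0 zi = 0.
Proof.
move=> Up; rewrite mxE big1// => i _; rewrite big1// => j _.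
by rewrite christoffel_product_z0// !mul0r.
Qed.

Section Field.
Variable v : 'rV[R]_(2 + 1) -> 'rV[R]_(2 + 1).

Definition slice (z : R) (x : 'rV[R]_2) : 'rV[R]_2 := \row_a v (vec3 x z) 0 (xyi a).

Let vec3_contract z (x y : 'rV[R]_2) : `|vec3 x z - vec3 y z| <= `|x - y|.
Proof.
apply: normr_rV_le => // i; rewrite [X in `|X|]mxE [X in `|_ + X|]mxE.
case: (I3_cases i) => [[a]|] ->; last by rewrite !vec3_z subrr normr0.
by rewrite !vec3_l; have := normr_coord (x - y) a; rewrite !mxE.
Qed.

Let vec3_delta z t (i : 'I_2) (p : 'rV[R]_2) :
  vec3 (t *: delta_mx 0 i + p) z = t *: oapp (delta_mx 0) 0 (Some (xyi i)) + vec3 p z.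
Proof.
apply/rowP => j; case: (I3_cases j) => [[a]|] ->.
  by rewrite vec3_l [RHS]mxE vec3_l !mxE /= eq_lshift.
by rewrite vec3_z [RHS]mxE vec3_z !mxE /= eq_rlshift ?andbF mulr0 add0r.
Qed.

Lemma pd_vec3 (f : 'rV[R]_(2 + 1) -> R) z a x :
  pd a (fun x => f (vec3 x z)) x = pd (xyi a) f (vec3 x z).
Proof. exact: (pd_precomp (vec3_delta z) f a x). Qed.

Lemma Ck_vec3 (f : 'rV[R]_(2 + 1) -> R) r z : I z -> Ck D r f ->
  Ck U r (fun x => f (vec3 x z)).
Proof.
move=> Iz Cf; have := Ck_precomp (vec3_contract z) (vec3_delta z) Cf.
by apply: Ck_sub => x Ux; split; rewrite ?xy_vec3 ?zc_vec3.
Qed.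

Hypothesis sv : vector_field D v.

Lemma smooth_slice z : I z -> vector_field U (slice z).
Proof.
move=> Iz a r; apply: (Ck_congr oU _ (Ck_vec3 Iz (sv (xyi a) r))) => x _.
by rewrite mxE.
Qed.

Lemma pd_slice z a d x :
  pd d (fun x => slice z x 0 a) x = dmx (xyi d) v 0 (xyi a) (vec3 x z).
Proof.
have E : (fun x => slice z x 0 a) = (fun x => v (vec3 x z) 0 (xyi a)).
  by apply/funext => y; rewrite mxE.
apply: etrans (congr1 (fun f => pd d f x) E) _.
exact: (pd_vec3 (fun q => v q 0 (xyi a)) z d x).
Qed.

Lemma pd2_slice z a b c x :
  pd b (pd c (fun x => slice z x 0 a)) x =
  pd (xyi b) (dmx (xyi c) v 0 (xyi a)) (vec3 x z).
Proof.
apply: etrans (congr1 (fun f => pd b f x) (funext (fun y => pd_slice z a c y))) _.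
exact: (pd_vec3 (dmx (xyi c) v 0 (xyi a)) z b x).
Qed.

(** The vertical component of the Lie derivative of the connection at
    [X = x + t d/dz].  With [w] the vertical component of [v], the coefficients of
    [1], [t] and [t^2] are the covariant Hessian of [w] along the slice, twice the
    mixed derivative, and [d_z^2 w]. *)
Lemma lie_conn_product_z p x t : D p ->
  lie_conn G v p (vec3 x t) 0 zi =
  \sum_b \sum_c (pd (xyi b) (dmx (xyi c) v 0 zi) p
     - \sum_d Γ h (xy p) d b c * dmx (xyi d) v 0 zi p)
     * x 0 b * x 0 c
  + t * (\sum_b (pd (xyi b) (dmx zi v 0 zi) p
      + pd zi (dmx (xyi b) v 0 zi) p) * x 0 b)
  + t ^+ 2 * pd zi (dmx zi v 0 zi) p.
Proof.
move=> Dp; have [Up _] := Dp.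
set f := fun q => v q 0 zi.
rewrite /lie_conn [LHS]mxE [X in X + _ = _]mxE [X in _ + X = _]mxE.
rewrite [X in _ + X - _]big1; last first.
  by move=> i _; rewrite big1// => j _; rewrite christoffel_product_z0// mul0r.
rewrite addr0 [X in _ - X]mxE.
have -> : \sum_i pd i f p * geo_acc G p (vec3 x t) 0 i =
    \sum_b \sum_c (\sum_d Γ h (xy p) d b c * pd (xyi d) f p) * x 0 b * x 0 c.
  rewrite big_split_ord /= big_ord1 geo_acc_product_z// mulr0 addr0.
  transitivity (\sum_d \sum_b \sum_c
      Γ h (xy p) d b c * pd (xyi d) f p * x 0 b * x 0 c).
    apply: eq_bigr => d _; rewrite geo_acc_product_l// mxE mulr_sumr.
    apply: eq_bigr => b _; rewrite mulr_sumr; apply: eq_bigr => c _.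
    exact: swap_factors.
  rewrite exchange_big /=; apply: eq_bigr => b _.
  rewrite exchange_big /=; apply: eq_bigr => c _.
  by rewrite !mulr_suml.
have E i j : pd i (pd j f) p + \sum_m dΓ m G zi i j p * v p 0 m
    = pd i (pd j f) p.
  by rewrite big1 ?addr0// => m _; rewrite pd_christoffel_product_z0// mul0r.
under eq_bigr do under eq_bigr do rewrite E.
rewrite (sum_split3 (fun i j => pd i (pd j f) p) x t).
rewrite addrAC; congr (_ + _); rewrite addrAC; congr (_ + _).
rewrite -sumrB; apply: eq_bigr => b _; rewrite -sumrB; apply: eq_bigr => c _.
by rewrite -!mulrBl.
Qed.

(** The horizontal components.  The constant term is the Lie derivative of the
    connection of [h] along the slice of [v]; the coefficient of [t] is twice the
    covariant derivative of [d_z u] in the direction [x]. *)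
Lemma lie_conn_product_l p x t a : D p ->
  lie_conn G v p (vec3 x t) 0 (xyi a) =
  lie_conn h (slice (zc p)) (xy p) x 0 a
  + t * (\sum_b (pd (xyi b) (dmx zi v 0 (xyi a)) p
      + pd zi (dmx (xyi b) v 0 (xyi a)) p) * x 0 b
    + \sum_b \sum_c Γ h (xy p) a b c *
        (dmx zi v 0 (xyi b) p * x 0 c
         + x 0 b * dmx zi v 0 (xyi c) p))
  + t ^+ 2 * pd zi (dmx zi v 0 (xyi a)) p.
Proof.
move=> Dp; have [Up _] := Dp.
set f := fun q => v q 0 (xyi a).
have pE : vec3 (xy p) (zc p) = p by exact: vec3_xyz.
have ds b d : pd d (fun x => slice (zc p) x 0 b) (xy p) = dmx (xyi d) v 0 (xyi b) p.
  by rewrite pd_slice pE.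
have d2s b c : pd b (pd c (fun x => slice (zc p) x 0 a)) (xy p) = pd (xyi b) (pd (xyi c) f) p.
  by rewrite pd2_slice pE.
have js b : jac v p (vec3 x t) 0 (xyi b) =
    jac (slice (zc p)) (xy p) x 0 b + dmx zi v 0 (xyi b) p * t.
  rewrite mxE big_split_ord /= big_ord1 vec3_z mxE; congr (_ + _).
  by apply: eq_bigr => d _; rewrite vec3_l ds.
rewrite /lie_conn [LHS]mxE [X in X + _ = _]mxE [X in _ + X = _]mxE.
have -> : jac v p (geo_acc G p (vec3 x t)) 0 (xyi a) =
    jac (slice (zc p)) (xy p) (geo_acc h (xy p) x) 0 a.
  rewrite mxE big_split_ord /= big_ord1 geo_acc_product_z// mulr0 addr0 mxE.
  by apply: eq_bigr => d _; rewrite geo_acc_product_l// ds.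
have -> : \sum_i \sum_j Γ G p (xyi a) i j *
     (jac v p (vec3 x t) 0 i * vec3 x t 0 j + vec3 x t 0 i * jac v p (vec3 x t) 0 j) =
   \sum_b \sum_c Γ h (xy p) a b c *
     (jac (slice (zc p)) (xy p) x 0 b * x 0 c + x 0 b * jac (slice (zc p)) (xy p) x 0 c)
   + t * \sum_b \sum_c Γ h (xy p) a b c *
        (dmx zi v 0 (xyi b) p * x 0 c + x 0 b * dmx zi v 0 (xyi c) p).
  rewrite mulr_sumr -big_split big_split_ord /= [X in _ + X]big1 => [|i _]; last first.
    rewrite big1// => j _; rewrite (ord1 i).
    by rewrite christoffel_product_z1 mul0r.
  rewrite addr0; apply: eq_bigr => b _; rewrite mulr_sumr -big_split big_split_ord /=.
  rewrite [X in _ + X]big1 => [|j _]; last by rewrite (ord1 j) christoffel_product_z2 mul0r.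
  rewrite addr0; apply: eq_bigr => c _.
  rewrite christoffel_product_l// !vec3_l !js; exact: cross_terms.
have sl b : fintype.split (xyi b : 'I_(2 + 1)) = inl b.
  by rewrite -[xyi b]/(unsplit (inl b)) unsplitK.
have sr b : fintype.split (rshift 2 b : 'I_(2 + 1)) = inr b.
  by rewrite -[rshift 2 b]/(unsplit (inr b)) unsplitK.
have E i j : (pd i (pd j f) p + \sum_m dΓ m G (xyi a) i j p * v p 0 m)
    = match fintype.split i, fintype.split j with
      | inl b, inl c => pd b (pd c (fun x => slice (zc p) x 0 a)) (xy p)
         + \sum_d dΓ d h a b c (xy p) * slice (zc p) (xy p) 0 d
      | _, _ => pd i (pd j f) p end.
  case: (split_ordP i) => b ->; last first.
    rewrite ?sr /= (ord1 b) big1 ?addr0// => m _.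
    by rewrite pd_christoffel_product_z1 mul0r.
  case: (split_ordP j) => c ->; last first.
    rewrite ?sl ?sr /= (ord1 c) big1 ?addr0// => m _.
    by rewrite pd_christoffel_product_z2 mul0r.
  rewrite ?sl /= d2s.
  congr (_ + _); rewrite big_split_ord /= big_ord1 pd_christoffel_product_zd// mul0r addr0.
  apply: eq_bigr => d _; rewrite pd_christoffel_product_l// mxE; congr (_ * _).
  by rewrite pE.
under eq_bigr do under eq_bigr do rewrite E.
rewrite (sum_split3 (fun i j => match fintype.split i, fintype.split j with
      | inl b, inl c => pd b (pd c (fun x => slice (zc p) x 0 a)) (xy p)
         + \sum_d dΓ d h a b c (xy p) * slice (zc p) (xy p) 0 d
      | _, _ => pd i (pd j f) p end) x t).
rewrite sr; under eq_bigr do under eq_bigr do rewrite !sl.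
under [X in _ + t * X + _]eq_bigr do rewrite sl.
rewrite [X in _ = X + _ + _]mxE [X in _ = X + _ + _ + _]mxE [X in _ = _ + X + _ + _]mxE.
exact: regroup.
Qed.

End Field.

End Product.

(** * Projective fields of the product *)

Section PolynomialIdentities.
Variable R : realFieldType.

(** The identity at [t = 0, 1, -1, 2] is an invertible linear system in the four
    differences of coefficients. *)
Lemma cubic_match (w e z a b c : R) :
  (forall t, w + t * e + t ^+ 2 * z = t * a + t ^+ 2 * b + t ^+ 3 * c) ->
  [/\ w = 0, e = a, z = b & c = 0].
Proof.
move=> H; have := H 0; have := H 1; have := H (-1); have := H 2.
by rewrite !expr2 !exprS !expr0 => ? ? ? ?; split; lra.
Qed.

Lemma cross_products (S1 S2 S3 S4 S5 S6 x t : R) :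
  (S1 + t * S2 + t ^+ 2 * S5) * x = (S3 + t * S4 + t ^+ 2 * S6) * t ->
  S1 * x + t * (S2 * x) + t ^+ 2 * (S5 * x) = t * S3 + t ^+ 2 * S4 + t ^+ 3 * S6.
Proof.
move=> E; transitivity ((S1 + t * S2 + t ^+ 2 * S5) * x); first by ring.
by rewrite E; ring.
Qed.

(** If [q(x) x = 0] for a quadratic form [q], then [q(x) = 0]: either a coordinate
    of [x] can be cancelled, or [x = 0]. *)
Lemma form_cancel (a b c d x y : R) :
  (a * x * x + b * x * y + (c * y * x + d * y * y)) * x = 0 ->
  (a * x * x + b * x * y + (c * y * x + d * y * y)) * y = 0 ->
  a * x * x + b * x * y + (c * y * x + d * y * y) = 0.
Proof.
move=> Hx Hy; have [x0|x0] := eqVneq x 0.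
  have [y0|y0] := eqVneq y 0; first by rewrite x0 y0 !mulr0 !addr0.
  by apply: (mulIf y0); rewrite mul0r.
by apply: (mulIf x0); rewrite mul0r.
Qed.

Lemma quadratic_form0 (a b b' c : R) : b = b' ->
  (forall x y, a * x * x + b * x * y + (b' * y * x + c * y * y) = 0) ->
  [/\ a = 0, b = 0 & c = 0].
Proof.
move=> <- H; have := H 1 0; have := H 0 1; have := H 1 1.
by move=> ? ? ?; split; lra.
Qed.

Lemma linear_match (p0 p1 g00 g01 g11 y0 y1 c0 c1 : R) :
  (forall x0 x1, (p0 + p0) * x0 + (p1 + p1) * x1
     + (g00 * (y0 * x0 + x0 * y0) + g01 * (y0 * x1 + x0 * y1)
     + (g01 * (y1 * x0 + x1 * y0) + g11 * (y1 * x1 + x1 * y1))) = c0 * x0 + c1 * x1) ->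
  p0 + (g00 * y0 + g01 * y1) = c0 / 2 /\ p1 + (g01 * y0 + g11 * y1) = c1 / 2.
Proof.
move=> H; have := H 1 0; have := H 0 1 => H1 H0; split.
  transitivity (((p0 + p0) * 1 + (p1 + p1) * 0
     + (g00 * (y0 * 1 + 1 * y0) + g01 * (y0 * 0 + 1 * y1)
     + (g01 * (y1 * 1 + 0 * y0) + g11 * (y1 * 0 + 0 * y1)))) / 2); first by field.
  by rewrite H0 mulr1 mulr0 addr0.
transitivity (((p0 + p0) * 0 + (p1 + p1) * 1
     + (g00 * (y0 * 0 + 0 * y0) + g01 * (y0 * 1 + 0 * y1)
     + (g01 * (y1 * 0 + 1 * y0) + g11 * (y1 * 1 + 1 * y1)))) / 2); first by field.
by rewrite H1 mulr1 mulr0 add0r.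
Qed.

End PolynomialIdentities.

Section ProductField.
Variables (R : realType) (U : set 'rV[R]_2) (I : set R) (h : 'rV[R]_2 -> 'M[R]_2) (k : R).
Hypotheses (oU : open U) (oI : open I) (mh : is_metric U h) (k0 : k != 0).

Let D := cylinder U I.
Let G := product_metric k h.
Let oD : open D := open_cylinder oU oI.
Let mG : is_metric D G := is_metric_product I oU mh k0.

Let DU p : D p -> U (xy p).
Proof. by case. Qed.

Let Dvec x z : U x -> I z -> D (vec3 x z).
Proof. by move=> Ux Iz; split; rewrite ?xy_vec3 ?zc_vec3. Qed.

Lemma riemann_product0 p : D p -> (forall a b c d, riemann h (xy p) a b c d = 0) ->
  forall i j c d, riemann G p i j c d = 0.
Proof.
move=> Dp flat i j.
have Up := DU Dp.
(* Here and in the cases below: nothing depends on [z], and the Christoffel symbols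
   with a vertical index are zero. *)
have cz d : riemann G p i j zi d = 0.
  have E2 := pd_christoffel_product_z1 h k p d i j.
  have E1 : dΓ zi G i d j p = 0.
    case: (I3_cases i) => [[a]|] ->.
      case: (I3_cases j) => [[b]|] ->; last exact: pd_christoffel_product_z2.
      case: (I3_cases d) => [[e]|] ->; last exact: pd_christoffel_product_z1.
      exact: (pd_christoffel_product_zd oU oI mh k0 a e b Dp).
    exact: (pd_christoffel_product_z0 oU oI mh k0 zi d j Dp).
  rewrite /riemann E1 E2 subrr add0r big1 // => m _.
  have F1 := christoffel_product_z1 h k p i m; have F2 := christoffel_product_z1 h k p m j.
  by rewrite F1 F2 mul0r mulr0 subrr.
move=> c d; case: (I3_cases c) => [[c']|] ->; last exact: cz.
case: (I3_cases d) => [[d']|] ->; last first.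
  by have E := riemannC G p i j zi (xyi c'); rewrite (cz (xyi c')) oppr0 in E.
case: (I3_cases i) => [[a]|] ->; last first.
  have E1 := pd_christoffel_product_z0 oU oI mh k0 (xyi c') (xyi d') j Dp.
  have E2 := pd_christoffel_product_z0 oU oI mh k0 (xyi d') (xyi c') j Dp.
  rewrite /riemann E1 E2 subrr add0r big1// => m _.
  have F1 := christoffel_product_z0 mh k0 (xyi c') m Up.
  have F2 := christoffel_product_z0 mh k0 (xyi d') m Up.
  by rewrite F1 F2 !mul0r subrr.
case: (I3_cases j) => [[b]|] ->; last first.
  have E1 := pd_christoffel_product_z2 h k p (xyi c') (xyi a) (xyi d').
  have E2 := pd_christoffel_product_z2 h k p (xyi d') (xyi a) (xyi c').
  rewrite /riemann E1 E2 subrr add0r big1// => m _.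
  have F1 := christoffel_product_z2 h k p m (xyi d').
  have F2 := christoffel_product_z2 h k p m (xyi c').
  by rewrite F1 F2 !mulr0 subrr.
apply: etrans (flat a b c' d'); rewrite /riemann.
have E1 := pd_christoffel_product_l oU oI mh k0 a d' b c' Dp.
have E2 := pd_christoffel_product_l oU oI mh k0 a c' b d' Dp.
rewrite E1 E2; congr (_ + _); rewrite big_split_ord /= big_ord1.
have F1 := christoffel_product_z2 h k p (xyi a) (xyi c').
have F2 := christoffel_product_z2 h k p (xyi a) (xyi d').
rewrite F1 F2 !mul0r subrr addr0; apply: eq_bigr => m _.
have G1 := christoffel_product_l mh k0 a c' m Up.
have G2 := christoffel_product_l mh k0 a d' m Up.
have G3 := christoffel_product_l mh k0 m d' b Up.
have G4 := christoffel_product_l mh k0 m c' b Up.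
by rewrite G1 G2 G3 G4.
Qed.

Lemma flat_product_constant_curvature :
  (forall p, D p -> forall a b c d, riemann h (xy p) a b c d = 0) ->
  constant_curvature G D.
Proof.
move=> flat; exists 0 => p X Y Dp _; rewrite /sectional_curvature.
have -> : curvature_op G p X Y Y = 0.
  apply/rowP => i; rewrite !mxE big1// => j _; rewrite big1// => c _; rewrite big1// => d _.
  by rewrite (riemann_product0 Dp (flat p Dp)) !mul0r.
rewrite /inner big1 ?mul0r// => i _; rewrite big1// => j _.
by rewrite [X in _ * X * _]mxE mulr0 mul0r.
Qed.

Variable v : 'rV[R]_(2 + 1) -> 'rV[R]_(2 + 1).
Hypothesis sv : vector_field D v.

Let pd_cst0 (n : nat) (i : 'I_n) p (a : R) : pd i (fun=> a) p = 0.
Proof. by rewrite /pd derive_cst. Qed.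

Let pd_zero (f : 'rV[R]_(2 + 1) -> R) i p (a : R) :
  (forall q, D q -> f q = a) -> D p -> pd i f p = 0.
Proof.
move=> fa Dp; rewrite -(pd_cst0 i p a); apply: (pd_congr i oD); last exact: Dp.
by move=> q; rewrite inE; exact: fa.
Qed.

(** By the decomposition in powers of [t] the Lie derivative of the connection
    vanishes: the horizontal part of [v] is affine and independent of [z], and the
    vertical part has no second derivatives. *)
Lemma homothetic_projective (u : 'rV[R]_2 -> 'rV[R]_2) (c0 c1 : R) :
  homothetic_field U h u ->
  (forall p, D p -> v p = vec3 (u (xy p)) (c1 * zc p + c0)) ->
  projective_field D G v.
Proof.
move=> [su [lam lamP]] vE; apply: (lie_conn0_projective oD mG sv) => p X Dp.
have Up := DU Dp; have [_ Iz] := Dp.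
have v_l q a : D q -> v q 0 (xyi a) = u (lsubmx q) 0 a.
  by move=> Dq; rewrite vE// vec3_l.
have v_z q : D q -> v q 0 zi = c1 * q 0 zi + c0.
  by move=> Dq; rewrite vE// vec3_z /zc mxE.
have dz_l q a : D q -> dmx zi v 0 (xyi a) q = 0.
  move=> Dq; rewrite -(pd_lsubmx_r (m := 2) (n := 1) (fun x => u x 0 a) ord0 q).
  apply: (@pd_congr R (2 + 1) D (fun q => v q 0 (xyi a)) (fun q => u (lsubmx q) 0 a) q zi oD); last exact: Dq.
  by move=> r; rewrite inE; exact: v_l.
have d_z q i : D q -> dmx i v 0 zi q = c1 * (delta_mx 0 i : 'rV[R]_(2 + 1)) 0 zi.
  move=> Dq.
  have Ez : {in D, (fun q => v q 0 zi) =1 (fun q => c1 * q 0 zi + c0)}.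
    by move=> r; rewrite inE; exact: v_z.
  rewrite (pd_congr i oD Ez Dq).
  have C1 : Ck D 1 (fun q => c1 * q 0 zi).
    by apply: CkM => //; [exact: Ck_cst|exact: Ck_coord].
  rewrite (pd_add i C1 (Ck_cst D 1 c0) Dq) pd_cst0 addr0.
  rewrite (pd_scale i c1 (Ck_coord 1 zi oD) Dq); congr (_ * _).
  by have [_] := is_derive_coord q (delta_mx 0 i) zi.
have db_z q b : D q -> dmx (xyi b) v 0 zi q = 0.
  by move=> Dq; rewrite d_z// mxE eq_rlshift ?andbF mulr0.
have d2_z q i j : D q -> pd i (dmx j v 0 zi) q = 0.
  by move=> Dq; exact: (@pd_zero (dmx j v 0 zi) i q _ (fun r Dr => d_z r j Dr) Dq).
have d2_l q i a : D q -> pd i (dmx zi v 0 (xyi a)) q = 0.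
  by move=> Dq; exact: (@pd_zero (dmx zi v 0 (xyi a)) i q 0 (fun r Dr => dz_l r a Dr) Dq).
have C2 a : Ck D 2 (fun q => v q 0 (xyi a)) by exact: sv.
rewrite -(vec3_xyz X); apply/rowP => i; rewrite [RHS]mxE.
case: (I3_cases i) => [[a]|] ->.
  rewrite (lie_conn_product_l oU oI mh k0 v _ _ _ Dp) (d2_l _ zi a Dp) mulr0 addr0.
  have -> : lie_conn h (slice v (zc p)) (xy p) (xy X) = 0.
    apply: (@homothetic_affine R U h oU mh (slice v (zc p)) lam); last exact: Up.
      exact: (smooth_slice oU sv Iz).
    move=> x Ux; rewrite -(lamP x Ux).
    have sE : {in U, slice v (zc p) =1 u}.
      move=> y; rewrite inE => Uy; apply/rowP => b; rewrite mxE.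
      have := v_l _ b (Dvec Uy Iz) => ->.
      by rewrite -/(xy _) xy_vec3.
    apply/matrixP => b c; rewrite !mxE; apply: eq_bigr => e _.
    have sEe e' : {in U, (fun q => slice v (zc p) q 0 e') =1 (fun q => u q 0 e')}.
      by move=> y /sE ->.
    rewrite (pd_congr b oU (sEe e) Ux) (pd_congr c oU (sEe e) Ux).
    by rewrite sE ?inE.
  rewrite mxE add0r [X in X + _]big1 => [|b _]; last first.
    by rewrite (d2_l _ (xyi b) a Dp) (pdC zi (xyi b) oD (C2 a) Dp) (d2_l _ (xyi b) a Dp) addr0 mul0r.
  rewrite add0r big1 ?mulr0// => b _; rewrite big1// => c _.
  by rewrite (dz_l p b Dp) (dz_l p c Dp) mul0r mulr0 addr0 mulr0.
rewrite (lie_conn_product_z oU oI mh k0 v _ _ Dp) (d2_z _ zi zi Dp) mulr0 addr0.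
rewrite [X in X + _]big1 => [|b _]; last first.
  rewrite big1// => c _; rewrite (d2_z _ (xyi b) (xyi c) Dp) big1 => [|e _].
    by rewrite subrr !mul0r.
  by rewrite (db_z p e Dp) mulr0.
rewrite add0r big1 ?mulr0// => b _.
by rewrite (d2_z _ (xyi b) zi Dp) (d2_z _ zi (xyi b) Dp) addr0 mul0r.
Qed.

Hypotheses (cU : connected U) (iI : is_interval I).

Lemma horizontally_constant (f : 'rV[R]_(2 + 1) -> R) x0 x z : Ck D 1 f ->
  (forall p b, D p -> pd (xyi b) f p = 0) ->
  U x0 -> U x -> I z -> f (vec3 x z) = f (vec3 x0 z).
Proof.
move=> Cf f0 Ux0 Ux Iz; apply/eqP; rewrite -subr_eq0; apply/eqP.
have C1 : Ck U 1 (fun x => f (vec3 x z)) by exact: (Ck_vec3 Iz Cf).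
have C0 := CkN oU (Ck_cst U 1 (f (vec3 x0 z))).
apply: (@unique_continuation R 2 U oU cU unit (fun _ x => f (vec3 x z) - f (vec3 x0 z))
  (fun _ _ _ _ => 0) x0 _ _ _ Ux0 _ x tt Ux) => [_|_ _ _|q a _ Uq|_].
- exact: CkD.
- exact: Ck_cst.
- rewrite (pd_add a C1 C0 Uq) pd_vec3 (f0 _ a (Dvec Uq Iz)) add0r.
  rewrite (pd_opp a (Ck_cst U 1 (f (vec3 x0 z))) Uq) /pd derive_cst oppr0.
  by rewrite big1// => c _; rewrite mul0r.
- by rewrite subrr.
Qed.

Lemma vertically_constant (f : 'rV[R]_(2 + 1) -> R) x z z' : Ck D 1 f ->
  (forall p, D p -> pd zi f p = 0) ->
  U x -> I z -> I z' -> f (vec3 x z') = f (vec3 x z).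
Proof.
move=> Cf f0 Ux Iz Iz'; apply/eqP; rewrite -subr_eq0; apply/eqP.
have vE (t : R) : vec3 x t = t *: delta_mx 0 zi + vec3 x 0.
  apply/rowP => i; rewrite [RHS]mxE [X in _ = X + _]mxE.
  case: (I3_cases i) => [[a]|] ->.
    by rewrite !vec3_l mxE eq_lrshift ?andbF mulr0 add0r.
  by rewrite !vec3_z mxE !eqxx mulr1 addr0.
have It (t : R) : 0 <= t <= 1 -> I (z + t * (z' - z)).
  move=> /andP[t0 t1]; have [zz'|/ltW zz'] := leP z z'.
    apply: (iI Iz Iz'); rewrite lerDl mulr_ge0 ?subr_ge0//= -lerBrDl.
    by rewrite ler_piMl// subr_ge0.
  apply: (iI Iz' Iz); rewrite gerDl mulr_ge0_le0 ?subr_le0// andbT.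
  by rewrite -lerBlDl ler_niMl// subr_le0.
have [t t01|t t01 ->] := @mvt_between R (fun t => f (vec3 x t))
  (fun t => pd zi f (vec3 x t)) z z'.
  have := is_derive_line (f := f) (p := vec3 x 0) (v := delta_mx 0 zi) (s := z + t * (z' - z)).
  rewrite -vE => /(_ (Ck_derivable Cf (Dvec Ux (It t t01)))).
  by under eq_fun do rewrite -vE.
by rewrite f0 ?mul0r//; exact: Dvec (It t t01).
Qed.

Hypothesis proj : projective_field D G v.

Let w (q : 'rV[R]_(2 + 1)) : R := v q 0 zi.
Let Cv i r : Ck D r (fun q => v q 0 i). Proof. exact: sv. Qed.

(** The relation between the vertical and the horizontal components of the condition
    that [L(X)] is parallel to [X], for [X = x + t d/dz], compared power by power in
    [t]. *)
Let split_conditions p (x : 'rV[R]_2) : D p -> forall a,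
  [/\ (\sum_b \sum_c (pd (xyi b) (pd (xyi c) w) p
         - \sum_d Γ h (xy p) d b c * pd (xyi d) w p) * x 0 b * x 0 c) * x 0 a = 0,
      (\sum_b (pd (xyi b) (pd zi w) p + pd zi (pd (xyi b) w) p) * x 0 b) * x 0 a =
        lie_conn h (slice v (zc p)) (xy p) x 0 a,
      pd zi (pd zi w) p * x 0 a =
        \sum_b (pd (xyi b) (dmx zi v 0 (xyi a)) p
           + pd zi (dmx (xyi b) v 0 (xyi a)) p) * x 0 b
        + \sum_b \sum_c Γ h (xy p) a b c *
            (dmx zi v 0 (xyi b) p * x 0 c
             + x 0 b * dmx zi v 0 (xyi c) p)
    & pd zi (dmx zi v 0 (xyi a)) p = 0].
Proof.
move=> Dp a; apply: cubic_match => t.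
have := projective_lie_conn oD mG sv (vec3 x t) zi (xyi a) proj Dp.
rewrite (lie_conn_product_l oU oI mh k0 v x t a Dp).
rewrite (lie_conn_product_z oU oI mh k0 v x t Dp) vec3_l vec3_z -/w.
exact: cross_products.
Qed.

(** The coefficient of [t^0] is the covariant Hessian of [w] as a quadratic form on
    the slice. *)
Lemma projective_form_parallel x z a b : U x -> I z ->
  pd (xyi a) (pd (xyi b) w) (vec3 x z) =
  \sum_d Γ h x d a b * pd (xyi d) w (vec3 x z).
Proof.
move=> Ux Iz; have Dp := Dvec Ux Iz.
pose C b c := pd (xyi b) (pd (xyi c) w) (vec3 x z) - \sum_d Γ h x d b c * pd (xyi d) w (vec3 x z).
have CC : C 0 1 = C 1 0.
  rewrite /C (pdC (xyi 0) (xyi 1) oD (Cv zi 2%N) Dp); congr (_ - _).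
  by apply: eq_bigr => d _; rewrite (christoffelC d 0 1 oU mh Ux).
have Q x0 x1 : C 0 0 * x0 * x0 + C 0 1 * x0 * x1 + (C 1 0 * x1 * x0 + C 1 1 * x1 * x1) = 0.
  pose X : 'rV[R]_2 := \row_j (if j == 0 then x0 else x1).
  have X0 : X 0 0 = x0 by rewrite mxE.
  have X1 : X 0 1 = x1 by rewrite mxE.
  have H a' : (C 0 0 * x0 * x0 + C 0 1 * x0 * x1 + (C 1 0 * x1 * x0 + C 1 1 * x1 * x1)) * X 0 a' = 0.
    have [H _ _ _] := split_conditions X Dp a'; rewrite xy_vec3 in H.
    rewrite -[RHS]H; congr (_ * _); rewrite sum_I2 -X0 -X1.
    by congr (_ + _); rewrite sum_I2.
  have H0 := H 0; have H1 := H 1; rewrite X0 in H0; rewrite X1 in H1.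
  exact: form_cancel H0 H1.
have [C0 C1 C2] := quadratic_form0 CC Q.
apply/eqP; rewrite -subr_eq0 -/(C a b); apply/eqP.
case: (I2_cases a) => ->; case: (I2_cases b) => ->;
  [exact: C0|exact: C1|rewrite -CC; exact: C1|exact: C2].
Qed.

Variable p1 : 'rV[R]_(2 + 1).
Hypotheses (Dp1 : D p1) (nf : nonflat_at h (xy p1)).
Let x1 := xy p1.
Let Ux1 : U x1. Proof. by case: Dp1. Qed.

Let vecE p : D p -> [/\ U (xy p), I (zc p) & p = vec3 (xy p) (zc p)].
Proof. by move=> [Up Ip]; rewrite vec3_xyz. Qed.

(** The curvature annihilates the parallel form [dw], so it vanishes at the non-flat
    point and then on the whole slice. *)
Let dw0 p b : D p -> pd (xyi b) w p = 0.
Proof.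
move=> Dp; have [Up Iz ->] := vecE Dp.
have CW c r : Ck U r (fun x => pd (xyi c) w (vec3 x (zc p))).
  by exact: (Ck_vec3 Iz (Ck_pd _ (Cv zi r.+1))).
have par q a c : U q -> pd a (fun x => pd (xyi c) w (vec3 x (zc p))) q =
    \sum_d Γ h q d a c * pd (xyi d) w (vec3 q (zc p)).
  by move=> Uq; rewrite pd_vec3; exact: projective_form_parallel.
have W0 c : pd (xyi c) w (vec3 x1 (zc p)) = 0.
  move: c; apply: (nonflat_form oU mh (w := fun c => pd (xyi c) w (vec3 x1 (zc p))) Ux1 nf) => e.
  exact: (@parallel_form_curvature R U h oU mh (fun c x => pd (xyi c) w (vec3 x (zc p)))
    x1 1 e 0 (fun c => CW c 2%N) par Ux1).
apply: (@unique_continuation R 2 U oU cU 'I_2 (fun c x => pd (xyi c) w (vec3 x (zc p)))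
  (fun a c d x => Γ h x d a c) x1 _ _ _ Ux1 _ (xy p) b Up).
- by move=> c; exact: CW.
- by move=> a c d; exact: smooth_christoffel.
- exact: par.
- exact: W0.
Qed.

Let dbz_w p b : D p -> pd (xyi b) (pd zi w) p = 0.
Proof.
move=> Dp; rewrite (pdC (xyi b) zi oD (Cv zi 2%N) Dp).
exact: (@pd_zero (pd (xyi b) w) zi p 0 (fun q => @dw0 q b) Dp).
Qed.

Let dbzz_w p b : D p -> pd (xyi b) (pd zi (pd zi w)) p = 0.
Proof.
move=> Dp; rewrite (pdC (xyi b) zi oD (Ck_pd zi (Cv zi 3%N)) Dp).
exact: (@pd_zero (pd (xyi b) (pd zi w)) zi p 0 (fun q => @dbz_w q b) Dp).
Qed.

(** The coefficient of [t^1], in which the mixed derivatives of [w] are now zero. *)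
Let slice_affine z x X : I z -> U x -> lie_conn h (slice v z) x X = 0.
Proof.
move=> Iz Ux; have Dp := Dvec Ux Iz; apply/rowP => a; rewrite [RHS]mxE.
have [_ H _ _] := split_conditions X Dp a; rewrite xy_vec3 zc_vec3 in H.
rewrite -H big1 ?mul0r// => b _.
have E1 := dbz_w b Dp; have E2 := pdC zi (xyi b) oD (Cv zi 2%N) Dp.
by rewrite E2 E1 addr0 mul0r.
Qed.

Let y (z : R) (a : 'I_2) (x : 'rV[R]_2) : R := dmx zi v 0 (xyi a) (vec3 x z).

Let Cy z a r : I z -> Ck U r (y z a).
Proof. by move=> Iz; exact: (Ck_vec3 Iz (Ck_pd zi (Cv (xyi a) r.+1))). Qed.

Let phi z := pd zi (pd zi w) (vec3 x1 z) / 2.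

(** The coefficient of [t^2].  As [dw] vanishes on slices, [d_z^2 w] is constant on
    each of them, and may be evaluated over the fixed point [x1]. *)
Let y_conformal z x a b : I z -> U x ->
  pd b (y z a) x + \sum_c Γ h x a b c * y z c x = (a == b)%:R * phi z.
Proof.
move=> Iz Ux; have Dp := Dvec Ux Iz.
have phiE : pd zi (pd zi w) (vec3 x z) = pd zi (pd zi w) (vec3 x1 z).
  apply: (@horizontally_constant (pd zi (pd zi w)) x1 x z) => //.
  exact: (Ck_pd zi (Ck_pd zi (Cv zi 3%N))).
have pdy c : pd c (y z a) x = pd (xyi c) (dmx zi v 0 (xyi a)) (vec3 x z).
  exact: (pd_vec3 (dmx zi v 0 (xyi a)) z c x).
have GC i j e : Γ h x i j e = Γ h x i e j.
  exact: christoffelC oU mh Ux.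
have Q (s0 s1 : R) : (pd 0 (y z a) x + pd 0 (y z a) x) * s0 + (pd 1 (y z a) x + pd 1 (y z a) x) * s1
   + (Γ h x a 0 0 * (y z 0 x * s0 + s0 * y z 0 x)
      + Γ h x a 0 1 * (y z 0 x * s1 + s0 * y z 1 x)
   + (Γ h x a 0 1 * (y z 1 x * s0 + s1 * y z 0 x)
      + Γ h x a 1 1 * (y z 1 x * s1 + s1 * y z 1 x)))
   = ((a == 0)%:R * (phi z * 2)) * s0 + ((a == 1)%:R * (phi z * 2)) * s1.
  pose X : 'rV[R]_2 := \row_j (if j == 0 then s0 else s1).
  have X0 : X 0 0 = s0 by rewrite mxE.
  have X1 : X 0 1 = s1 by rewrite mxE.
  have [_ _ H _] := split_conditions X Dp a; rewrite xy_vec3 phiE in H.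
  have -> : (a == 0)%:R * (phi z * 2) * s0 + (a == 1)%:R * (phi z * 2) * s1 =
      pd zi (pd zi w) (vec3 x1 z) * X 0 a.
    have n2 : (2 : R) != 0 by rewrite pnatr_eq0.
    rewrite /phi (divfK n2).
    by case: (I2_cases a) => ->; rewrite ?X0 ?X1 eqxx /= mul1r ?mul0r ?add0r ?addr0// !mul0r ?add0r ?addr0.
  rewrite H; congr (_ + _).
    rewrite sum_I2 X0 X1.
    have C c := pdC zi (xyi c) oD (Cv (xyi a) 2%N) Dp.
    by rewrite (C 0) (C 1) -(pdy 0) -(pdy 1).
  rewrite sum_I2; congr (_ + _); rewrite sum_I2 X0 X1; first by [].
  by rewrite (GC a 1 0).
have [E0 E1] := linear_match Q.
rewrite sum_I2; case: (I2_cases b) => ->.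
  by rewrite E0 mulrA mulfK.
by rewrite (GC a 1 0) E1 mulrA mulfK.
Qed.

Lemma nonflat_near : \forall x \near x1, U x /\ nonflat_at h x.
Proof.
have [a [b [c [d n0]]]] := nf.
have CR : Ck U 0 (fun x => riemann h x a b c d).
  have sG i j e : smooth U (fun q => Γ h q i j e) by exact: smooth_christoffel.
  rewrite /riemann; apply: CkD => //.
    apply: CkB => //; [exact: Ck_pd (sG a d b 1%N)|exact: Ck_pd (sG a c b 1%N)].
  by apply: Ck_sum => // m; apply: CkB => //; apply: CkM => //; exact: sG.
have cR := Ck_continuous CR Ux1.
have e0 : 0 < `|riemann h x1 a b c d| by rewrite normr_gt0.
have N1 : \forall x \near x1, U x by exact: open_nbhs_nbhs.
have N2 : \forall x \near x1, `|riemann h x1 a b c d - riemann h x a b c d| < `|riemann h x1 a b c d|.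
  exact: (cvgrPdist_lt _ _).1 cR _ e0.
have N : \forall x \near x1, U x /\
    `|riemann h x1 a b c d - riemann h x a b c d| < `|riemann h x1 a b c d|.
  exact: (filterI (F := nbhs x1) N1 N2).
apply: filterS N => x [Ux lt]; split; first exact: Ux.
exists a, b, c, d; apply: contraTneq lt => ->.
by rewrite subr0 ltxx.
Qed.

(** The integrability condition is needed on a neighbourhood, and not only at [x1],
    because the vanishing of [y] at one point says nothing about [phi]. *)
Let y_near z : I z -> \forall x \near x1, forall a, y z a x = 0.
Proof.
move=> Iz; apply: filterS nonflat_near => x [Ux nx] a.
move: a; apply: (nonflat_vector oU mh (y := fun a => y z a x) Ux nx) => b.
exact: (@conformal_gradient_curvature R U h oU mh (y z) (phi z) x b 1 0
  (fun a => Cy a 2%N Iz) (fun q a c Uq => y_conformal a c Iz Uq) Ux).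
Qed.

Let y_at z a : I z -> y z a x1 = 0.
Proof. by move=> Iz; have := nbhs_singleton (y_near Iz); exact. Qed.

Let phi0 z : I z -> phi z = 0.
Proof.
move=> Iz; have := y_conformal 0 0 Iz Ux1; rewrite eqxx mul1r => <-.
rewrite big1 ?addr0 => [|c _]; last by rewrite y_at// mulr0.
have E : \forall x \near x1, y z 0 x = (fun=> 0) x.
  by apply: filterS (y_near Iz) => x; exact.
by rewrite /pd (near_eq_derive _ E) derive_cst.
Qed.

(** With [phi = 0] the field [y] is parallel on the slice. *)
Let y0 z x a : I z -> U x -> y z a x = 0.
Proof.
move=> Iz Ux; apply: (@unique_continuation R 2 U oU cU 'I_2 (y z)
  (fun b a c x => - Γ h x a b c) x1 _ _ _ Ux1 _ x a Ux).
- by move=> c; exact: Cy.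
- by move=> b c d; apply: CkN => //; exact: smooth_christoffel.
- move=> q b c Uq; have := y_conformal c b Iz Uq; rewrite (phi0 Iz) mulr0 => /eqP.
  rewrite addr_eq0 => /eqP ->; rewrite -sumrN; apply: eq_bigr => d _.
  by rewrite mulNr.
- by move=> c; exact: y_at.
Qed.

(** The horizontal part of [v] is independent of [z] because [y = 0], and the
    vertical part is affine in [z] because its only possibly non-zero derivative is
    [d_z w], which is constant. *)
Lemma projective_homothetic :
  exists (u : 'rV[R]_2 -> 'rV[R]_2) (c0 c1 : R), homothetic_field U h u /\
    forall p, D p -> v p = vec3 (u (xy p)) (c1 * zc p + c0).
Proof.
have [_ Iz1] := Dp1; pose z1 := zc p1.
have dz_l p a : D p -> dmx zi v 0 (xyi a) p = 0.
  by move=> Dp; have [Up Iz ->] := vecE Dp; exact: y0.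
have dzz_w p : D p -> pd zi (pd zi w) p = 0.
  move=> Dp; have [Up Iz ->] := vecE Dp.
  rewrite (@horizontally_constant (pd zi (pd zi w)) x1 _ _ _ _ Ux1 Up Iz) //.
    by have /eqP := phi0 Iz; rewrite /phi mulf_eq0 invr_eq0 pnatr_eq0 orbF => /eqP.
  exact: (Ck_pd zi (Ck_pd zi (Cv zi 3%N))).
pose c1 := pd zi w (vec3 x1 z1).
have dz_w p : D p -> pd zi w p = c1.
  move=> Dp; have [Up Iz ->] := vecE Dp; have C1 := Ck_pd zi (Cv zi 2%N).
  rewrite (horizontally_constant C1 dbz_w Ux1 Up Iz).
  exact: (vertically_constant C1 dzz_w Ux1 Iz1 Iz).
(* [w] minus its linear part has vanishing differential. *)
pose r q := w q - c1 * q 0 zi.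
have Clin : Ck D 1 (fun q => c1 * q 0 zi).
  by apply: CkM => //; [exact: Ck_cst|exact: Ck_coord].
have Cr : Ck D 1 r by exact: (CkB oD (Cv zi 1%N) Clin).
have dr p i : D p -> pd i r p = pd i w p - c1 * (delta_mx 0 i : 'rV[R]_(2 + 1)) 0 zi.
  move=> Dp; rewrite (pd_add i (Cv zi 1%N) (CkN oD Clin) Dp) (pd_opp i Clin Dp).
  rewrite (pd_scale i c1 (Ck_coord 1 zi oD) Dp).
  congr (_ - _ * _); by have [_] := is_derive_coord p (delta_mx 0 i) zi.
have dr_l p b : D p -> pd (xyi b) r p = 0.
  by move=> Dp; rewrite dr// dw0// mxE eq_rlshift ?andbF mulr0 subr0.
have dr_z p : D p -> pd zi r p = 0.
  by move=> Dp; rewrite dr// dz_w// mxE !eqxx mulr1 subrr.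
have rE p : D p -> r p = r (vec3 x1 z1).
  move=> Dp; have [Up Iz ->] := vecE Dp.
  rewrite (horizontally_constant Cr dr_l Ux1 Up Iz).
  exact: (vertically_constant Cr dr_z Ux1 Iz1 Iz).
exists (slice v z1), (r (vec3 x1 z1)), c1; split.
  have su := smooth_slice oU sv Iz1; split; first exact: su.
  have [lam lamP] := affine_homothetic oU mh cU su Ux1 nf
    (fun x X Ux => slice_affine X Iz1 Ux).
  by exists lam.
move=> p Dp; have [Up Iz pE] := vecE Dp; apply/rowP => i.
case: (I3_cases i) => [[a]|] ->.
  rewrite vec3_l mxE {1}pE.
  exact: (vertically_constant (Cv (xyi a) 1%N) (fun q => @dz_l q a) Up Iz1 Iz).
by rewrite vec3_z -(rE p Dp) /r /zc [rsubmx p _ _]mxE addrC subrK.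
Qed.

End ProductField.

Theorem corollary3 (R : realType) (U : set 'rV[R]_2) (I : set R)
    (h : 'rV[R]_2 -> 'M[R]_2) (k : R) :
  open U -> connected U -> open_interval I ->
  is_metric U h ->
  k != 0 ->
  ~ constant_curvature (product_metric k h) (cylinder U I) ->
  forall v : 'rV[R]_(2 + 1) -> 'rV[R]_(2 + 1),
    vector_field (cylinder U I) v ->
    projective_field (cylinder U I) (product_metric k h) v <->
    exists (u : 'rV[R]_2 -> 'rV[R]_2) (k0 k1 : R),
      homothetic_field U h u /\
      forall p, cylinder U I p ->
        v p = vec3 (u (xy p)) (k1 * zc p + k0).
Proof.
move=> oU cU [oI iI] mh kn0 ncc v sv; split=> [proj|[u [k0 [k1 [hu vE]]]]]; last first.
  exact: (homothetic_projective oU oI mh kn0 sv hu vE).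
have [p Dp nf] : exists2 p, cylinder U I p & nonflat_at h (xy p).
  apply: contrapT => flat; apply: ncc.
  apply: (flat_product_constant_curvature oU oI mh kn0) => p Dp a b c d.
  apply/eqP/negP => /negP Rn0; apply: flat; exists p => //.
  by exists a, b, c, d.
exact: (projective_homothetic oU oI mh kn0 sv cU iI proj Dp nf).
Qed.
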